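(* Let $\lambda=0$. Suppose that $n$ is an integer with $1\le n\le q$ such that $F_i(x,y)\equiv0$ and $G_i(x,y)\equiv 0$ for all $i<n$, and such that $G_{n+l}(0,0)=0$ for all $0\le l<n$ and $$G_{2n}(0,0)-F_n(0,0)\big(\partial_yG_n(0,0)+\delta_{n,q}\big)\neq0.$$ Put $$\Delta_n=\big(\partial_xG_n(0,0)\big)^2-4w(0)\Big(\big(\partial_yG_n(0,0)+\delta_{n,q}\big)F_n(0,0)-G_{2n}(0,0)\Big).$$ If $\Delta_n>0$, then the perturbed system $$\frac{dx}{dt}=\partial_y H(x,y;\lambda)+F(x,y,t),\qquad \frac{dy}{dt}=-\partial_x H(x,y;\lambda)+G(x,y,t)$$ has two different solutions $x_\ast(t),y_\ast(t)$, one for each choice of sign in $x_n=\nu_\pm$, with asymptotic expansion of the form $$x_\ast(t)=\sum_{k=n}^{\infty}t^{-\frac{k}{q}}x_k,\qquad y_\ast(t)=\sum_{k=n}^{\infty}t^{-\frac{k}{q}}y_k,\qquad t\to\infty,$$ with constant real coefficients $x_k,y_k$, where $$\nu_\pm=\frac{1}{2w(0)}\Big(\partial_xG_n(0,0)\pm\sqrt{\Delta_n}\Big).$$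
   Context: Standing setting. The functions $H(x,y;\lambda)$, $F(x,y,t)$, $G(x,y,t)$ are smooth for all $(x,y)\in\mathbb R^2$, $t>0$, $\lambda\in\mathbb R$. The Hamiltonian of the limiting system is $H(x,y;\lambda)=\frac{y^2}{2}+V(x;\lambda)$ with $\partial_xV(x;\lambda)=(x^2-\lambda)w(x)$, where, for some $d_0>0$, $w(x)>0$ for all $(x,\lambda)\in\{|x|<\sqrt\lambda+d_0,\ \lambda\ge 0\}\cup\{|x|<d_0,\ \lambda<0\}$. The perturbations satisfy $F(x,y,t)\to0$ and $G(x,y,t)\to0$ as $t\to\infty$ for $(x,y)$ in any compact subset of $\mathbb R^2$, and have power-law asymptotics $$F(x,y,t)=\sum_{k=1}^\infty t^{-\frac kq}F_k(x,y),\qquad G(x,y,t)=\sum_{k=1}^\infty t^{-\frac kq}G_k(x,y),\qquad t\to\infty,$$ where $q$ is a positive integer and $F_k,G_k$ are smooth functions on $\mathbb R^2$. Infinite series followed by ''$t\to\infty$'' are understood as asymptotic expansions. The coefficients $x_k,y_k$ of the solutions' expansions are obtained by substituting the series into the system and equating the coefficients of equal powers of $t$. $\delta_{n,q}$ is the Kronecker delta. *)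

(* Defs.v *)
From Stdlib Require Import Reals Lra Lia.
From Coquelicot Require Import Coquelicot.
Open Scope R_scope.

Definition pdx (g : R -> R -> R) (x y : R) : R := Derive (fun u => g u y) x.
Definition pdy (g : R -> R -> R) (x y : R) : R := Derive (fun v => g x v) y.

(* Class C^m in (x, y, s) on the open set {(x, y, s) | I s}; I is meant to be
   an open subset of R. *)
Fixpoint Ck3 (m : nat) (I : R -> Prop) (f : R -> R -> R -> R) : Prop :=
  match m with
  | O => forall x y s : R, I s ->
      continuous (fun p : R * R * R => f (fst (fst p)) (snd (fst p)) (snd p))
                 (x, y, s)
  | S m' =>
      (forall x y s : R, I s ->
         ex_derive (fun u => f u y s) x /\
         ex_derive (fun u => f x u s) y /\
         ex_derive (fun u => f x y u) s) /\
      Ck3 m' I (fun x y s => Derive (fun u => f u y s) x) /\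
      Ck3 m' I (fun x y s => Derive (fun u => f x u s) y) /\
      Ck3 m' I (fun x y s => Derive (fun u => f x y u) s)
  end.

Definition smooth3 (I : R -> Prop) (f : R -> R -> R -> R) : Prop :=
  forall m, Ck3 m I f.

Fixpoint Ck2 (m : nat) (f : R -> R -> R) : Prop :=
  match m with
  | O => forall x y : R, continuous (fun p : R * R => f (fst p) (snd p)) (x, y)
  | S m' =>
      (forall x y : R, ex_derive (fun u => f u y) x /\ ex_derive (fun u => f x u) y) /\
      Ck2 m' (pdx f) /\ Ck2 m' (pdy f)
  end.

Definition smooth2 (f : R -> R -> R) : Prop := forall m, Ck2 m f.

(* t^(-k/q), for t > 0 *)
Definition tpow (q k : nat) (t : R) : R := Rpower t (- (INR k / INR q)).

(* Uniformity on compact subsets of the plane is uniformity on every square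
   [-r, r] x [-r, r]. *)
Definition vanishes_on_compacts (F : R -> R -> R -> R) : Prop :=
  forall r eps, 0 < eps ->
    Rbar_locally p_infty (fun t => forall x y, Rabs x <= r -> Rabs y <= r ->
      Rabs (F x y t) <= eps).

(* F(x,y,t) = sum_(k >= 1) t^(-k/q) F_k(x,y) as t -> +oo, in the sense of
   Poincare, uniformly on compact subsets; the series need not converge, and
   nothing is assumed on the derivatives of the remainders. *)
Definition expansion_on_compacts (q : nat) (F : R -> R -> R -> R)
    (Fk : nat -> R -> R -> R) : Prop :=
  forall (N : nat) r eps, 0 < eps ->
    Rbar_locally p_infty (fun t => forall x y, Rabs x <= r -> Rabs y <= r ->
      Rabs (F x y t - sum_n_m (fun k => tpow q k t * Fk k x y) 1 N)
        <= eps * tpow q N t).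

(* The power-law perturbations; the value at k = 0 of Fk is irrelevant. *)
Definition perturbation (q : nat) (F : R -> R -> R -> R)
    (Fk : nat -> R -> R -> R) : Prop :=
  smooth3 (fun t => 0 < t) F /\
  (forall k, (1 <= k)%nat -> smooth2 (Fk k)) /\
  vanishes_on_compacts F /\
  expansion_on_compacts q F Fk.

(* f(t) = o(t^(-N/q)) as t -> +oo *)
Definition little_o (q N : nat) (f : R -> R) : Prop :=
  forall eps, 0 < eps ->
    Rbar_locally p_infty (fun t => Rabs (f t) <= eps * tpow q N t).

Definition psum (q n : nat) (a : nat -> R) (N : nat) (t : R) : R :=
  sum_n_m (fun k => tpow q k t * a k) n N.

(* f(t) = sum_(k >= n) t^(-k/q) a_k as t -> +oo; sum_n_m is 0 when N < n. *)
Definition expansion (q n : nat) (f : R -> R) (a : nat -> R) : Prop :=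
  forall N, little_o q N (fun t => f t - psum q n a N t).

Definition xrhs (H : R -> R -> R -> R) (lam : R) (F : R -> R -> R -> R)
    (x y t : R) : R := Derive (fun v => H x v lam) y + F x y t.
Definition yrhs (H : R -> R -> R -> R) (lam : R) (G : R -> R -> R -> R)
    (x y t : R) : R := - Derive (fun u => H u y lam) x + G x y t.

Definition solution (f g : R -> R -> R -> R) (T : R) (x y : R -> R) : Prop :=
  forall t, T < t ->
    is_derive x t (f (x t) (y t) t) /\ is_derive y t (g (x t) (y t) t).

(* The formal series satisfy the system: the coefficients of t^(-k/q) agree for
   all k <= N on substitution. Those coefficients only involve a_k, b_k with
   k <= N, so this is expressed by the residual of the N-th partial sums. *)
Definition formal_solution (q n : nat) (f g : R -> R -> R -> R)
    (a b : nat -> R) : Prop :=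
  forall N,
    little_o q N (fun t => Derive (psum q n a N) t
                           - f (psum q n a N t) (psum q n b N t) t) /\
    little_o q N (fun t => Derive (psum q n b N) t
                           - g (psum q n a N t) (psum q n b N t) t).

Definition has_expansion_solution (q n : nat) (f g : R -> R -> R -> R)
    (nu T : R) (x y : R -> R) : Prop :=
  solution f g T x y /\
  exists a b : nat -> R,
    a n = nu /\ expansion q n x a /\ expansion q n y b /\
    formal_solution q n f g a b.

Definition kron (n q : nat) : R := if Nat.eqb n q then 1 else 0.

Definition Delta_n (q n : nat) (w0 : R) (Fk Gk : nat -> R -> R -> R) : R :=
  (pdx (Gk n) 0 0) ^ 2
  - 4 * w0 * ((pdy (Gk n) 0 0 + kron n q) * Fk n 0 0 - Gk (2 * n)%nat 0 0).

(* Main.v *)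
Require Import Defs.
From Stdlib Require Import Reals Lra Lia ClassicalEpsilon FunctionalExtensionality.
From Coquelicot Require Import Coquelicot.
Open Scope R_scope.

(** Write e = t^(-1/q), so that d/dt = -(1/q) e^(q+1) d/de. The system reads
    x' = f, y' = g, where f has the expansion y + sum_k e^k F_k and g the expansion
    - x^2 w(x) + sum_k e^k G_k.

    Formal solution. At order e^n the x-equation gives y_n = - F_n(0,0). The
    y-equation begins at order e^(2n), where it is the quadratic equation
    w(0) x_n^2 - dxG_n x_n - G_(2n) + (dyG_n + delta) F_n = 0 for x_n (values at the
    origin); its discriminant is Delta_n and its roots are nu_+ and nu_-. At every
    later order the x-equation gives the next y_k, and then the y-equation is linear
    in the next x_k with coefficient sigma = 2 w(0) x_n - dxG_n, which is
    + sqrt Delta_n or - sqrt Delta_n and does not vanish. See [formal_base],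
    [formal_step], [formal_series].

    True solutions. The deviation (u, v) of (x, y) from a partial sum satisfies
    u' = a u + b v + h1, v' = - c u + d v + h2, where b tends to 1, c is
    asymptotic to sigma e^n, a and d are O(e^n), and (h1, h2) consists of terms
    quadratic in (u, v) and of a residual of high order in e. The remainders of the
    expansions of F and G are small in value but their derivatives are not
    controlled, so there is no contraction on a half-line. Instead solutions in a
    thin tube are found on each finite interval [T, T + j], by boundary conditions
    suited to the linear part, and a subsequence of their initial values converges
    to that of a solution in the tube for all time ([solution_of_finite_horizons]).
    This rests on estimates of the linear system that lose only a fixed power of t,
    while the order of the partial sum is arbitrary:
    - if sigma < 0, the system is a saddle with rate s = sqrt(-sigma e^n), large
      against 1/t. One shoots along v = s u ([saddle_finite_horizon]).
    - if sigma > 0, the solutions rotate. The quadratic form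
      c u^2 + (a - d) u v + b v^2 is multiplied by exp of the integral of a + d, up to
      a power of t ([form_derivative_estimate]). As a + d is a smooth function of
      e, it is eventually either at least - C/t, and the tube is preserved backward in
      time ([expanding_barrier]), or below - K/t for every K, and the tube is
      preserved forward ([contracting_barrier]).

    The same estimates, applied to the solution already found, show that its
    deviation from the partial sum of any order is as small as that order permits
    ([tracking_all_orders]), which is the full expansion. The two solutions differ
    because their coefficients x_n do. *)

(** * Continuous and C^1 functions on boxes *)

Lemma countable_choice (A : Type) (P : nat -> A -> Prop) :
  (forall k, exists a, P k a) -> exists s : nat -> A, forall k, P k (s k).
Proof.
  intros HP.
  exists (fun k => proj1_sig (constructive_indefinite_description _ (HP k))).
  intros k. apply proj2_sig.
Qed.

Lemma bounded_subsequence (s : nat -> R) (lo hi : R) :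
  (forall k, lo <= s k <= hi) ->
  exists (l : R) (phi : nat -> nat), lo <= l <= hi /\ (forall k, (k <= phi k)%nat) /\
    (forall eps, 0 < eps -> exists N, forall k, (N <= k)%nat ->
       Rabs (s (phi k) - l) < eps).
Proof.
  intros Hs.
  destruct (Bolzano_Weierstrass s (fun x => lo <= x <= hi)
              (compact_P3 lo hi) Hs) as [l Hl].
  destruct (countable_choice nat
              (fun k p => (k <= p)%nat /\ Rabs (s p - l) < / (INR k + 1))) as [phi Hphi].
  { intros k.
    assert (Hk : 0 < / (INR k + 1)) by (apply Rinv_0_lt_compat; pose proof (pos_INR k); lra).
    destruct (Hl (disc l (mkposreal _ Hk)) k) as [p [Hp1 Hp2]].
    { exists (mkposreal _ Hk). intros y Hy. exact Hy. }
    exists p. split; [exact Hp1 | exact Hp2]. }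
  assert (Hlim : forall eps, 0 < eps -> exists N, forall k, (N <= k)%nat ->
       Rabs (s (phi k) - l) < eps).
  { intros eps He. destruct (archimed_cor1 eps He) as [N [HN1 HN2]].
    exists N. intros k Hk. destruct (Hphi k) as [_ H].
    apply Rlt_trans with (1 := H). apply Rle_lt_trans with (2 := HN1).
    apply Rinv_le_contravar. { apply lt_0_INR; lia. }
    apply le_INR in Hk. lra. }
  exists l, phi. split; [ | split].
  - split; apply Rnot_lt_le; intros Hc.
    + destruct (Hlim (lo - l)) as [N HN]; [lra|].
      specialize (HN N (Nat.le_refl N)). specialize (Hs (phi N)).
      apply Rabs_def2 in HN. lra.
    + destruct (Hlim (l - hi)) as [N HN]; [lra|].
      specialize (HN N (Nat.le_refl N)). specialize (Hs (phi N)).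
      apply Rabs_def2 in HN. lra.
  - intros k. apply Hphi.
  - exact Hlim.
Qed.

Definition cont3 (f : R -> R -> R -> R) (x y s : R) : Prop :=
  continuous (fun p : R * R * R => f (fst (fst p)) (snd (fst p)) (snd p)) (x, y, s).

Definition cont2 (f : R -> R -> R) (x y : R) : Prop :=
  continuous (fun p : R * R => f (fst p) (snd p)) (x, y).

Lemma cont3_eps (f : R -> R -> R -> R) (x y s : R) :
  cont3 f x y s ->
  forall eps, 0 < eps -> exists delta, 0 < delta /\ forall x' y' s',
    Rabs (x' - x) < delta -> Rabs (y' - y) < delta -> Rabs (s' - s) < delta ->
    Rabs (f x' y' s' - f x y s) < eps.
Proof.
  intros Hc eps He.
  destruct (proj1 (filterlim_locally _ _) Hc (mkposreal eps He)) as [d Hd].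
  exists d. split. { apply cond_pos. }
  intros x' y' s' Hx Hy Hs.
  apply (Hd (x', y', s')). repeat split; assumption.
Qed.

Lemma cont2_cont3 (f : R -> R -> R) (x y s : R) :
  cont2 f x y -> cont3 (fun x y _ => f x y) x y s.
Proof.
  intros Hc. unfold cont3.
  apply (continuous_comp (fun p : R * R * R => fst p) (fun p : R * R => f (fst p) (snd p))).
  - apply continuous_fst.
  - exact Hc.
Qed.

Lemma continuous_on_box_bounded (f : R -> R -> R -> R) (r al be : R) :
  (forall x y s, Rabs x <= r -> Rabs y <= r -> al <= s <= be -> cont3 f x y s) ->
  exists M, 0 <= M /\ forall x y s, Rabs x <= r -> Rabs y <= r -> al <= s <= be ->
    Rabs (f x y s) <= M.
Proof.
  intros Hc.
  apply NNPP. intros Hn.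
  destruct (countable_choice (R * R * R) (fun k p =>
     Rabs (fst (fst p)) <= r /\ Rabs (snd (fst p)) <= r /\ al <= snd p <= be /\
     INR k < Rabs (f (fst (fst p)) (snd (fst p)) (snd p)))) as [p Hp].
  { intros k. apply NNPP. intros Hk. apply Hn. exists (INR k).
    split. { apply pos_INR. }
    intros x y s Hx Hy Hs. apply Rnot_lt_le. intros Hlt. apply Hk.
    exists (x, y, s). simpl. auto. }
  destruct (bounded_subsequence (fun k => fst (fst (p k))) (-r) r) as (x & f1 & Hx & Hf1 & Lx).
  { intros k. apply Rabs_le_between. apply Hp. }
  destruct (bounded_subsequence (fun k => snd (fst (p (f1 k)))) (-r) r) as (y & f2 & Hy & Hf2 & Ly).
  { intros k. apply Rabs_le_between. apply Hp. }
  destruct (bounded_subsequence (fun k => snd (p (f1 (f2 k)))) al be) as (s & f3 & Hs & Hf3 & Ls).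
  { intros k. apply Hp. }
  destruct (cont3_eps f x y s) with (eps := 1) as (d & Hd & Hfd).
  { apply Hc; try (apply Rabs_le_between; assumption); assumption. }
  { lra. }
  destruct (Lx d Hd) as [N1 HN1]. destruct (Ly d Hd) as [N2 HN2]. destruct (Ls d Hd) as [N3 HN3].
  destruct (INR_unbounded (Rabs (f x y s) + 1)) as [N4 HN4].
  set (N := (N1 + N2 + N3 + N4)%nat).
  set (k := f1 (f2 (f3 N))).
  assert (Hk3 : (N <= f3 N)%nat) by apply Hf3.
  assert (Hk2 : (f3 N <= f2 (f3 N))%nat) by apply Hf2.
  assert (Hk1 : (f2 (f3 N) <= k)%nat) by apply Hf1.
  assert (Hfk := Hfd (fst (fst (p k))) (snd (fst (p k))) (snd (p k))
           (HN1 (f2 (f3 N)) ltac:(lia)) (HN2 (f3 N) ltac:(lia)) (HN3 N ltac:(lia))).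
  destruct (Hp k) as (_ & _ & _ & Hbig).
  assert (HkN : INR N4 <= INR k) by (apply le_INR; lia).
  apply Rabs_def2 in Hfk.
  revert Hbig. unfold Rabs at 1.
  generalize (Rle_abs (f x y s)) (Rle_abs (- f x y s)); rewrite Rabs_Ropp.
  destruct (Rcase_abs _); lra.
Qed.

Lemma mvt_lipschitz (f : R -> R) (a b M : R) :
  (forall x, Rmin a b <= x <= Rmax a b -> ex_derive f x /\ Rabs (Derive f x) <= M) ->
  Rabs (f b - f a) <= M * Rabs (b - a).
Proof.
  intros H.
  destruct (MVT_gen f a b (Derive f)) as [c [Hc Heq]].
  - intros x Hx. apply Derive_correct. apply H. lra.
  - intros x Hx. apply derivable_continuous_pt. apply ex_derive_Reals_0. apply H; exact Hx.
  - rewrite Heq, Rabs_mult. apply Rmult_le_compat_r. { apply Rabs_pos. } apply H; exact Hc.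
Qed.

Lemma between_abs (a b c r : R) :
  Rabs a <= r -> Rabs b <= r -> Rmin a b <= c <= Rmax a b -> Rabs c <= r.
Proof.
  intros Ha Hb Hc. apply Rabs_le_between in Ha, Hb. apply Rabs_le_between.
  unfold Rmin, Rmax in Hc. destruct (Rle_dec a b); lra.
Qed.

Lemma C1_lipschitz_on_box (f : R -> R -> R -> R) (r al be : R) :
  (forall x y s, al <= s <= be -> ex_derive (fun u => f u y s) x /\ ex_derive (fun v => f x v s) y) ->
  (forall x y s, al <= s <= be -> cont3 (fun x y s => Derive (fun u => f u y s) x) x y s) ->
  (forall x y s, al <= s <= be -> cont3 (fun x y s => Derive (fun v => f x v s) y) x y s) ->
  exists L, 0 <= L /\ forall x y x' y' s,
    Rabs x <= r -> Rabs y <= r -> Rabs x' <= r -> Rabs y' <= r -> al <= s <= be ->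
    Rabs (f x y s - f x' y' s) <= L * (Rabs (x - x') + Rabs (y - y')).
Proof.
  intros Hd Hcx Hcy.
  destruct (continuous_on_box_bounded _ r al be (fun x y s _ _ h => Hcx x y s h)) as (Mx & HMx & Bx).
  destruct (continuous_on_box_bounded _ r al be (fun x y s _ _ h => Hcy x y s h)) as (My & HMy & By).
  exists (Mx + My). split; [lra|].
  intros x y x' y' s Hx Hy Hx' Hy' Hs.
  assert (H1 : Rabs (f x y s - f x' y s) <= Mx * Rabs (x - x')).
  { apply (mvt_lipschitz (fun u => f u y s)). intros z Hz. split. { exact (proj1 (Hd z y s Hs)). }
    apply (Bx z y s); try assumption. apply (between_abs x' x); assumption. }
  assert (H2 : Rabs (f x' y s - f x' y' s) <= My * Rabs (y - y')).
  { apply (mvt_lipschitz (fun v => f x' v s)). intros z Hz. split. { exact (proj2 (Hd x' z s Hs)). }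
    apply (By x' z s); try assumption. apply (between_abs y' y); assumption. }
  replace (f x y s - f x' y' s) with ((f x y s - f x' y s) + (f x' y s - f x' y' s)) by ring.
  eapply Rle_trans; [apply Rabs_triang|].
  pose proof (Rabs_pos (x - x')). pose proof (Rabs_pos (y - y')). nra.
Qed.

Lemma smooth2_ex_derive (f : R -> R -> R) (x y : R) :
  smooth2 f -> ex_derive (fun u => f u y) x /\ ex_derive (fun v => f x v) y.
Proof. intros Hf. apply (Hf 1%nat). Qed.

Lemma smooth2_pdx (f : R -> R -> R) : smooth2 f -> smooth2 (pdx f).
Proof. intros Hf m. apply (Hf (S m)). Qed.

Lemma smooth2_pdy (f : R -> R -> R) : smooth2 f -> smooth2 (pdy f).
Proof. intros Hf m. apply (Hf (S m)). Qed.

Lemma smooth2_lipschitz (f : R -> R -> R) (r : R) :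
  smooth2 f ->
  exists L, 0 <= L /\ forall x y x' y',
    Rabs x <= r -> Rabs y <= r -> Rabs x' <= r -> Rabs y' <= r ->
    Rabs (f x y - f x' y') <= L * (Rabs (x - x') + Rabs (y - y')).
Proof.
  intros Hf.
  destruct (C1_lipschitz_on_box (fun x y _ => f x y) r 0 0) as (L & HL & H).
  - intros x y _ _. exact (smooth2_ex_derive f x y Hf).
  - intros x y s _. apply (cont2_cont3 (pdx f)), (smooth2_pdx f Hf 0%nat).
  - intros x y s _. apply (cont2_cont3 (pdy f)), (smooth2_pdy f Hf 0%nat).
  - exists L. split; [exact HL|]. intros. apply (H x y x' y' 0); try assumption; lra.
Qed.

(** Linearising at a third point (x0, y0) is what allows one fixed linear part along
    approximate solutions of different orders. *)
Lemma smooth2_linearization (f : R -> R -> R) (r : R) :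
  smooth2 f ->
  exists L, 0 <= L /\ forall x y x' y' x0 y0,
    Rabs x <= r -> Rabs y <= r -> Rabs x' <= r -> Rabs y' <= r ->
    Rabs x0 <= r -> Rabs y0 <= r ->
    Rabs (f x' y' - f x y - pdx f x0 y0 * (x' - x) - pdy f x0 y0 * (y' - y))
      <= L * (Rabs (x' - x) + Rabs (y' - y))
           * (Rabs (x' - x) + Rabs (y' - y) + Rabs (x - x0) + Rabs (y - y0)).
Proof.
  intros Hf.
  destruct (smooth2_lipschitz (pdx f) r (smooth2_pdx f Hf)) as (Lx & HLx & Bx).
  destruct (smooth2_lipschitz (pdy f) r (smooth2_pdy f Hf)) as (Ly & HLy & By).
  exists (Lx + Ly). split; [lra|].
  intros x y x' y' x0 y0 Hx Hy Hx' Hy' Hx0 Hy0.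
  set (D := Rabs (x' - x) + Rabs (y' - y) + Rabs (x - x0) + Rabs (y - y0)).
  assert (HD : forall a b c, Rmin a b <= c <= Rmax a b -> Rabs (c - a) <= Rabs (b - a)).
  { intros a b c. unfold Rmin, Rmax, Rabs.
    destruct (Rle_dec a b), (Rcase_abs (c - a)), (Rcase_abs (b - a)); lra. }
  assert (HT : forall a b c, Rabs (a - c) <= Rabs (a - b) + Rabs (b - c)).
  { intros a b c. replace (a - c) with ((a - b) + (b - c)) by ring. apply Rabs_triang. }
  assert (H1 : Rabs ((f x' y' - pdx f x0 y0 * x') - (f x y' - pdx f x0 y0 * x))
               <= (Lx * D) * Rabs (x' - x)).
  { apply (mvt_lipschitz (fun u => f u y' - pdx f x0 y0 * u)). intros z Hz.
    assert (Hdz : is_derive (fun u => f u y' - pdx f x0 y0 * u) z (pdx f z y' - pdx f x0 y0)).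
    { apply (is_derive_minus (fun u => f u y') (fun u => pdx f x0 y0 * u)).
      - exact (Derive_correct _ _ (proj1 (smooth2_ex_derive f z y' Hf))).
      - auto_derive; [exact I|ring]. }
    split. { eexists; exact Hdz. }
    replace (Derive _ z) with (pdx f z y' - pdx f x0 y0) by (symmetry; apply is_derive_unique; exact Hdz).
    eapply Rle_trans. { apply Bx; try assumption. apply (between_abs x x'); assumption. }
    apply Rmult_le_compat_l; [exact HLx|].
    pose proof (HD x x' z Hz). pose proof (HT z x x0). pose proof (HT y' y y0). unfold D. lra. }
  assert (H2 : Rabs ((f x y' - pdy f x0 y0 * y') - (f x y - pdy f x0 y0 * y))
               <= (Ly * D) * Rabs (y' - y)).
  { apply (mvt_lipschitz (fun v => f x v - pdy f x0 y0 * v)). intros z Hz.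
    assert (Hdz : is_derive (fun v => f x v - pdy f x0 y0 * v) z (pdy f x z - pdy f x0 y0)).
    { apply (is_derive_minus (fun v => f x v) (fun v => pdy f x0 y0 * v)).
      - exact (Derive_correct _ _ (proj2 (smooth2_ex_derive f x z Hf))).
      - auto_derive; [exact I|ring]. }
    split. { eexists; exact Hdz. }
    replace (Derive _ z) with (pdy f x z - pdy f x0 y0) by (symmetry; apply is_derive_unique; exact Hdz).
    eapply Rle_trans. { apply By; try assumption. apply (between_abs y y'); assumption. }
    apply Rmult_le_compat_l; [exact HLy|].
    pose proof (HD y y' z Hz). pose proof (HT z y y0). pose proof (Rabs_pos (x' - x)). unfold D. lra. }
  match goal with |- Rabs ?e <= _ => replace e with
    (((f x' y' - pdx f x0 y0 * x') - (f x y' - pdx f x0 y0 * x)) +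
     ((f x y' - pdy f x0 y0 * y') - (f x y - pdy f x0 y0 * y))) by ring end.
  eapply Rle_trans; [apply Rabs_triang|].
  assert (HD0 : 0 <= D) by (unfold D; pose proof (Rabs_pos (x' - x)); pose proof (Rabs_pos (y' - y));
    pose proof (Rabs_pos (x - x0)); pose proof (Rabs_pos (y - y0)); lra).
  pose proof (Rabs_pos (x' - x)). pose proof (Rabs_pos (y' - y)).
  fold D.
  assert (0 <= Lx * D) by (apply Rmult_le_pos; lra).
  assert (0 <= Ly * D) by (apply Rmult_le_pos; lra).
  nra.
Qed.

(** * Existence for planar differential equations *)

Lemma continuous_eps (f : R -> R) (x : R) :
  continuous f x <->
  forall eps, 0 < eps -> exists d, 0 < d /\ forall y, Rabs (y - x) < d -> Rabs (f y - f x) < eps.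
Proof.
  split.
  - intros Hc eps He.
    destruct (proj1 (filterlim_locally _ _) Hc (mkposreal eps He)) as [d Hd].
    exists d. split. { apply cond_pos. } intros y Hy. apply (Hd y), Hy.
  - intros H. apply filterlim_locally. intros eps.
    destruct (H eps (cond_pos eps)) as (d & Hd & Hf).
    exists (mkposreal d Hd). intros y Hy. apply (Hf y), Hy.
Qed.

Lemma is_derive_continuous (f : R -> R) (x l : R) : is_derive f x l -> continuous f x.
Proof. intros H. exact (ex_derive_continuous f x (ex_intro _ l H)). Qed.

(** Right-hand sides on T0 < t that are Lipschitz in (u, v) globally, uniformly on
    compact time intervals: solutions then extend forward and backward to the whole
    of T0 < t. *)
Definition ode_field (T0 : R) (f : R -> R -> R -> R) : Prop :=
  (forall u v t, T0 < t -> continuous (fun s => f s u v) t) /\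
  (forall al be, T0 < al -> exists L, 0 < L /\ forall t u v u' v', al <= t <= be ->
     Rabs (f t u v - f t u' v') <= L * (Rabs (u - u') + Rabs (v - v'))).

Lemma ode_field_comp_continuous (T0 : R) (f : R -> R -> R -> R) (u v : R -> R) (t : R) :
  ode_field T0 f -> T0 < t -> continuous u t -> continuous v t ->
  continuous (fun s => f s (u s) (v s)) t.
Proof.
  intros [Hc HL] Ht Hu Hv.
  destruct (HL ((T0 + t) / 2) (t + 1) ltac:(lra)) as (L & HL0 & HLf).
  apply continuous_eps. intros eps He.
  assert (He4 : 0 < eps / (4 * L)) by (apply Rdiv_lt_0_compat; lra).
  destruct (proj1 (continuous_eps _ _) Hu _ He4) as (d1 & Hd1 & H1).
  destruct (proj1 (continuous_eps _ _) Hv _ He4) as (d2 & Hd2 & H2).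
  destruct (proj1 (continuous_eps _ _) (Hc (u t) (v t) t Ht) (eps / 2) ltac:(lra)) as (d3 & Hd3 & H3).
  set (d4 := Rmin ((t - T0) / 2) 1).
  assert (Hd4 : 0 < d4) by (unfold d4; apply Rmin_glb_lt; lra).
  exists (Rmin (Rmin d1 d2) (Rmin d3 d4)).
  split. { apply Rmin_glb_lt; apply Rmin_glb_lt; assumption. }
  intros s Hs.
  pose proof (Rmin_l (Rmin d1 d2) (Rmin d3 d4)). pose proof (Rmin_r (Rmin d1 d2) (Rmin d3 d4)).
  pose proof (Rmin_l d1 d2). pose proof (Rmin_r d1 d2).
  pose proof (Rmin_l d3 d4). pose proof (Rmin_r d3 d4).
  assert (Hd4l : d4 <= (t - T0) / 2) by apply Rmin_l. assert (Hd4r : d4 <= 1) by apply Rmin_r.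
  specialize (H1 s ltac:(lra)). specialize (H2 s ltac:(lra)). specialize (H3 s ltac:(lra)).
  assert (Hs' : Rabs (s - t) < d4) by lra. apply Rabs_def2 in Hs'.
  replace (f s (u s) (v s) - f t (u t) (v t)) with
    ((f s (u s) (v s) - f s (u t) (v t)) + (f s (u t) (v t) - f t (u t) (v t))) by ring.
  eapply Rle_lt_trans; [apply Rabs_triang|].
  assert (Hb := HLf s (u s) (v s) (u t) (v t) ltac:(lra)).
  assert (Hb2 : L * (Rabs (u s - u t) + Rabs (v s - v t)) < L * (eps / (4 * L) + eps / (4 * L)))
    by (apply Rmult_lt_compat_l; lra).
  replace (L * (eps / (4 * L) + eps / (4 * L))) with (eps / 2) in Hb2 by (field; lra).
  lra.
Qed.

Lemma continuous_is_RInt (g : R -> R) (a b : R) :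
  (forall z, Rmin a b <= z <= Rmax a b -> continuous g z) -> is_RInt g a b (RInt g a b).
Proof.
  intros H. exact (RInt_correct (V := R_CompleteNormedModule) g a b
                     (ex_RInt_continuous (V := R_CompleteNormedModule) g a b H)).
Qed.

Lemma is_derive_primitive (g : R -> R) (T0 t0 t c : R) :
  (forall s, T0 < s -> continuous g s) -> T0 < t0 -> T0 < t ->
  is_derive (fun t => c + RInt g t0 t) t (g t).
Proof.
  intros Hg H0 Ht.
  replace (g t) with (0 + g t) by ring.
  apply (is_derive_plus (fun _ => c) (fun t => RInt g t0 t)).
  { apply (is_derive_const c). }
  apply (is_derive_RInt g (fun t => RInt g t0 t) t0 t).
  - exists (mkposreal (t - T0) ltac:(lra)). intros s Hs.
    apply continuous_is_RInt. intros z Hz. apply Hg.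
    assert (Hs' : Rabs (s - t) < t - T0) by exact Hs. apply Rabs_def2 in Hs'.
    revert Hz. unfold Rmin. destruct (Rle_dec t0 s); lra.
  - apply Hg, Ht.
Qed.

(** The exponential weight makes the primitive of g smaller than g by the factor
    1 / lam, on both sides of t0. *)
Lemma RInt_exp_bound (g : R -> R) (t0 t k lam : R) :
  0 < lam -> 0 <= k ->
  (forall s, Rmin t0 t <= s <= Rmax t0 t -> continuous g s) ->
  (forall s, Rmin t0 t <= s <= Rmax t0 t -> Rabs (g s) <= k * exp (lam * Rabs (s - t0))) ->
  Rabs (RInt g t0 t) <= k / lam * exp (lam * Rabs (t - t0)).
Proof.
  intros Hlam Hk Hc Hb.
  assert (Hkl : 0 <= k / lam) by (apply Rdiv_le_0_compat; lra).
  destruct (Rle_dec t0 t) as [Hle|Hgt].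
  - rewrite Rmin_left, Rmax_right in Hc by lra. rewrite Rmin_left, Rmax_right in Hb by lra.
    assert (HI : is_RInt (fun s => k * exp (lam * (s - t0))) t0 t
             (k / lam * exp (lam * (t - t0)) - k / lam * exp (lam * (t0 - t0)))).
    { apply (is_RInt_derive (fun s => k / lam * exp (lam * (s - t0)))).
      - intros x _. auto_derive; [exact I|]. replace (lam * (x + - t0)) with (lam * (x - t0)) by ring. field. lra.
      - intros x _. apply (ex_derive_continuous (fun s => k * exp (lam * (s - t0)))). auto_derive. exact I. }
    eapply Rle_trans.
    + apply (norm_RInt_le g (fun s => k * exp (lam * (s - t0))) t0 t (RInt g t0 t) _ Hle).
      * intros x Hx. specialize (Hb x Hx). rewrite (Rabs_pos_eq (x - t0)) in Hb by lra. exact Hb.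
      * apply continuous_is_RInt. rewrite Rmin_left, Rmax_right by lra. exact Hc.
      * exact HI.
    + rewrite (Rabs_pos_eq (t - t0)) by lra.
      pose proof (exp_pos (lam * (t0 - t0))). nra.
  - rewrite Rmin_right, Rmax_left in Hc by lra. rewrite Rmin_right, Rmax_left in Hb by lra.
    assert (HI : is_RInt (fun s => k * exp (lam * (t0 - s))) t t0
             (- (k / lam) * exp (lam * (t0 - t0)) - - (k / lam) * exp (lam * (t0 - t)))).
    { apply (is_RInt_derive (fun s => - (k / lam) * exp (lam * (t0 - s)))).
      - intros x _. auto_derive; [exact I|]. replace (lam * (t0 + - x)) with (lam * (t0 - x)) by ring. field. lra.
      - intros x _. apply (ex_derive_continuous (fun s => k * exp (lam * (t0 - s)))). auto_derive. exact I. }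
    replace (Rabs (RInt g t0 t)) with (Rabs (RInt g t t0)).
    2:{ rewrite <- (opp_RInt_swap g t t0).
        - change (opp (RInt g t t0)) with (- RInt g t t0). symmetry. apply Rabs_Ropp.
        - exists (RInt g t t0). apply continuous_is_RInt. rewrite Rmin_left, Rmax_right by lra. exact Hc. }
    eapply Rle_trans.
    + apply (norm_RInt_le g (fun s => k * exp (lam * (t0 - s))) t t0 (RInt g t t0) _ ltac:(lra)).
      * intros x Hx. specialize (Hb x Hx). rewrite Rabs_minus_sym, (Rabs_pos_eq (t0 - x)) in Hb by lra. exact Hb.
      * apply continuous_is_RInt. rewrite Rmin_left, Rmax_right by lra. exact Hc.
      * exact HI.
    + rewrite Rabs_minus_sym, (Rabs_pos_eq (t0 - t)) by lra.
      pose proof (exp_pos (lam * (t0 - t0))). nra.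
Qed.

Lemma geometric_limit (x : nat -> R) (D : R) :
  (forall k, Rabs (x (S k) - x k) <= D * (/2) ^ k) ->
  forall k, Rabs (real (Lim_seq x) - x k) <= 2 * D * (/2) ^ k.
Proof.
  intros Hx.
  assert (HD : 0 <= D).
  { specialize (Hx 0%nat). simpl in Hx. pose proof (Rabs_pos (x 1%nat - x 0%nat)). lra. }
  assert (Hp : forall k, 0 < (/2) ^ k) by (intros; apply pow_lt; lra).
  assert (Htail : forall k j, Rabs (x (k + j)%nat - x k) <= 2 * D * (/2) ^ k * (1 - (/2) ^ j)).
  { intros k j. induction j as [|j IH].
    - rewrite Nat.add_0_r. unfold Rminus. rewrite Rplus_opp_r, Rabs_R0. simpl. lra.
    - rewrite Nat.add_succ_r. specialize (Hx (k + j)%nat). rewrite pow_add in Hx.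
      replace (x (S (k + j)) - x k) with ((x (S (k + j)) - x (k + j)%nat) + (x (k + j)%nat - x k)) by ring.
      eapply Rle_trans; [apply Rabs_triang|]. simpl. nra. }
  assert (Hlim : ex_finite_lim_seq x).
  { apply ex_lim_seq_cauchy_corr. intros eps.
    destruct (pow_lt_1_zero (/2) ltac:(rewrite Rabs_pos_eq; lra) (eps / (4 * D + 1))) as [N HN].
    { apply Rdiv_lt_0_compat; [apply cond_pos|lra]. }
    exists N. intros a b Ha Hb.
    assert (HNN := HN N (Nat.le_refl N)). rewrite Rabs_pos_eq in HNN by (left; apply Hp).
    assert (Hb1 : (4 * D + 1) * (/2) ^ N < eps).
    { apply Rmult_lt_compat_l with (r := 4 * D + 1) in HNN; [|lra].
      replace ((4 * D + 1) * (eps / (4 * D + 1))) with (pos eps) in HNN by (field; lra). exact HNN. }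
    assert (Hab : forall a, (N <= a)%nat -> Rabs (x a - x N) <= 2 * D * (/2) ^ N).
    { intros c Hc. replace c with (N + (c - N))%nat by lia.
      eapply Rle_trans; [apply Htail|]. rewrite <- (Rmult_1_r (2 * D * (/2)^N)) at 2.
      pose proof (Hp N). pose proof (Hp (c - N)%nat).
      apply Rmult_le_compat_l; [|lra]. apply Rmult_le_pos; lra. }
    replace (x a - x b) with ((x a - x N) - (x b - x N)) by ring.
    eapply Rle_lt_trans; [apply Rabs_triang|]. rewrite Rabs_Ropp.
    pose proof (Hab a Ha). pose proof (Hab b Hb). pose proof (Hp N). lra. }
  intros k.
  destruct Hlim as [l Hl]. rewrite (is_lim_seq_unique _ _ Hl). simpl.
  apply (is_lim_seq_incr_n x k) in Hl.
  assert (Hl2 : is_lim_seq (fun j => Rabs (x (j + k)%nat - x k)) (Rabs (l - x k))).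
  { apply (is_lim_seq_abs _ (l - x k)).
    apply (is_lim_seq_minus' (fun j => x (j + k)%nat) (fun _ => x k)); [exact Hl|apply is_lim_seq_const]. }
  assert (Hb : forall j, Rabs (x (j + k)%nat - x k) <= 2 * D * (/2) ^ k).
  { intros j. rewrite (Nat.add_comm j k). eapply Rle_trans; [apply Htail|].
    pose proof (Hp k). pose proof (Hp j).
    assert (0 <= 2 * D * (/2) ^ k) by (apply Rmult_le_pos; lra). nra. }
  assert (Hle := is_lim_seq_le _ _ _ _ Hb Hl2 (is_lim_seq_const _)).
  exact Hle.
Qed.

Definition solves (T0 : R) (f1 f2 : R -> R -> R -> R) (u v : R -> R) : Prop :=
  forall t, T0 < t ->
    is_derive u t (f1 t (u t) (v t)) /\ is_derive v t (f2 t (u t) (v t)).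

Fixpoint picard_iter (f1 f2 : R -> R -> R -> R) (t0 u0 v0 : R) (k : nat) : R -> R * R :=
  match k with
  | O => fun _ => (u0, v0)
  | S k' => fun t =>
      let w := picard_iter f1 f2 t0 u0 v0 k' in
      (u0 + RInt (fun s => f1 s (fst (w s)) (snd (w s))) t0 t,
       v0 + RInt (fun s => f2 s (fst (w s)) (snd (w s))) t0 t)
  end.

Lemma RInt_diff_exp_bound (g h : R -> R) (t0 t k lam : R) :
  0 < lam -> 0 <= k ->
  (forall s, Rmin t0 t <= s <= Rmax t0 t -> continuous g s) ->
  (forall s, Rmin t0 t <= s <= Rmax t0 t -> continuous h s) ->
  (forall s, Rmin t0 t <= s <= Rmax t0 t -> Rabs (g s - h s) <= k * exp (lam * Rabs (s - t0))) ->
  Rabs (RInt g t0 t - RInt h t0 t) <= k / lam * exp (lam * Rabs (t - t0)).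
Proof.
  intros Hlam Hk Hg Hh Hb.
  replace (RInt g t0 t - RInt h t0 t) with (RInt (fun s => g s - h s) t0 t).
  - apply RInt_exp_bound; try assumption.
    intros s Hs. apply (continuous_minus g h); auto.
  - apply (is_RInt_unique (V := R_CompleteNormedModule)).
    apply (is_RInt_minus (V := R_NormedModule) g h); apply continuous_is_RInt; assumption.
Qed.

Lemma eq_of_geometric_bound (x y c : R) :
  (forall k, Rabs (x - y) <= c * (/2) ^ k) -> x = y.
Proof.
  intros H. apply Rminus_diag_uniq.
  destruct (Req_dec (x - y) 0) as [E|E]; [exact E|exfalso].
  apply Rabs_pos_lt in E.
  assert (Hc : 0 < c) by (specialize (H 0%nat); simpl in H; lra).
  destruct (pow_lt_1_zero (/2) ltac:(rewrite Rabs_pos_eq; lra) (Rabs (x - y) / c)) as [N HN].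
  { apply Rdiv_lt_0_compat; assumption. }
  specialize (HN N (Nat.le_refl N)). specialize (H N).
  rewrite Rabs_pos_eq in HN by (left; apply pow_lt; lra).
  apply Rmult_lt_compat_l with (r := c) in HN; [|exact Hc].
  replace (c * (Rabs (x - y) / c)) with (Rabs (x - y)) in HN by (field; lra). lra.
Qed.

Lemma geometric_limit_continuous (X : nat -> R -> R) (t al be C : R) :
  al < t < be -> 0 <= C -> (forall k, continuous (X k) t) ->
  (forall k s, al <= s <= be -> Rabs (X (S k) s - X k s) <= C * (/2) ^ k) ->
  continuous (fun s => real (Lim_seq (fun k => X k s))) t.
Proof.
  intros Ht HC0 HX HB.
  assert (Hp : forall k, 0 < (/2) ^ k) by (intros; apply pow_lt; lra).
  apply continuous_eps. intros eps He.
  destruct (pow_lt_1_zero (/2) ltac:(rewrite Rabs_pos_eq; lra) (eps / (6 * C + 1))) as [N HN].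
  { apply Rdiv_lt_0_compat; lra. }
  specialize (HN N (Nat.le_refl N)). rewrite Rabs_pos_eq in HN by (left; apply Hp).
  apply Rmult_lt_compat_l with (r := 6 * C + 1) in HN; [|lra].
  replace ((6 * C + 1) * (eps / (6 * C + 1))) with eps in HN by (field; lra).
  pose proof (Hp N).
  destruct (proj1 (continuous_eps _ _) (HX N) (eps / 3) ltac:(lra)) as (d & Hd & Hdd).
  exists (Rmin d (Rmin (t - al) (be - t))).
  split. { apply Rmin_glb_lt; [exact Hd|apply Rmin_glb_lt; lra]. }
  intros s Hs.
  pose proof (Rmin_l d (Rmin (t - al) (be - t))). pose proof (Rmin_r d (Rmin (t - al) (be - t))).
  pose proof (Rmin_l (t - al) (be - t)). pose proof (Rmin_r (t - al) (be - t)).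
  specialize (Hdd s ltac:(lra)).
  assert (Hst : al <= s <= be).
  { assert (Hs1 : Rabs (s - t) < t - al) by lra. assert (Hs2 : Rabs (s - t) < be - t) by lra.
    apply Rabs_def2 in Hs1, Hs2. lra. }
  assert (G1 := geometric_limit (fun k => X k s) C (fun k => HB k s Hst) N).
  assert (G2 := geometric_limit (fun k => X k t) C (fun k => HB k t ltac:(lra)) N).
  cbv beta in G1, G2.
  match goal with |- Rabs (?a - ?b) < _ =>
    replace (a - b) with ((a - X N s) + (X N s - X N t) + - (b - X N t)) by ring end.
  eapply Rle_lt_trans; [apply Rabs_triang|]. rewrite Rabs_Ropp.
  eapply Rle_lt_trans; [apply Rplus_le_compat_r, Rabs_triang|]. lra.
Qed.

(** Successive approximation on both sides of t0 at once: for the weight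
    exp (lam |t - t0|) with lam four times the Lipschitz constant, the integral
    operator is a contraction, so the iterates converge geometrically on every
    compact interval. *)
Theorem picard_lindelof (T0 t0 u0 v0 : R) (f1 f2 : R -> R -> R -> R) :
  ode_field T0 f1 -> ode_field T0 f2 -> T0 < t0 ->
  exists u v, u t0 = u0 /\ v t0 = v0 /\ solves T0 f1 f2 u v.
Proof.
  intros F1 F2 Ht0.
  set (w := picard_iter f1 f2 t0 u0 v0).
  set (U := fun k t => fst (w k t)). set (V := fun k t => snd (w k t)).
  set (along := fun (f : R -> R -> R -> R) k s => f s (U k s) (V k s)).
  assert (HUS : forall k t, U (S k) t = u0 + RInt (along f1 k) t0 t) by reflexivity.
  assert (HVS : forall k t, V (S k) t = v0 + RInt (along f2 k) t0 t) by reflexivity.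
  assert (HC : forall k t, T0 < t -> continuous (U k) t /\ continuous (V k) t).
  { induction k as [|k IH]; intros t Ht.
    - split; apply continuous_const.
    - assert (HA : forall f z0, ode_field T0 f -> continuous (fun t => z0 + RInt (along f k) t0 t) t).
      { intros f z0 Ff. apply (is_derive_continuous _ _ (along f k t)).
        apply (is_derive_primitive (along f k) T0 t0 t z0); try assumption.
        intros s Hs. exact (ode_field_comp_continuous T0 f (U k) (V k) s Ff Hs (proj1 (IH s Hs)) (proj2 (IH s Hs))). }
      split; apply HA; assumption. }
  assert (HG : forall f k t, ode_field T0 f -> T0 < t -> continuous (along f k) t).
  { intros f k t Ff Ht. destruct (HC k t Ht) as [CU CV].
    exact (ode_field_comp_continuous T0 f (U k) (V k) t Ff Ht CU CV). }
  assert (Hbt : forall al be t s, al <= t0 <= be -> al <= t <= be ->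
            Rmin t0 t <= s <= Rmax t0 t -> al <= s <= be).
  { intros al be t s H1 H2 H3. unfold Rmin, Rmax in H3. destruct (Rle_dec t0 t); lra. }
  assert (Hp : forall k, 0 < (/2) ^ k) by (intros; apply pow_lt; lra).
  assert (Hexp : forall lam t, 0 <= lam -> 1 <= exp (lam * Rabs (t - t0))).
  { intros lam t Hlam. apply Rle_trans with (1 + lam * Rabs (t - t0)); [|apply exp_ineq1_le].
    pose proof (Rmult_le_pos _ _ Hlam (Rabs_pos (t - t0))). lra. }
  assert (HK : forall al be, T0 < al -> al <= t0 <= be -> exists C, 0 <= C /\ forall k t, al <= t <= be ->
        Rabs (U (S k) t - U k t) <= C * (/2) ^ k /\ Rabs (V (S k) t - V k t) <= C * (/2) ^ k).
  { intros al be Hal Hin.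
    destruct (proj2 F1 al be Hal) as (L1 & HL1 & B1).
    destruct (proj2 F2 al be Hal) as (L2 & HL2 & B2).
    set (L := L1 + L2). assert (HL0 : 0 < L) by (unfold L; lra).
    assert (HM : forall f, ode_field T0 f -> exists M, 0 <= M /\ forall s, al <= s <= be -> Rabs (f s u0 v0) <= M).
    { intros f Ff. destruct (continuous_on_box_bounded (fun _ _ s => f s u0 v0) 0 al be) as (M & HM & B).
      - intros x y s _ _ Hs.
        apply (continuous_comp (fun p : R * R * R => snd p) (fun s => f s u0 v0)); [apply continuous_snd|].
        apply (proj1 Ff). simpl. lra.
      - exists M. split; [exact HM|]. intros s Hs. apply (B 0 0 s); try (rewrite Rabs_R0; lra). exact Hs. }
    destruct (HM f1 F1) as (M1 & HM1 & BM1). destruct (HM f2 F2) as (M2 & HM2 & BM2).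
    set (lam := 4 * L). assert (Hlam : 0 < lam) by (unfold lam; lra).
    set (D := (M1 + M2) / lam).
    assert (HD : 0 <= D) by (apply Rdiv_le_0_compat; lra).
    assert (HW : forall k t, al <= t <= be ->
        Rabs (U (S k) t - U k t) <= D * (/2) ^ k * exp (lam * Rabs (t - t0)) /\
        Rabs (V (S k) t - V k t) <= D * (/2) ^ k * exp (lam * Rabs (t - t0))).
    { induction k as [|k IH]; intros t Ht.
      - rewrite HUS, HVS. change (U 0%nat t) with u0. change (V 0%nat t) with v0.
        assert (Ez : forall z r : R, z + r - z = r) by (intros; ring). rewrite !Ez.
        simpl pow. rewrite !Rmult_1_r. unfold D.
        split; (apply RInt_exp_bound; [exact Hlam|lra| |]); intros s Hs;
          pose proof (Hbt al be t s Hin Ht Hs) as Hs'; try (apply HG; assumption || lra);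
          pose proof (Hexp lam s ltac:(lra)).
        + pose proof (BM1 s Hs') as HB. change (Rabs (along f1 0%nat s) <= M1) in HB. nra.
        + pose proof (BM2 s Hs') as HB. change (Rabs (along f2 0%nat s) <= M2) in HB. nra.
      - assert (Ek : D * (/2) ^ S k = (L * (2 * (D * (/2) ^ k))) / lam)
          by (simpl; unfold lam; field; lra).
        assert (Hp' : 0 <= D * (/2) ^ k) by (pose proof (Hp k); apply Rmult_le_pos; lra).
        assert (HS : forall f Lf z0, ode_field T0 f -> Lf <= L -> (forall s u v u' v', al <= s <= be ->
            Rabs (f s u v - f s u' v') <= Lf * (Rabs (u - u') + Rabs (v - v'))) ->
          Rabs (z0 + RInt (along f (S k)) t0 t - (z0 + RInt (along f k) t0 t))
            <= L * (2 * (D * (/2) ^ k)) / lam * exp (lam * Rabs (t - t0))).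
        { intros f Lf z0 Ff HLf HLip.
          replace (z0 + RInt (along f (S k)) t0 t - (z0 + RInt (along f k) t0 t))
            with (RInt (along f (S k)) t0 t - RInt (along f k) t0 t) by ring.
          apply RInt_diff_exp_bound; [exact Hlam| apply Rmult_le_pos; lra | | |];
            intros s Hs; pose proof (Hbt al be t s Hin Ht Hs) as Hs'; try (apply HG; assumption || lra).
          rewrite Rmult_assoc. destruct (IH s Hs') as [I1 I2].
          eapply Rle_trans; [apply HLip; exact Hs'|].
          pose proof (Rabs_pos (U (S k) s - U k s)). pose proof (Rabs_pos (V (S k) s - V k s)).
          apply Rle_trans with (L * (Rabs (U (S k) s - U k s) + Rabs (V (S k) s - V k s))).
          - apply Rmult_le_compat_r; lra.
          - apply Rmult_le_compat_l; lra. }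
        rewrite (HUS (S k)), (HUS k), (HVS (S k)), (HVS k), Ek.
        split; [apply (HS f1 L1)|apply (HS f2 L2)]; try assumption; unfold L; lra. }
    exists (D * exp (lam * (be - al))).
    split. { apply Rmult_le_pos; [exact HD|left; apply exp_pos]. }
    intros k t Ht. pose proof (Hp k).
    assert (Hle : exp (lam * Rabs (t - t0)) <= exp (lam * (be - al))).
    { assert (Hx : lam * Rabs (t - t0) <= lam * (be - al)).
      { apply Rmult_le_compat_l; [lra|]. apply Rabs_le_between. lra. }
      destruct Hx as [Hx| ->]; [left; apply exp_increasing; exact Hx|lra]. }
    assert (Hq : 0 <= D * (/2) ^ k) by (apply Rmult_le_pos; lra).
    destruct (HW k t Ht) as [I1 I2]. split; nra. }
  set (u := fun t => real (Lim_seq (fun k => U k t))).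
  set (v := fun t => real (Lim_seq (fun k => V k t))).
  (* Around t and t0 there is a compact interval on which the iterates converge. *)
  assert (Hint : forall t, T0 < t -> exists al be C, T0 < al /\ al < t0 < be /\ al < t < be /\ 0 <= C /\
    forall k s, al <= s <= be -> Rabs (U (S k) s - U k s) <= C * (/2) ^ k /\ Rabs (V (S k) s - V k s) <= C * (/2) ^ k).
  { intros t Ht.
    assert (HI : T0 < (T0 + Rmin t0 t) / 2 /\ (T0 + Rmin t0 t) / 2 < t0 < Rmax t0 t + 1 /\
                 (T0 + Rmin t0 t) / 2 < t < Rmax t0 t + 1).
    { unfold Rmin, Rmax. destruct (Rle_dec t0 t); lra. }
    destruct HI as (A1 & A2 & A3).
    destruct (HK _ (Rmax t0 t + 1) A1 ltac:(lra)) as (C & HC0 & HB).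
    exists ((T0 + Rmin t0 t) / 2), (Rmax t0 t + 1), C. auto. }
  assert (Huv : forall t, T0 < t -> continuous u t /\ continuous v t).
  { intros t Ht. destruct (Hint t Ht) as (al & be & C & A1 & A2 & A3 & HC0 & HB).
    split; [apply (geometric_limit_continuous U t al be C A3 HC0)|apply (geometric_limit_continuous V t al be C A3 HC0)];
      intros k; (apply HC, Ht) || (intros s Hs; apply HB, Hs). }
  assert (Hf : forall f t, ode_field T0 f -> T0 < t -> continuous (fun s => f s (u s) (v s)) t).
  { intros f t Ff Ht. destruct (Huv t Ht) as [Cu Cv]. exact (ode_field_comp_continuous T0 f u v t Ff Ht Cu Cv). }
  assert (Heq : forall f z0 (Z : nat -> R -> R) t, ode_field T0 f -> T0 < t ->
     (forall k t, Z (S k) t = z0 + RInt (along f k) t0 t) ->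
     (forall D, (forall k, Rabs (U (S k) t - U k t) <= D * (/2) ^ k /\ Rabs (V (S k) t - V k t) <= D * (/2) ^ k) ->
        forall k, Rabs (real (Lim_seq (fun k => Z k t)) - Z k t) <= 2 * D * (/2) ^ k) ->
     real (Lim_seq (fun k => Z k t)) = z0 + RInt (fun s => f s (u s) (v s)) t0 t).
  { intros f z0 Z t Ff Ht HZ HZl. destruct (Hint t Ht) as (al & be & C & A1 & A2 & A3 & HC0 & HB).
    destruct (proj2 Ff al be A1) as (L & HL & HLip).
    assert (Hgu : forall k s, al <= s <= be -> Rabs (u s - U k s) <= 2 * C * (/2) ^ k).
    { intros k s Hs. apply (geometric_limit (fun k => U k s) C). intros j. apply HB, Hs. }
    assert (Hgv : forall k s, al <= s <= be -> Rabs (v s - V k s) <= 2 * C * (/2) ^ k).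
    { intros k s Hs. apply (geometric_limit (fun k => V k s) C). intros j. apply HB, Hs. }
    assert (HCp : forall k, 0 <= L * (4 * C * (/2) ^ k)).
    { intros k. pose proof (Hp k). apply Rmult_le_pos; [lra|]. apply Rmult_le_pos; lra. }
    set (E := exp (1 * Rabs (t - t0))).
    apply (eq_of_geometric_bound _ _ (2 * C + 4 * L * C * E)). intros k.
    set (l := real (Lim_seq (fun k => Z k t))) in *.
    replace (l - (z0 + RInt (fun s => f s (u s) (v s)) t0 t)) with
        ((l - Z (S k) t) + (RInt (along f k) t0 t - RInt (fun s => f s (u s) (v s)) t0 t))
        by (rewrite HZ; ring).
    eapply Rle_trans; [apply Rabs_triang|].
    assert (I1 := HZl C (fun k => HB k t ltac:(lra)) (S k)). simpl pow in I1.
    assert (I2 : Rabs (RInt (along f k) t0 t - RInt (fun s => f s (u s) (v s)) t0 t) <=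
                  (L * (4 * C * (/2) ^ k)) / 1 * E).
    { apply RInt_diff_exp_bound; [lra|apply HCp| | |];
        intros s Hs; pose proof (Hbt al be t s ltac:(lra) ltac:(lra) Hs) as Hs'.
      - apply HG; assumption || lra.
      - apply Hf; assumption || lra.
      - assert (I3 := HLip s (U k s) (V k s) (u s) (v s) Hs').
        rewrite (Rabs_minus_sym (U k s)), (Rabs_minus_sym (V k s)) in I3.
        pose proof (Hgu k s Hs'). pose proof (Hgv k s Hs').
        assert (I4 : L * (Rabs (u s - U k s) + Rabs (v s - V k s)) <= L * (4 * C * (/2) ^ k))
          by (apply Rmult_le_compat_l; lra).
        unfold along. pose proof (Hexp 1 s ltac:(lra)). specialize (HCp k). nra. }
    pose proof (Hp k). assert (0 <= C * (/2) ^ k) by (apply Rmult_le_pos; lra).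
    unfold Rdiv in I2. rewrite Rinv_1 in I2. lra. }
  assert (Hu : forall t, T0 < t -> u t = u0 + RInt (fun s => f1 s (u s) (v s)) t0 t).
  { intros t Ht. apply (Heq f1 u0 U t F1 Ht HUS). intros D HB. apply geometric_limit. intros k. apply HB. }
  assert (Hv : forall t, T0 < t -> v t = v0 + RInt (fun s => f2 s (u s) (v s)) t0 t).
  { intros t Ht. apply (Heq f2 v0 V t F2 Ht HVS). intros D HB. apply geometric_limit. intros k. apply HB. }
  exists u, v.
  split. { rewrite (Hu t0 Ht0), RInt_point. unfold zero; simpl. ring. }
  split. { rewrite (Hv t0 Ht0), RInt_point. unfold zero; simpl. ring. }
  intros t Ht.
  assert (Hsol : forall f z0 z, ode_field T0 f -> (forall t, T0 < t -> z t = z0 + RInt (fun s => f s (u s) (v s)) t0 t) ->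
     is_derive z t (f t (u t) (v t))).
  { intros f z0 z Ff Hz. apply (is_derive_ext_loc (fun t => z0 + RInt (fun s => f s (u s) (v s)) t0 t)).
    - exists (mkposreal (t - T0) ltac:(lra)). intros s Hs. symmetry. apply Hz.
      assert (Hs' : Rabs (s - t) < t - T0) by exact Hs. apply Rabs_def2 in Hs'. lra.
    - apply (is_derive_primitive (fun s => f s (u s) (v s)) T0); try assumption. intros s Hs. apply Hf; assumption. }
  split; [apply (Hsol f1 u0 u F1 Hu)|apply (Hsol f2 v0 v F2 Hv)].
Qed.

(** * Barriers, dependence on initial values, passage to an infinite horizon *)

Lemma nondecreasing_of_derive (e de : R -> R) (a b : R) :
  a <= b -> (forall t, a <= t <= b -> is_derive e t (de t) /\ 0 <= de t) -> e a <= e b.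
Proof.
  intros Hab H.
  destruct (MVT_gen e a b de) as [c [Hc Heq]].
  - intros x Hx. rewrite Rmin_left, Rmax_right in Hx by lra. apply H. lra.
  - intros x Hx. rewrite Rmin_left, Rmax_right in Hx by lra.
    apply derivable_continuous_pt, ex_derive_Reals_0.
    exists (de x). apply H. lra.
  - rewrite Rmin_left, Rmax_right in Hc by lra. destruct (H c Hc) as [_ Hd].
    assert (0 <= de c * (b - a)) by (apply Rmult_le_pos; lra). lra.
Qed.

Lemma is_derive_quadratic_error (f : R -> R) (x l C : R) :
  (forall y, Rabs (f y - f x - l * (y - x)) <= C * (y - x) ^ 2) -> is_derive f x l.
Proof.
  intros H. apply is_derive_Reals. intros eps He.
  assert (HC : 0 <= C).
  { specialize (H (x + 1)). eapply Rle_trans; [apply (Rabs_pos (f (x + 1) - f x - l * (x + 1 - x)))|].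
    replace ((x + 1 - x) ^ 2) with 1 in H by ring. lra. }
  assert (Hd : 0 < eps / (C + 1)) by (apply Rdiv_lt_0_compat; lra).
  exists (mkposreal _ Hd). intros h Hh0 Hh. simpl in Hh.
  specialize (H (x + h)). replace (x + h - x) with h in H by ring.
  replace ((f (x + h) - f x) / h - l) with ((f (x + h) - f x - l * h) / h) by (field; exact Hh0).
  unfold Rdiv. rewrite Rabs_mult, Rabs_inv.
  assert (Hp : 0 < Rabs h) by (apply Rabs_pos_lt; exact Hh0).
  apply Rle_lt_trans with ((C * h ^ 2) * / Rabs h).
  { apply Rmult_le_compat_r; [left; apply Rinv_0_lt_compat; exact Hp|exact H]. }
  rewrite <- (pow2_abs h). replace (C * Rabs h ^ 2 * / Rabs h) with (C * Rabs h) by (field; lra).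
  apply Rle_lt_trans with ((C + 1) * Rabs h); [nra|].
  apply Rmult_lt_compat_l with (r := C + 1) in Hh; [|lra].
  replace ((C + 1) * (eps / (C + 1))) with eps in Hh by (field; lra). exact Hh.
Qed.

Lemma is_derive_positive_part_sqr (x : R) :
  is_derive (fun y => (Rmax 0 y) ^ 2) x (2 * Rmax 0 x).
Proof.
  apply (is_derive_quadratic_error _ _ _ 1). intros y.
  unfold Rmax. destruct (Rle_dec 0 y) as [Hy|Hy], (Rle_dec 0 x) as [Hx|Hx];
    try apply Rnot_le_lt in Hy; try apply Rnot_le_lt in Hx; apply Rabs_le_between;
    pose proof (pow2_ge_0 x); pose proof (pow2_ge_0 y); pose proof (pow2_ge_0 (y - x)); split; nra.
Qed.

(** The square of the positive part of e is differentiable and monotone; this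
    replaces the usual argument by a first exit time. *)
Lemma barrier_backward (e de : R -> R) (a b : R) :
  a <= b -> (forall t, a <= t <= b -> is_derive e t (de t)) ->
  (forall t, a <= t <= b -> 0 < e t -> 0 <= de t) ->
  0 < e a -> e a <= e b.
Proof.
  intros Hab Hd Hs Ha.
  assert (Hm := nondecreasing_of_derive (fun t => (Rmax 0 (e t)) ^ 2)
                  (fun t => de t * (2 * Rmax 0 (e t))) a b Hab).
  assert (H : (Rmax 0 (e a)) ^ 2 <= (Rmax 0 (e b)) ^ 2).
  { apply Hm. intros t Ht. split.
    - apply (is_derive_comp (fun y => (Rmax 0 y) ^ 2) e); [apply is_derive_positive_part_sqr|apply Hd, Ht].
    - destruct (Rle_lt_dec (e t) 0) as [Hn|Hp].
      + rewrite Rmax_left by lra. lra.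
      + pose proof (Rmax_l 0 (e t)). pose proof (Hs t Ht Hp). apply Rmult_le_pos; lra. }
  rewrite (Rmax_right 0 (e a)) in H by lra.
  unfold Rmax in H. destruct (Rle_dec 0 (e b)); nra.
Qed.

Lemma barrier_forward (e de : R -> R) (a b : R) :
  a <= b -> (forall t, a <= t <= b -> is_derive e t (de t)) ->
  (forall t, a <= t <= b -> 0 < e t -> de t <= 0) ->
  e a <= 0 -> e b <= 0.
Proof.
  intros Hab Hd Hs Ha.
  assert (Hm := nondecreasing_of_derive (fun t => - (Rmax 0 (e t)) ^ 2)
                  (fun t => - (de t * (2 * Rmax 0 (e t)))) a b Hab).
  assert (H : - (Rmax 0 (e a)) ^ 2 <= - (Rmax 0 (e b)) ^ 2).
  { apply Hm. intros t Ht. split.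
    - apply (is_derive_opp (fun t => (Rmax 0 (e t)) ^ 2)).
      apply (is_derive_comp (fun y => (Rmax 0 y) ^ 2) e); [apply is_derive_positive_part_sqr|apply Hd, Ht].
    - destruct (Rle_lt_dec (e t) 0) as [Hn|Hp].
      + rewrite Rmax_left by lra. lra.
      + pose proof (Rmax_l 0 (e t)). pose proof (Hs t Ht Hp). nra. }
  rewrite (Rmax_left 0 (e a)) in H by lra.
  unfold Rmax in H. destruct (Rle_dec 0 (e b)); nra.
Qed.

Lemma abs_le_of_sqr (x y : R) : 0 <= y -> x ^ 2 <= y ^ 2 -> Rabs x <= y.
Proof. intros Hy H. apply Rabs_le_between. split; nra. Qed.

(** Gronwall: the squared distance of two solutions grows at most like
    exp (4 L t). *)
Lemma solutions_close (T0 a b : R) (f1 f2 : R -> R -> R -> R) :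
  ode_field T0 f1 -> ode_field T0 f2 -> T0 < a ->
  exists C, 0 < C /\ forall u v u' v', solves T0 f1 f2 u v -> solves T0 f1 f2 u' v' ->
    forall t, a <= t <= b ->
    (u t - u' t) ^ 2 + (v t - v' t) ^ 2 <= C * ((u a - u' a) ^ 2 + (v a - v' a) ^ 2).
Proof.
  intros [_ F1] [_ F2] Ha.
  destruct (F1 a b Ha) as (L1 & HL1 & B1). destruct (F2 a b Ha) as (L2 & HL2 & B2).
  set (L := L1 + L2). assert (HL : 0 < L) by (unfold L; lra).
  exists (exp (4 * L * Rabs (b - a))). split; [apply exp_pos|].
  intros u v u' v' HS HS' t Ht.
  set (e := fun s => - (((u s - u' s) ^ 2 + (v s - v' s) ^ 2) * exp (- (4 * L * (s - a))))).
  set (D1 := fun s => f1 s (u s) (v s) - f1 s (u' s) (v' s)).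
  set (D2 := fun s => f2 s (u s) (v s) - f2 s (u' s) (v' s)).
  assert (Hm : e a <= e t).
  { apply (nondecreasing_of_derive e (fun s => - (2 * (u s - u' s) * D1 s + 2 * (v s - v' s) * D2 s
       - 4 * L * ((u s - u' s) ^ 2 + (v s - v' s) ^ 2)) * exp (- (4 * L * (s - a)))) a t); [lra|].
    intros s Hs.
    destruct (HS s ltac:(lra)) as [Du Dv]. destruct (HS' s ltac:(lra)) as [Du' Dv'].
    split.
    - unfold e, D1, D2. auto_derive.
      + repeat split; eexists; eassumption.
      + assert (Eu : Derive (fun x : R => u x) s = f1 s (u s) (v s)) by (apply is_derive_unique; exact Du).
        assert (Ev : Derive (fun x : R => v x) s = f2 s (u s) (v s)) by (apply is_derive_unique; exact Dv).
        assert (Eu' : Derive (fun x : R => u' x) s = f1 s (u' s) (v' s)) by (apply is_derive_unique; exact Du').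
        assert (Ev' : Derive (fun x : R => v' x) s = f2 s (u' s) (v' s)) by (apply is_derive_unique; exact Dv').
        rewrite Eu, Ev, Eu', Ev'.
        unfold Rminus. ring.
    - assert (I1 := B1 s (u s) (v s) (u' s) (v' s) ltac:(lra)).
      assert (I2 := B2 s (u s) (v s) (u' s) (v' s) ltac:(lra)).
      fold (D1 s) in I1. fold (D2 s) in I2.
      set (p := u s - u' s) in *. set (r := v s - v' s) in *.
      pose proof (exp_pos (- (4 * L * (s - a)))).
      apply Rmult_le_pos; [|lra].
      assert (P1 : p * D1 s <= Rabs p * (L1 * (Rabs p + Rabs r))).
      { eapply Rle_trans; [apply Rle_abs|]. rewrite Rabs_mult. apply Rmult_le_compat_l; [apply Rabs_pos|exact I1]. }
      assert (P2 : r * D2 s <= Rabs r * (L2 * (Rabs p + Rabs r))).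
      { eapply Rle_trans; [apply Rle_abs|]. rewrite Rabs_mult. apply Rmult_le_compat_l; [apply Rabs_pos|exact I2]. }
      rewrite <- (pow2_abs p), <- (pow2_abs r).
      pose proof (Rabs_pos p). pose proof (Rabs_pos r).
      assert (Q1 : 0 <= L1 * (Rabs p - Rabs r) ^ 2) by (apply Rmult_le_pos; [lra|apply pow2_ge_0]).
      assert (Q2 : 0 <= L2 * (Rabs p - Rabs r) ^ 2) by (apply Rmult_le_pos; [lra|apply pow2_ge_0]).
      assert (Q3 : 0 <= L1 * Rabs p ^ 2) by (apply Rmult_le_pos; [lra|apply pow2_ge_0]).
      assert (Q4 : 0 <= L2 * Rabs p ^ 2) by (apply Rmult_le_pos; [lra|apply pow2_ge_0]).
      assert (Q5 : 0 <= L1 * Rabs r ^ 2) by (apply Rmult_le_pos; [lra|apply pow2_ge_0]).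
      assert (Q6 : 0 <= L2 * Rabs r ^ 2) by (apply Rmult_le_pos; [lra|apply pow2_ge_0]).
      unfold L. nra. }
  unfold e in Hm. replace (- (4 * L * (a - a))) with 0 in Hm by ring. rewrite exp_0 in Hm.
  assert (Hx : exp (4 * L * (t - a)) <= exp (4 * L * Rabs (b - a))).
  { rewrite (Rabs_pos_eq (b - a)) by lra.
    assert (Hle : 4 * L * (t - a) <= 4 * L * (b - a)) by (apply Rmult_le_compat_l; lra).
    destruct Hle as [Hlt| ->]; [left; apply exp_increasing; exact Hlt|lra]. }
  rewrite exp_Ropp in Hm.
  set (et := (u t - u' t) ^ 2 + (v t - v' t) ^ 2) in *.
  set (ea := (u a - u' a) ^ 2 + (v a - v' a) ^ 2) in *.
  assert (Hea : 0 <= ea) by (unfold ea; pose proof (pow2_ge_0 (u a - u' a)); pose proof (pow2_ge_0 (v a - v' a)); lra).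
  pose proof (exp_pos (4 * L * (t - a))) as Hpos.
  apply Rle_trans with (exp (4 * L * (t - a)) * ea); [|nra].
  apply Rmult_le_reg_r with (/ exp (4 * L * (t - a))); [apply Rinv_0_lt_compat; exact Hpos|].
  replace (exp (4 * L * (t - a)) * ea * / exp (4 * L * (t - a))) with ea by (field; lra). lra.
Qed.

(** Initial values of solutions that stay in the tube up to time T + j accumulate
    at the initial value of a solution that stays in it forever. *)
Lemma solution_of_finite_horizons (T0 T : R) (f1 f2 : R -> R -> R -> R) (phi : R -> R) :
  ode_field T0 f1 -> ode_field T0 f2 -> T0 < T ->
  (forall j : nat, exists u v, solves T0 f1 f2 u v /\
     forall t, T <= t <= T + INR j -> Rabs (u t) <= phi t /\ Rabs (v t) <= phi t) ->
  exists u v, solves T0 f1 f2 u v /\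
    forall t, T <= t -> Rabs (u t) <= phi t /\ Rabs (v t) <= phi t.
Proof.
  intros F1 F2 HT HJ.
  destruct (countable_choice ((R -> R) * (R -> R)) (fun j w => solves T0 f1 f2 (fst w) (snd w) /\
     forall t, T <= t <= T + INR j -> Rabs (fst w t) <= phi t /\ Rabs (snd w t) <= phi t)) as [w Hw].
  { intros j. destruct (HJ j) as (u & v & H). exists (u, v). exact H. }
  assert (HwT : forall j, Rabs (fst (w j) T) <= phi T /\ Rabs (snd (w j) T) <= phi T).
  { intros j. apply (Hw j). pose proof (pos_INR j). lra. }
  destruct (bounded_subsequence (fun j => fst (w j) T) (- phi T) (phi T)) as (a & g1 & _ & Hg1 & La).
  { intros j. apply Rabs_le_between, HwT. }
  destruct (bounded_subsequence (fun j => snd (w (g1 j)) T) (- phi T) (phi T)) as (b & g2 & _ & Hg2 & Lb).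
  { intros j. apply Rabs_le_between, HwT. }
  destruct (picard_lindelof T0 T a b f1 f2 F1 F2 HT) as (u & v & Hu & Hv & HS).
  exists u, v. split; [exact HS|].
  intros t Ht.
  destruct (solutions_close T0 T t f1 f2 F1 F2 HT) as (C & HC & Hclose).
  assert (Hnear : forall eps, 0 < eps -> exists x y, Rabs x <= phi t /\ Rabs y <= phi t /\
            Rabs (u t - x) <= eps /\ Rabs (v t - y) <= eps).
  { intros eps He.
    set (d := eps / (2 * (C + 1))).
    assert (Hd : 0 < d) by (apply Rdiv_lt_0_compat; lra).
    destruct (La d Hd) as [N1 HN1]. destruct (Lb d Hd) as [N2 HN2].
    destruct (INR_unbounded (t - T)) as [N3 HN3].
    set (N := (N1 + N2 + N3)%nat). set (k := g1 (g2 N)).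
    assert (K2 : (N <= g2 N)%nat) by apply Hg2. assert (K1 : (g2 N <= k)%nat) by apply Hg1.
    destruct (Hw k) as [HSk HBk].
    assert (Hk : INR N3 <= INR k) by (apply le_INR; lia).
    destruct (HBk t ltac:(lra)) as [X Y].
    exists (fst (w k) t), (snd (w k) t). split; [exact X|]. split; [exact Y|].
    assert (Hcl := Hclose u v (fst (w k)) (snd (w k)) HS HSk t ltac:(lra)).
    rewrite Hu, Hv in Hcl.
    assert (A1 := HN1 (g2 N) ltac:(lia)). assert (A2 := HN2 N ltac:(lia)).
    fold k in A1, A2. apply Rabs_def2 in A1, A2.
    assert (Hs1 : (a - fst (w k) T) ^ 2 <= d ^ 2) by nra.
    assert (Hs2 : (b - snd (w k) T) ^ 2 <= d ^ 2) by nra.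
    assert (Hfin : C * (2 * d ^ 2) <= eps ^ 2).
    { replace eps with (2 * (C + 1) * d) by (unfold d; field; lra).
      pose proof (pow2_ge_0 d). nra. }
    assert (Hm : C * ((a - fst (w k) T) ^ 2 + (b - snd (w k) T) ^ 2) <= C * (2 * d ^ 2))
      by (apply Rmult_le_compat_l; lra).
    pose proof (pow2_ge_0 (u t - fst (w k) t)). pose proof (pow2_ge_0 (v t - snd (w k) t)).
    split; apply abs_le_of_sqr; lra. }
  split; apply Rnot_lt_le; intros Hc.
  - destruct (Hnear ((Rabs (u t) - phi t) / 2) ltac:(lra)) as (x & y & X & _ & D & _).
    pose proof (Rabs_triang (u t - x) x). replace (u t - x + x) with (u t) in H by ring. lra.
  - destruct (Hnear ((Rabs (v t) - phi t) / 2) ltac:(lra)) as (x & y & _ & Y & _ & D).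
    pose proof (Rabs_triang (v t - y) y). replace (v t - y + y) with (v t) in H by ring. lra.
Qed.

(** * Powers of t^(-1/q) and the two properties of a linear system *)

Definition at_infinity (P : R -> Prop) : Prop := exists T, forall t, T <= t -> P t.

Lemma at_infinity_and (P Q : R -> Prop) :
  at_infinity P -> at_infinity Q -> at_infinity (fun t => P t /\ Q t).
Proof.
  intros [T1 H1] [T2 H2]. exists (Rmax T1 T2). intros t Ht.
  pose proof (Rmax_l T1 T2). pose proof (Rmax_r T1 T2). split; [apply H1|apply H2]; lra.
Qed.

Lemma at_infinity_imp (P Q : R -> Prop) :
  (forall t, P t -> Q t) -> at_infinity P -> at_infinity Q.
Proof. intros H [T HT]. exists T. intros t Ht. apply H, HT, Ht. Qed.

Lemma at_infinity_ge (M : R) : at_infinity (fun t => M <= t).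
Proof. exists M. intros t Ht. exact Ht. Qed.

Lemma at_infinity_Rbar_locally (P : R -> Prop) : at_infinity P <-> Rbar_locally p_infty P.
Proof.
  split.
  - intros [T H]. exists T. intros t Ht. apply H. lra.
  - intros [T H]. exists (T + 1). intros t Ht. apply H. lra.
Qed.

Lemma tpow_pos (q k : nat) (t : R) : 0 < tpow q k t.
Proof. apply exp_pos. Qed.

Lemma tpow_0 (q : nat) (t : R) : tpow q 0 t = 1.
Proof.
  unfold tpow. simpl INR. unfold Rdiv. rewrite Rmult_0_l, Ropp_0. unfold Rpower. rewrite Rmult_0_l. apply exp_0.
Qed.

Lemma tpow_add (q j k : nat) (t : R) : tpow q (j + k) t = tpow q j t * tpow q k t.
Proof.
  unfold tpow. rewrite <- Rpower_plus, plus_INR. f_equal. unfold Rdiv. ring.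
Qed.

Lemma tpow_pow (q k : nat) (t : R) : tpow q k t = tpow q 1 t ^ k.
Proof.
  induction k as [|k IH].
  - apply tpow_0.
  - change (S k) with (1 + k)%nat. rewrite tpow_add, IH. reflexivity.
Qed.

Lemma tpow_mul2 (q k : nat) (t : R) : tpow q (2 * k) t = tpow q k t ^ 2.
Proof. replace (2 * k)%nat with (k + k)%nat by lia. rewrite tpow_add. ring. Qed.

Lemma tpow_base (q : nat) (t : R) : (0 < q)%nat -> 0 < t -> tpow q q t = / t.
Proof.
  intros Hq Ht. unfold tpow. replace (INR q / INR q) with 1.
  - rewrite Rpower_Ropp, Rpower_1 by exact Ht. reflexivity.
  - field. apply not_0_INR. lia.
Qed.

Lemma tpow_half (q n : nat) (t : R) : (0 < q)%nat -> tpow (2 * q) n t ^ 2 = tpow q n t.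
Proof.
  intros Hq. rewrite <- tpow_mul2. unfold tpow. f_equal. rewrite !mult_INR. field.
  repeat split; apply not_0_INR; lia.
Qed.

Lemma is_derive_tpow (q k : nat) (t : R) :
  0 < t -> is_derive (tpow q k) t (- (INR k / INR q) * tpow q k t * / t).
Proof.
  intros Ht. unfold tpow, Rpower. generalize (INR k / INR q). intros r. auto_derive; [exact Ht|]. field. lra.
Qed.

Lemma tpow_le_1 (q k : nat) (t : R) : (0 < q)%nat -> 1 <= t -> tpow q k t <= 1.
Proof.
  intros Hq Ht. unfold tpow, Rpower. rewrite <- exp_0.
  assert (H : - (INR k / INR q) * ln t <= 0).
  { assert (0 <= ln t) by (rewrite <- ln_1; destruct Ht as [Ht| <-]; [left; apply ln_increasing; lra|lra]).
    assert (0 <= INR k / INR q) by (apply Rdiv_le_0_compat; [apply pos_INR|apply lt_0_INR; exact Hq]).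
    nra. }
  destruct H as [H|H]; [left; apply exp_increasing; exact H|rewrite H; lra].
Qed.

Lemma tpow_le (q j k : nat) (t : R) : (0 < q)%nat -> 1 <= t -> (j <= k)%nat -> tpow q k t <= tpow q j t.
Proof.
  intros Hq Ht Hjk. replace k with (j + (k - j))%nat by lia. rewrite tpow_add.
  pose proof (tpow_le_1 q (k - j) t Hq Ht). pose proof (tpow_pos q j t). nra.
Qed.

Lemma tpow_small (q k : nat) (eps : R) :
  (0 < q)%nat -> (0 < k)%nat -> 0 < eps -> at_infinity (fun t => tpow q k t <= eps).
Proof.
  intros Hq Hk He.
  assert (Hr : 0 < INR k / INR q) by (apply Rdiv_lt_0_compat; apply lt_0_INR; assumption).
  exists (exp (- ln eps / (INR k / INR q))). intros t Ht.
  assert (Hl : - ln eps / (INR k / INR q) <= ln t).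
  { rewrite <- (ln_exp (- ln eps / (INR k / INR q))).
    destruct Ht as [Ht| <-]; [left; apply ln_increasing; [apply exp_pos|exact Ht]|lra]. }
  unfold tpow, Rpower. apply Rle_trans with (exp (ln eps)); [|rewrite exp_ln by exact He; lra].
  assert (H : - (INR k / INR q) * ln t <= ln eps).
  { apply Rmult_le_compat_l with (r := INR k / INR q) in Hl; [|lra].
    replace (INR k / INR q * (- ln eps / (INR k / INR q))) with (- ln eps) in Hl.
    - lra.
    - field. split; apply not_0_INR; lia. }
  destruct H as [H|H]; [left; apply exp_increasing; exact H|rewrite H; lra].
Qed.

(** The planar linear system with forcing (h1, h2); c enters with a minus sign,
    so c > 0 is the rotating case and c < 0 the saddle. *)
Definition linear_system (a b c d u v h1 h2 : R -> R) (t : R) : Prop :=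
  is_derive u t (a t * u t + b t * v t + h1 t) /\
  is_derive v t (- c t * u t + d t * v t + h2 t).

(** The number of powers of t^(-1/q) by which a solution of the linear system may be
    larger than its forcing: q for the integration in time, at most q for the passage
    between (u, v) and the energy s^2 u^2 + v^2, where s^2 = kap t^(-n/q), and one to
    absorb constants. *)
Definition loss (q : nat) : nat := (2 * q + 1)%nat.

Definition bounded_pair (C : R) (g : R -> R) (u v : R -> R) (t : R) : Prop :=
  Rabs (u t) <= C * g t /\ Rabs (v t) <= C * g t.

(** Stated for a forcing that depends on the solution: its Lipschitz constant in
    (u, v) is not controlled as t -> oo, so that no fixed-point argument can treat
    the forcing as given. *)
Definition finite_horizon_solvable (q : nat) (a b c d : R -> R) : Prop :=
  exists m0, forall m, (m0 <= m)%nat -> exists T1, forall T0 T f1 f2,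
    T1 <= T -> T0 < T -> ode_field T0 f1 -> ode_field T0 f2 ->
    (forall t u v, T <= t ->
       Rabs (f1 t u v - (a t * u + b t * v)) <= tpow q (m + loss q) t /\
       Rabs (f2 t u v - (- c t * u + d t * v)) <= tpow q (m + loss q) t) ->
    forall j : nat, exists u v, solves T0 f1 f2 u v /\
      forall t, T <= t <= T + INR j -> Rabs (u t) <= tpow q m t /\ Rabs (v t) <= tpow q m t.

(** Used repeatedly, this turns a rough bound on a solution into bounds of every
    order. *)
Definition decay_improving (q : nat) (a b c d : R -> R) : Prop :=
  exists m0, forall m u v h1 h2 C, (m0 <= m)%nat ->
    at_infinity (linear_system a b c d u v h1 h2) ->
    at_infinity (bounded_pair C (tpow q m0) u v) ->
    at_infinity (bounded_pair 1 (tpow q (m + loss q)) h1 h2) ->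
    exists C', at_infinity (bounded_pair C' (tpow q m) u v).

(** The passage from the energy s^2 u^2 + v^2 back to u costs a factor 1/s, where
    s^2 = kap t^(-n/q); the n additional powers in the tube pay for it and for the
    constants. *)
Lemma energy_bound (q n m : nat) (kap K C u v t : R) :
  (0 < q)%nat -> (1 <= n)%nat -> 0 < kap -> 0 <= C ->
  K / kap * tpow q n t <= C ^ 2 -> K * tpow q (2 * n) t <= C ^ 2 ->
  kap * tpow q n t * u ^ 2 + v ^ 2 <= K * tpow q (2 * (m + n)) t ->
  Rabs u <= C * tpow q m t /\ Rabs v <= C * tpow q m t.
Proof.
  intros Hq Hn Hk HC H1 H2 H.
  pose proof (tpow_pos q m t) as Pm. pose proof (tpow_pos q n t) as Pn.
  replace (2 * (m + n))%nat with (2 * m + 2 * n)%nat in H by lia.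
  rewrite tpow_add in H. rewrite tpow_mul2 in H2. rewrite !tpow_mul2 in H.
  set (p := tpow q m t) in *. set (r := tpow q n t) in *.
  assert (Hp2 : 0 < p ^ 2) by (apply pow_lt; exact Pm).
  pose proof (pow2_ge_0 u). pose proof (pow2_ge_0 v).
  assert (Hkr : 0 < kap * r) by (apply Rmult_lt_0_compat; assumption).
  split; apply abs_le_of_sqr; try (apply Rmult_le_pos; lra); rewrite Rpow_mult_distr.
  - apply Rle_trans with ((K / kap * r) * p ^ 2); [|apply Rmult_le_compat_r; lra].
    apply Rmult_le_reg_l with (kap * r); [exact Hkr|].
    replace (kap * r * (K / kap * r * p ^ 2)) with (K * (p ^ 2 * r ^ 2)) by (field; lra). nra.
  - apply Rle_trans with ((K * r ^ 2) * p ^ 2); [|apply Rmult_le_compat_r; lra].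
    assert (0 <= kap * r * u ^ 2) by (apply Rmult_le_pos; lra). lra.
Qed.

(** * The saddle: pointwise inequalities *)

(** The rate s with s^2 = kap t^(-n/q): exponent of the saddle, or frequency of the
    rotation. *)
Definition rate (q n : nat) (kap t : R) : R := sqrt kap * tpow (2 * q) n t.

Lemma rate_pos (q n : nat) (kap t : R) : 0 < kap -> 0 < rate q n kap t.
Proof. intros Hk. apply Rmult_lt_0_compat; [apply sqrt_lt_R0, Hk|apply tpow_pos]. Qed.

Lemma rate_sqr (q n : nat) (kap t : R) :
  (0 < q)%nat -> 0 < kap -> rate q n kap t ^ 2 = kap * tpow q n t.
Proof.
  intros Hq Hk. unfold rate. rewrite Rpow_mult_distr, tpow_half by exact Hq.
  rewrite pow2_sqrt by lra. reflexivity.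
Qed.

Lemma is_derive_rate (q n : nat) (kap t : R) :
  0 < t -> is_derive (rate q n kap) t (- (INR n / INR (2 * q)) * rate q n kap t * / t).
Proof.
  intros Ht. unfold rate.
  replace (- (INR n / INR (2 * q)) * (sqrt kap * tpow (2 * q) n t) * / t)
    with (sqrt kap * (- (INR n / INR (2 * q)) * tpow (2 * q) n t * / t)) by ring.
  apply (is_derive_scal (tpow (2 * q) n)), is_derive_tpow, Ht.
Qed.

Lemma rate_small (q n : nat) (kap eps : R) :
  (1 <= n <= q)%nat -> 0 < kap -> 0 < eps -> at_infinity (fun t => rate q n kap t <= eps).
Proof.
  intros Hn Hk He. pose proof (sqrt_lt_R0 kap Hk) as Hs.
  apply (at_infinity_imp (fun t => tpow (2 * q) n t <= eps / sqrt kap)).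
  - intros t Ht. unfold rate. apply Rmult_le_compat_l with (r := sqrt kap) in Ht; [|lra].
    replace (sqrt kap * (eps / sqrt kap)) with eps in Ht by (field; lra). exact Ht.
  - apply tpow_small; [lia|lia|apply Rdiv_lt_0_compat; assumption].
Qed.

(** Here n <= q enters: 1/t = e^q <= e^n, which is of the order of s^2 and hence
    negligible against s. The slow variation of all coefficients is of relative size
    1/t. *)
Lemma inv_le_rate (q n : nat) (kap K : R) :
  (1 <= n <= q)%nat -> 0 < kap -> at_infinity (fun t => K * / t <= rate q n kap t).
Proof.
  intros Hn Hk. pose proof (sqrt_lt_R0 kap Hk) as Hs.
  assert (HK : 0 < Rabs K + 1) by (pose proof (Rabs_pos K); lra).
  apply (at_infinity_imp (fun t => 1 <= t /\ tpow (2 * q) n t <= sqrt kap / (Rabs K + 1))).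
  - intros t [H1 Ht].
    assert (Hi : / t <= tpow (2 * q) n t ^ 2).
    { rewrite tpow_half by lia. rewrite <- (tpow_base q t) by (lia || lra). apply tpow_le; lia || lra. }
    unfold rate. pose proof (tpow_pos (2 * q) n t) as Hp.
    set (r := tpow (2 * q) n t) in *.
    apply Rmult_le_compat_l with (r := Rabs K + 1) in Ht; [|lra].
    replace ((Rabs K + 1) * (sqrt kap / (Rabs K + 1))) with (sqrt kap) in Ht by (field; lra).
    pose proof (Rle_abs K). assert (Hti : 0 < / t) by (apply Rinv_0_lt_compat; lra).
    apply Rle_trans with ((Rabs K + 1) * / t); [apply Rmult_le_compat_r; lra|].
    apply Rle_trans with ((Rabs K + 1) * r ^ 2); [apply Rmult_le_compat_l; lra|]. nra.
  - apply at_infinity_and; [apply at_infinity_ge|].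
    apply tpow_small; [lia|lia|apply Rdiv_lt_0_compat; lra].
Qed.

(** The forcing is negligible against the rate times the width of the tube; this
    is where the loss of t^((2q+1)/q) is spent. *)
Lemma forcing_le_rate (q n m : nat) (kap eps : R) :
  (1 <= n <= q)%nat -> 0 < kap -> 0 < eps ->
  at_infinity (fun t => tpow q (m + loss q) t <= eps * rate q n kap t * tpow q (m + n) t).
Proof.
  intros Hn Hk He. pose proof (sqrt_lt_R0 kap Hk) as Hs.
  apply (at_infinity_imp (fun t => 1 <= t /\ tpow (2 * q) n t <= eps * sqrt kap)).
  - intros t [H1 Ht].
    replace (m + loss q)%nat with ((m + n) + (loss q - n))%nat by (unfold loss; lia).
    rewrite (tpow_add q (m + n)).
    assert (Hi : tpow q (loss q - n) t <= tpow (2 * q) n t ^ 2).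
    { rewrite tpow_half by lia. apply tpow_le; [lia|lra|unfold loss; lia]. }
    unfold rate. pose proof (tpow_pos (2 * q) n t) as Hp. pose proof (tpow_pos q (m + n) t) as Hp2.
    set (r := tpow (2 * q) n t) in *.
    rewrite (Rmult_comm (eps * (sqrt kap * r))). apply Rmult_le_compat_l; [lra|]. nra.
  - apply at_infinity_and; [apply at_infinity_ge|].
    apply tpow_small; [lia|lia|apply Rmult_lt_0_compat; lra].
Qed.

Lemma abs_mul_le (x y A B : R) : Rabs x <= A -> Rabs y <= B -> Rabs (x * y) <= A * B.
Proof.
  intros Hx Hy. rewrite Rabs_mult. apply Rmult_le_compat; try apply Rabs_pos; assumption.
Qed.

(** For the model saddle a = d = 0, b = 1, c = - s^2 the derivative of s u v is
    s (s^2 u^2 + v^2). The margins 1/32 and 1/8 leave room for all perturbations,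
    given that the product exceeds the square of the tube width psi. *)
Lemma saddle_product_grows (a b c d s s' u v h1 h2 psi H : R) :
  0 < s <= 1 -> Rabs a <= s / 32 -> Rabs d <= s / 32 -> Rabs (b - 1) <= 1 / 32 ->
  Rabs (c + s ^ 2) <= s ^ 2 / 32 -> Rabs s' <= s ^ 2 / 32 ->
  Rabs h1 <= H -> Rabs h2 <= H -> 0 < psi -> H <= s * psi / 8 ->
  psi ^ 2 < s * u * v ->
  0 <= s' * u * v + s * (a * u + b * v + h1) * v + s * u * (- c * u + d * v + h2).
Proof.
  intros Hs Ha Hd Hb Hc Hs' H1 H2 Hpsi HH HD.
  set (x := s * u).
  assert (Ex : u = x / s) by (unfold x; field; lra).
  pose proof (Rabs_pos x) as Px. pose proof (Rabs_pos v) as Pv.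
  set (N := Rabs x + Rabs v).
  assert (HN : psi <= N / 2).
  { assert (x * v <= Rabs x * Rabs v) by (rewrite <- Rabs_mult; apply Rle_abs).
    fold x in HD. apply Rnot_lt_le. intros Hlt. unfold N in Hlt.
    pose proof (pow2_ge_0 (Rabs x - Rabs v)). nra. }
  assert (Q : N ^ 2 <= 2 * (x ^ 2 + v ^ 2)).
  { rewrite <- (pow2_abs x), <- (pow2_abs v). unfold N. pose proof (pow2_ge_0 (Rabs x - Rabs v)). nra. }
  assert (Hxv : Rabs x * Rabs v <= (x ^ 2 + v ^ 2) / 2).
  { rewrite <- (pow2_abs x), <- (pow2_abs v). pose proof (pow2_ge_0 (Rabs x - Rabs v)). nra. }
  assert (T1 : Rabs (s' * u * v) <= s / 32 * (Rabs x * Rabs v)).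
  { rewrite !Rabs_mult, Ex. unfold Rdiv at 1. rewrite Rabs_mult, Rabs_inv, (Rabs_pos_eq s) by lra.
    replace (Rabs s' * (Rabs x * / s) * Rabs v) with ((Rabs s' * / s) * (Rabs x * Rabs v)) by ring.
    apply Rmult_le_compat_r; [apply Rmult_le_pos; lra|].
    replace (s / 32) with (s ^ 2 / 32 * / s) by (field; lra).
    apply Rmult_le_compat_r; [left; apply Rinv_0_lt_compat; lra|exact Hs']. }
  assert (T2 : Rabs (a * x * v) <= s / 32 * (Rabs x * Rabs v)).
  { rewrite !Rabs_mult. rewrite Rmult_assoc. apply Rmult_le_compat_r; [apply Rmult_le_pos; lra|exact Ha]. }
  assert (T3 : Rabs (d * x * v) <= s / 32 * (Rabs x * Rabs v)).
  { rewrite !Rabs_mult. rewrite Rmult_assoc. apply Rmult_le_compat_r; [apply Rmult_le_pos; lra|exact Hd]. }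
  assert (T4 : 31 / 32 * s * v ^ 2 <= s * b * v ^ 2).
  { apply Rabs_le_between in Hb. pose proof (pow2_ge_0 v). assert (0 <= s * v ^ 2) by (apply Rmult_le_pos; lra). nra. }
  assert (T5 : 31 / 32 * s * x ^ 2 <= - (s * c * u ^ 2)).
  { apply Rabs_le_between in Hc. pose proof (pow2_ge_0 u). unfold x.
    assert (0 <= s * u ^ 2) by (apply Rmult_le_pos; lra). nra. }
  assert (HP : 0 <= H) by (pose proof (Rabs_pos h1); lra).
  assert (T6 : Rabs (s * h1 * v) <= H * Rabs v).
  { rewrite !Rabs_mult. apply Rmult_le_compat_r; [lra|]. rewrite (Rabs_pos_eq s) by lra.
    pose proof (Rabs_pos h1). nra. }
  assert (T7 : Rabs (x * h2) <= H * Rabs x).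
  { rewrite Rabs_mult, Rmult_comm. apply Rmult_le_compat_r; lra. }
  assert (T8 : H * N <= s * N ^ 2 / 16).
  { assert (H <= s * N / 16) by nra. assert (0 <= N) by (unfold N; lra). nra. }
  assert (T9 : s * N ^ 2 <= s * (2 * (x ^ 2 + v ^ 2))) by (apply Rmult_le_compat_l; lra).
  assert (T10 : s * (Rabs x * Rabs v) <= s * ((x ^ 2 + v ^ 2) / 2)) by (apply Rmult_le_compat_l; lra).
  apply Rabs_le_between in T1, T2, T3, T6, T7.
  replace (s' * u * v + s * (a * u + b * v + h1) * v + x * (- c * u + d * v + h2)) with
    (s' * u * v + a * x * v + d * x * v + s * b * v ^ 2 - s * c * u ^ 2 + s * h1 * v + x * h2)
    by (unfold x; ring).
  assert (0 <= s * (x ^ 2 + v ^ 2)) by (apply Rmult_le_pos; [lra|]; pose proof (pow2_ge_0 x); pose proof (pow2_ge_0 v); lra).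
  assert (T11 : H * Rabs x + H * Rabs v <= s * N ^ 2 / 16) by (unfold N at 1 in T8; lra).
  lra.
Qed.

(** For the model saddle v - s u decays at the rate s. The coupling to v + s u is
    harmless as long as s u v does not exceed psi^2, because then v - s u is the
    dominant part of (s u, v). *)
Lemma saddle_stable_part_decays (a b c d s s' u v h1 h2 psi H : R) :
  0 < s <= 1 -> Rabs a <= s / 32 -> Rabs d <= s / 32 -> Rabs (b - 1) <= 1 / 32 ->
  Rabs (c + s ^ 2) <= s ^ 2 / 32 -> Rabs s' <= s ^ 2 / 32 ->
  Rabs h1 <= H -> Rabs h2 <= H -> 0 < psi -> H <= s * psi / 8 ->
  s * u * v <= psi ^ 2 -> psi ^ 2 < (v - s * u) ^ 2 ->
  2 * (v - s * u) * ((- c * u + d * v + h2) - s' * u - s * (a * u + b * v + h1))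
    <= - s * (v - s * u) ^ 2.
Proof.
  intros Hs Ha Hd Hb Hc Hs' H1 H2 Hpsi HH HD Hz.
  set (x := s * u) in *.
  set (z := v - x) in *.
  set (err := - (c + s ^ 2) * u + d * v + h2 - s' * u - a * x - s * (b - 1) * v - s * h1).
  replace ((- c * u + d * v + h2) - s' * u - s * (a * u + b * v + h1)) with (- s * z + err)
    by (unfold err, z, x; ring).
  pose proof (Rabs_pos x) as Px. pose proof (Rabs_pos v) as Pv. pose proof (Rabs_pos z) as Pz.
  assert (Eu : Rabs u * s = Rabs x) by (unfold x; rewrite Rabs_mult, (Rabs_pos_eq s) by lra; ring).
  assert (Hpz : psi <= Rabs z).
  { apply Rnot_lt_le. intros Hlt. rewrite <- (pow2_abs z) in Hz. nra. }
  assert (HN : Rabs x + Rabs v <= 5 / 2 * Rabs z).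
  { apply Rnot_lt_le. intros Hlt.
    assert (Q : (Rabs x + Rabs v) ^ 2 <= 2 * (x ^ 2 + v ^ 2)).
    { rewrite <- (pow2_abs x), <- (pow2_abs v). pose proof (pow2_ge_0 (Rabs x - Rabs v)). nra. }
    assert (Q2 : x ^ 2 + v ^ 2 = z ^ 2 + 2 * (x * v)) by (unfold z; ring).
    rewrite <- (pow2_abs z) in Q2.
    assert (Q3 : (5 / 2 * Rabs z) ^ 2 < (Rabs x + Rabs v) ^ 2) by nra.
    assert (Q4 : psi ^ 2 <= Rabs z ^ 2) by nra. nra. }
  assert (T1 : Rabs ((c + s ^ 2) * u) <= s / 32 * Rabs x).
  { rewrite Rabs_mult, <- Eu. pose proof (Rabs_pos u).
    replace (s / 32 * (Rabs u * s)) with (s ^ 2 / 32 * Rabs u) by field. apply Rmult_le_compat_r; lra. }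
  assert (T2 : Rabs (s' * u) <= s / 32 * Rabs x).
  { rewrite Rabs_mult, <- Eu. pose proof (Rabs_pos u).
    replace (s / 32 * (Rabs u * s)) with (s ^ 2 / 32 * Rabs u) by field. apply Rmult_le_compat_r; lra. }
  assert (T3 : Rabs (a * x) <= s / 32 * Rabs x) by (rewrite Rabs_mult; apply Rmult_le_compat_r; lra).
  assert (T4 : Rabs (d * v) <= s / 32 * Rabs v) by (rewrite Rabs_mult; apply Rmult_le_compat_r; lra).
  assert (T5 : Rabs (s * (b - 1) * v) <= s / 32 * Rabs v).
  { rewrite Rabs_mult; apply Rmult_le_compat_r; [lra|].
    rewrite Rabs_mult, (Rabs_pos_eq s) by lra. nra. }
  assert (T6 : Rabs (s * h1) <= H).
  { rewrite Rabs_mult, (Rabs_pos_eq s) by lra. pose proof (Rabs_pos h1). nra. }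
  assert (Herr : Rabs err <= s / 2 * Rabs z).
  { apply Rle_trans with (3 * (s / 32) * (Rabs x + Rabs v) + 2 * (s * Rabs z / 8)).
    - assert (HHz : H <= s * Rabs z / 8) by nra.
      apply Rabs_le_between in T1, T2, T3, T4, T5, T6, H2. unfold err.
      assert (0 <= s / 32 * Rabs v) by (apply Rmult_le_pos; lra).
      apply Rabs_le_between. lra.
    - assert (3 * (s / 32) * (Rabs x + Rabs v) <= 3 * (s / 32) * (5 / 2 * Rabs z))
        by (apply Rmult_le_compat_l; lra).
      assert (0 <= s * Rabs z) by (apply Rmult_le_pos; lra). lra. }
  assert (Hp : z * err <= s / 2 * z ^ 2).
  { eapply Rle_trans; [apply Rle_abs|]. rewrite Rabs_mult, <- (pow2_abs z).
    assert (Rabs z * Rabs err <= Rabs z * (s / 2 * Rabs z)) by (apply Rmult_le_compat_l; lra). lra. }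
  nra.
Qed.

(** * The saddle: solutions in a tube *)

Lemma at_infinity_all (P : R -> Prop) :
  at_infinity P -> exists T, 1 <= T /\ forall t, T <= t -> P t.
Proof.
  intros H. destruct (at_infinity_and _ _ H (at_infinity_ge 1)) as [T HT].
  exists (Rmax T 1). split; [apply Rmax_r|]. intros t Ht. apply HT.
  pose proof (Rmax_l T 1). lra.
Qed.

Lemma is_derive_tube (q M : nat) (t : R) :
  0 < t -> is_derive (fun s => tpow q M s ^ 2) t (- (2 * (INR M / INR q)) * / t * tpow q M t ^ 2).
Proof.
  intros Ht.
  apply (is_derive_ext (tpow q (2 * M))); [intros s; apply tpow_mul2|].
  rewrite <- tpow_mul2.
  replace (- (2 * (INR M / INR q)) * / t * tpow q (2 * M) t)
    with (- (INR (2 * M) / INR q) * tpow q (2 * M) t * / t).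
  - apply is_derive_tpow, Ht.
  - rewrite mult_INR. simpl (INR 2). unfold Rdiv. ring.
Qed.

(** Closeness to the model saddle u' = v, v' = s^2 u, measured in units of s. *)
Definition near_saddle (q n : nat) (kap : R) (a b c d : R -> R) : Prop :=
  forall eta, 0 < eta -> at_infinity (fun t =>
    let s := rate q n kap t in
    Rabs (a t) <= eta * s /\ Rabs (d t) <= eta * s /\ Rabs (b t - 1) <= eta /\
    Rabs (c t + s ^ 2) <= eta * s ^ 2).

(** D = s u v is positive on the side of the unstable direction and grows there
    as soon as it beats the tube; below that, the stable coordinate v - s u
    cannot leave the tube. *)
Lemma saddle_barriers (q n m : nat) (kap : R) (a b c d : R -> R) :
  (1 <= n <= q)%nat -> 0 < kap -> near_saddle q n kap a b c d ->
  exists T1, 1 <= T1 /\ forall u v h1 h2 t0 t1, T1 <= t0 <= t1 ->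
    (forall t, t0 <= t <= t1 -> linear_system a b c d u v h1 h2 t /\
                               bounded_pair 1 (tpow q (m + loss q)) h1 h2 t) ->
    let D := fun t => rate q n kap t * u t * v t - tpow q (m + n) t ^ 2 in
    let S := fun t => (v t - rate q n kap t * u t) ^ 2 in
    (0 < D t0 -> D t0 <= D t1) /\
    (forall B, 1 <= B -> (forall t, t0 <= t <= t1 -> D t <= 0) ->
       S t0 <= B * tpow q (m + n) t0 ^ 2 -> S t1 <= B * tpow q (m + n) t1 ^ 2).
Proof.
  intros Hn Hk HA.
  set (s := rate q n kap). set (psi := tpow q (m + n)).
  destruct (at_infinity_all _ (at_infinity_and _ _ (HA (1 / 32) ltac:(lra))
     (at_infinity_and _ _ (rate_small q n kap 1 Hn Hk ltac:(lra))
     (at_infinity_and _ _ (inv_le_rate q n kap (32 * (INR n / INR (2 * q))) Hn Hk)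
     (at_infinity_and _ _ (inv_le_rate q n kap (2 * (INR (m + n) / INR q)) Hn Hk)
       (forcing_le_rate q n m kap (1 / 8) Hn Hk ltac:(lra))))))) as (T1 & HT1 & HT).
  exists T1. split; [exact HT1|].
  intros u v h1 h2 t0 t1 Ht HS D S.
  set (s' := fun t => - (INR n / INR (2 * q)) * s t * / t).
  set (de := fun t => s' t * u t * v t + s t * (a t * u t + b t * v t + h1 t) * v t
                    + s t * u t * (- c t * u t + d t * v t + h2 t)).
  set (df := fun t => 2 * (v t - s t * u t) * ((- c t * u t + d t * v t + h2 t) - s' t * u t
                    - s t * (a t * u t + b t * v t + h1 t))).
  set (dp := fun t => - (2 * (INR (m + n) / INR q)) * / t * psi t ^ 2).
  assert (Hdp : forall t, 1 <= t -> is_derive (fun t => psi t ^ 2) t (dp t)).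
  { intros t H1. apply is_derive_tube. lra. }
  assert (HnR : 0 <= INR n / INR (2 * q)) by (apply Rdiv_le_0_compat; [apply pos_INR|apply lt_0_INR; lia]).
  assert (HMR : 0 <= INR (m + n) / INR q) by (apply Rdiv_le_0_compat; [apply pos_INR|apply lt_0_INR; lia]).
  assert (HdD : forall t, t0 <= t <= t1 -> is_derive D t (de t - dp t)).
  { intros t H1. destruct (HS t H1) as [[Du Dv] _].
    assert (Ds := is_derive_rate q n kap t ltac:(lra)). fold s in Ds. fold (s' t) in Ds.
    apply (is_derive_minus (fun t => s t * u t * v t) (fun t => psi t ^ 2)); [|apply Hdp; lra].
    evar_last.
    - apply (is_derive_mult (fun t => s t * u t) v t); [|exact Dv|exact Rmult_comm].
      apply (is_derive_mult s u t); [exact Ds|exact Du|exact Rmult_comm].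
    - unfold de, plus, mult; simpl. ring. }
  assert (HdS : forall t, t0 <= t <= t1 -> is_derive S t (df t)).
  { intros t H1. destruct (HS t H1) as [[Du Dv] _].
    assert (Ds := is_derive_rate q n kap t ltac:(lra)). fold s in Ds. fold (s' t) in Ds.
    unfold S. evar_last.
    - apply (is_derive_comp (fun y => y ^ 2) (fun t => v t - s t * u t)).
      + apply (is_derive_pow (fun y => y) 2). apply is_derive_id.
      + apply (is_derive_minus v (fun t => s t * u t)); [exact Dv|].
        apply (is_derive_mult s u t); [exact Ds|exact Du|exact Rmult_comm].
    - unfold df, plus, mult, minus, opp, plus, scal, one, mult; simpl. unfold mult; simpl. ring. }
  assert (Hpt : forall t, t0 <= t <= t1 -> 0 < s t <= 1 /\ Rabs (a t) <= s t / 32 /\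
     Rabs (d t) <= s t / 32 /\ Rabs (b t - 1) <= 1 / 32 /\ Rabs (c t + s t ^ 2) <= s t ^ 2 / 32 /\
     Rabs (s' t) <= s t ^ 2 / 32 /\ 0 < psi t /\ tpow q (m + loss q) t <= s t * psi t / 8 /\
     2 * (INR (m + n) / INR q) * / t <= s t).
  { intros t H1. destruct (HT t ltac:(lra)) as ((Ha & Hd & Hb & Hc) & Hs1 & Hi1 & Hi2 & Hf).
    pose proof (rate_pos q n kap t Hk) as Hs0. fold s in Ha, Hd, Hc, Hs1, Hi1, Hi2, Hf, Hs0. fold psi in Hf.
    repeat split; try lra.
    - unfold s'. assert (Hti : 0 < / t) by (apply Rinv_0_lt_compat; lra).
      rewrite Rabs_mult, Rabs_mult, Rabs_Ropp, (Rabs_pos_eq (s t)), (Rabs_pos_eq (/ t)), Rabs_pos_eq by lra.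
      nra.
    - apply tpow_pos. }
  split.
  - intros H0. apply (barrier_backward D (fun t => de t - dp t) t0 t1); [lra|exact HdD| |exact H0].
    intros t H1 Hpos.
    destruct (Hpt t H1) as (P1 & P2 & P3 & P4 & P5 & P6 & P7 & P8 & P9).
    destruct (HS t H1) as [_ [B1 B2]]. rewrite Rmult_1_l in B1, B2.
    assert (Hg := saddle_product_grows (a t) (b t) (c t) (d t) (s t) (s' t) (u t) (v t) (h1 t) (h2 t)
      (psi t) _ P1 P2 P3 P4 P5 P6 B1 B2 P7 P8).
    unfold D in Hpos. fold s psi in Hpos. specialize (Hg ltac:(lra)). fold (de t) in Hg.
    assert (dp t <= 0).
    { unfold dp. assert (Hti : 0 < / t) by (apply Rinv_0_lt_compat; lra).
      pose proof (pow2_ge_0 (psi t)).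
      assert (0 <= 2 * (INR (m + n) / INR q) * / t) by (apply Rmult_le_pos; lra). nra. }
    lra.
  - intros B HB HD H0.
    assert (H : S t1 - B * psi t1 ^ 2 <= 0); [|lra].
    apply (barrier_forward (fun t => S t - B * psi t ^ 2) (fun t => df t - B * dp t) t0 t1); [lra| | |fold psi in H0; lra].
    + intros t H1. apply (is_derive_minus S (fun t => B * psi t ^ 2)); [apply HdS; exact H1|].
      apply (is_derive_scal (fun t => psi t ^ 2)), Hdp. lra.
    + intros t H1 Hpos.
      destruct (Hpt t H1) as (P1 & P2 & P3 & P4 & P5 & P6 & P7 & P8 & P9).
      destruct (HS t H1) as [_ [B1 B2]]. rewrite Rmult_1_l in B1, B2.
      assert (Hp2 : 0 < psi t ^ 2) by (apply pow_lt; exact P7).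
      specialize (HD t H1). unfold D in HD. unfold S in Hpos. fold s psi in HD, Hpos.
      assert (Hg := saddle_stable_part_decays (a t) (b t) (c t) (d t) (s t) (s' t) (u t) (v t) (h1 t) (h2 t)
        (psi t) _ P1 P2 P3 P4 P5 P6 B1 B2 P7 P8 ltac:(lra) ltac:(nra)).
      fold (df t) in Hg. unfold dp.
      assert (s t * (B * psi t ^ 2) <= s t * (v t - s t * u t) ^ 2) by (apply Rmult_le_compat_l; lra).
      assert (2 * (INR (m + n) / INR q) * / t * (B * psi t ^ 2) <= s t * (B * psi t ^ 2)).
      { apply Rmult_le_compat_r; [apply Rmult_le_pos; lra|exact P9]. }
      lra.
Qed.

Lemma energy_bound_eventually (q n m : nat) (kap K C : R) :
  (1 <= n <= q)%nat -> 0 < kap -> 0 < C -> 0 <= K ->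
  at_infinity (fun t => forall u v,
    kap * tpow q n t * u ^ 2 + v ^ 2 <= K * tpow q (m + n) t ^ 2 ->
    Rabs u <= C * tpow q m t /\ Rabs v <= C * tpow q m t).
Proof.
  intros Hn Hk HC HK.
  assert (HC2 : 0 < C ^ 2) by (apply pow_lt; exact HC).
  set (e := C ^ 2 / (K / kap + K + 1)).
  assert (HKk : 0 <= K / kap) by (apply Rdiv_le_0_compat; lra).
  assert (He : 0 < e) by (apply Rdiv_lt_0_compat; lra).
  assert (HeK : (K / kap + K + 1) * e = C ^ 2).
  { assert (HW : 0 < K / kap + K + 1) by lra. unfold e.
    generalize dependent (K / kap + K + 1). intros W _ _ HW. field. lra. }
  destruct (tpow_small q n e ltac:(lia) ltac:(lia) He) as [T1 H1].
  destruct (tpow_small q (2 * n) e ltac:(lia) ltac:(lia) He) as [T2 H2].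
  exists (Rmax T1 T2). intros t Ht u v H.
  pose proof (Rmax_l T1 T2). pose proof (Rmax_r T1 T2).
  specialize (H1 t ltac:(lra)). specialize (H2 t ltac:(lra)).
  pose proof (tpow_pos q n t). pose proof (tpow_pos q (2 * n) t).
  rewrite <- tpow_mul2 in H.
  apply (energy_bound q n m kap K C u v t); try lia; try lra; nra.
Qed.

Lemma solves_linear_system (T0 t : R) (f1 f2 : R -> R -> R -> R) (a b c d u v : R -> R) :
  solves T0 f1 f2 u v -> T0 < t ->
  linear_system a b c d u v (fun t => f1 t (u t) (v t) - (a t * u t + b t * v t))
    (fun t => f2 t (u t) (v t) - (- c t * u t + d t * v t)) t.
Proof.
  intros HS Ht. destruct (HS t Ht) as [Du Dv]. split.
  - replace (a t * u t + b t * v t + _) with (f1 t (u t) (v t)) by ring. exact Du.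
  - replace (- c t * u t + d t * v t + _) with (f2 t (u t) (v t)) by ring. exact Dv.
Qed.

Lemma nonvanishing_keeps_sign (f : R -> R) (a b : R) :
  a <= b -> (forall t, a <= t <= b -> continuous f t) -> (forall t, a <= t <= b -> f t <> 0) ->
  0 < f a -> 0 < f b.
Proof.
  intros Hab Hc Hn Ha. apply Rnot_le_lt. intros Hb.
  destruct (Req_dec (f b) 0) as [E|E]; [apply (Hn b); [lra|exact E]|].
  assert (Hlt : a < b) by (destruct Hab as [|E2]; [assumption|subst; lra]).
  destruct (Ranalysis5.IVT_interv (fun t => - f t) a b) as [z [Hz Hz0]]; try lra.
  - intros t Ht. apply continuity_pt_filterlim. apply (continuous_opp f). apply Hc, Ht.
  - apply (Hn z Hz). lra.
Qed.

(** Solutions starting on the line v = s(T) u have no stable part at T. If they start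
    far out on either side, s u v stays positive and v + s u keeps its sign; so some
    solution in between has v + s u = 0 at the end of the interval. There s u v <= 0,
    hence s u v is below the barrier on the whole interval. *)
Lemma saddle_finite_horizon (q n : nat) (kap : R) (a b c d : R -> R) :
  (1 <= n <= q)%nat -> 0 < kap -> near_saddle q n kap a b c d ->
  finite_horizon_solvable q a b c d.
Proof.
  intros Hn Hk HA. exists 0%nat. intros m _.
  destruct (saddle_barriers q n m kap a b c d Hn Hk HA) as (T1 & HT1 & HB).
  destruct (energy_bound_eventually q n m kap 3 1 Hn Hk ltac:(lra) ltac:(lra)) as [T2 HE].
  exists (Rmax T1 T2). intros T0 T f1 f2 HT HT0 F1 F2 Hf j.
  pose proof (Rmax_l T1 T2). pose proof (Rmax_r T1 T2).
  set (s := rate q n kap) in *. set (psi := tpow q (m + n)) in *.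
  set (e := T + INR j). assert (He : T <= e) by (unfold e; pose proof (pos_INR j); lra).
  assert (HL : forall u v, solves T0 f1 f2 u v -> forall t, T <= t ->
     linear_system a b c d u v (fun t => f1 t (u t) (v t) - (a t * u t + b t * v t))
       (fun t => f2 t (u t) (v t) - (- c t * u t + d t * v t)) t /\
     bounded_pair 1 (tpow q (m + loss q)) (fun t => f1 t (u t) (v t) - (a t * u t + b t * v t))
       (fun t => f2 t (u t) (v t) - (- c t * u t + d t * v t)) t).
  { intros u v HS t Ht. split.
    - apply (solves_linear_system T0); [exact HS|lra].
    - unfold bounded_pair. rewrite Rmult_1_l. apply Hf, Ht. }
  assert (Hgrow : forall u v, solves T0 f1 f2 u v -> forall t0 t1, T <= t0 <= t1 ->
     0 < s t0 * u t0 * v t0 - psi t0 ^ 2 ->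
     s t0 * u t0 * v t0 - psi t0 ^ 2 <= s t1 * u t1 * v t1 - psi t1 ^ 2).
  { intros u v HS t0 t1 Ht. apply (HB u v _ _ t0 t1 ltac:(lra) (fun t h => HL u v HS t ltac:(lra))). }
  assert (Hstable : forall u v, solves T0 f1 f2 u v -> forall t1, T <= t1 ->
     (forall t, T <= t <= t1 -> s t * u t * v t - psi t ^ 2 <= 0) ->
     (v T - s T * u T) ^ 2 <= psi T ^ 2 -> (v t1 - s t1 * u t1) ^ 2 <= psi t1 ^ 2).
  { intros u v HS t1 Ht HD Hi.
    assert (Hx := proj2 (HB u v _ _ T t1 ltac:(lra) (fun t h => HL u v HS t ltac:(lra))) 1 ltac:(lra) HD).
    cbv beta in Hx. rewrite !Rmult_1_l in Hx. apply Hx, Hi. }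
  assert (Hsol : forall x, exists w : (R -> R) * (R -> R),
     solves T0 f1 f2 (fst w) (snd w) /\ fst w T = x /\ snd w T = s T * x).
  { intros x. destruct (picard_lindelof T0 T x (s T * x) f1 f2 F1 F2 HT0) as (u & v & Hu & Hv & HS).
    exists (u, v). auto. }
  set (w := fun x => proj1_sig (constructive_indefinite_description _ (Hsol x))).
  assert (Hw : forall x, solves T0 f1 f2 (fst (w x)) (snd (w x)) /\ fst (w x) T = x /\ snd (w x) T = s T * x).
  { intros x. unfold w. apply proj2_sig. }
  set (Z := fun x => snd (w x) e + s e * fst (w x) e).
  pose proof (rate_pos q n kap T Hk) as HsT. pose proof (rate_pos q n kap e Hk) as Hse.
  fold s in HsT, Hse.
  assert (HZc : continuity Z).
  { destruct (solutions_close T0 T e f1 f2 F1 F2 HT0) as (C & HC & Hclose).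
    set (K := C * (1 + s T ^ 2)). assert (HK : 0 < K) by (apply Rmult_lt_0_compat; [exact HC|]; pose proof (pow2_ge_0 (s T)); lra).
    assert (HLip : forall x y, Rabs (Z x - Z y) <= (1 + s e) * (1 + K) * Rabs (x - y)).
    { intros x y. destruct (Hw x) as (Sx & Ux & Vx). destruct (Hw y) as (Sy & Uy & Vy).
      assert (Hc := Hclose _ _ _ _ Sx Sy e ltac:(lra)). rewrite Ux, Uy, Vx, Vy in Hc.
      replace (C * ((x - y) ^ 2 + (s T * x - s T * y) ^ 2)) with (K * (x - y) ^ 2) in Hc by (unfold K; ring).
      assert (HR : K * (x - y) ^ 2 <= ((1 + K) * Rabs (x - y)) ^ 2).
      { rewrite Rpow_mult_distr, pow2_abs. apply Rmult_le_compat_r; [apply pow2_ge_0|nra]. }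
      assert (HKx : 0 <= (1 + K) * Rabs (x - y)) by (apply Rmult_le_pos; [lra|apply Rabs_pos]).
      assert (A1 : Rabs (fst (w x) e - fst (w y) e) <= (1 + K) * Rabs (x - y)).
      { apply abs_le_of_sqr; [exact HKx|]. pose proof (pow2_ge_0 (snd (w x) e - snd (w y) e)). lra. }
      assert (A2 : Rabs (snd (w x) e - snd (w y) e) <= (1 + K) * Rabs (x - y)).
      { apply abs_le_of_sqr; [exact HKx|]. pose proof (pow2_ge_0 (fst (w x) e - fst (w y) e)). lra. }
      replace (Z x - Z y) with ((snd (w x) e - snd (w y) e) + s e * (fst (w x) e - fst (w y) e)) by (unfold Z; ring).
      eapply Rle_trans; [apply Rabs_triang|]. rewrite Rabs_mult, (Rabs_pos_eq (s e)) by lra. nra. }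
    intros x. apply continuity_pt_filterlim. apply continuous_eps. intros eps Heps.
    set (M := (1 + s e) * (1 + K)) in *. assert (HM : 0 < M) by (apply Rmult_lt_0_compat; lra).
    exists (eps / M). split; [apply Rdiv_lt_0_compat; assumption|].
    intros y Hy. eapply Rle_lt_trans; [apply HLip|].
    apply Rmult_lt_compat_l with (r := M) in Hy; [|exact HM].
    replace (M * (eps / M)) with eps in Hy by (field; lra). exact Hy. }
  set (X := 2 * psi T / s T).
  assert (HpsiT : 0 < psi T) by apply tpow_pos.
  assert (HX : 0 < X) by (apply Rdiv_lt_0_compat; lra).
  assert (HsX : s T * X = 2 * psi T) by (unfold X; field; lra).
  assert (Hnz : forall x, x = X \/ x = - X -> forall t, T <= t <= e -> 0 < fst (w x) t * snd (w x) t).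
  { intros x Hx t Ht. destruct (Hw x) as (Sx & Ux & Vx).
    assert (HD0 : 0 < s T * fst (w x) T * snd (w x) T - psi T ^ 2).
    { rewrite Ux, Vx. replace (s T * x * (s T * x)) with ((s T * X) ^ 2) by (destruct Hx as [-> | ->]; ring).
      rewrite HsX. nra. }
    assert (HDt := Hgrow _ _ Sx T t ltac:(lra) HD0).
    pose proof (pow2_ge_0 (psi t)). pose proof (rate_pos q n kap t Hk) as Hst. fold s in Hst.
    apply Rmult_lt_reg_l with (s t); [exact Hst|]. rewrite Rmult_0_r. lra. }
  assert (Hcu : forall x t, T <= t -> continuous (fst (w x)) t).
  { intros x t Ht. destruct (Hw x) as (Sx & _). apply (is_derive_continuous _ _ _ (proj1 (Sx t ltac:(lra)))). }
  assert (HZp : 0 < Z X).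
  { assert (Hue : 0 < fst (w X) e).
    { apply (nonvanishing_keeps_sign (fst (w X)) T e He).
      - intros t Ht. apply Hcu. lra.
      - intros t Ht E. pose proof (Hnz X (or_introl eq_refl) t Ht) as Hp. rewrite E in Hp. lra.
      - destruct (Hw X) as (_ & -> & _). exact HX. }
    pose proof (Hnz X (or_introl eq_refl) e ltac:(lra)). unfold Z.
    assert (0 < snd (w X) e) by nra. nra. }
  assert (HZm : Z (- X) < 0).
  { assert (Hue : 0 < - fst (w (- X)) e).
    { apply (nonvanishing_keeps_sign (fun t => - fst (w (- X)) t) T e He).
      - intros t Ht. apply (continuous_opp (fst (w (- X)))). apply Hcu. lra.
      - intros t Ht E. pose proof (Hnz (- X) (or_intror eq_refl) t Ht) as Hp.
        assert (E' : fst (w (- X)) t = 0) by lra. rewrite E' in Hp. lra.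
      - destruct (Hw (- X)) as (_ & -> & _). lra. }
    pose proof (Hnz (- X) (or_intror eq_refl) e ltac:(lra)). unfold Z.
    assert (snd (w (- X)) e < 0) by nra. nra. }
  destruct (IVT_gen Z (- X) X 0 HZc) as [x [_ Hx]].
  { rewrite Rmin_left, Rmax_right by lra. lra. }
  destruct (Hw x) as (Sx & Ux & Vx).
  exists (fst (w x)), (snd (w x)). split; [exact Sx|].
  assert (HDle : forall t, T <= t <= e -> s t * fst (w x) t * snd (w x) t - psi t ^ 2 <= 0).
  { intros t Ht. apply Rnot_lt_le. intros Hlt.
    assert (Hg := Hgrow _ _ Sx t e ltac:(lra) Hlt).
    assert (Ev : snd (w x) e = - s e * fst (w x) e) by (unfold Z in Hx; lra).
    rewrite Ev in Hg. pose proof (pow2_ge_0 (s e * fst (w x) e)). pose proof (pow2_ge_0 (psi e)). nra. }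
  intros t Ht.
  assert (Hst := Hstable _ _ Sx t ltac:(lra) (fun r h => HDle r (conj (proj1 h) (Rle_trans _ _ _ (proj2 h) (proj2 Ht))))).
  rewrite Ux, Vx in Hst. specialize (Hst ltac:(pose proof (pow2_ge_0 (psi T)); nra)).
  specialize (HDle t Ht).
  rewrite <- (Rmult_1_l (tpow q m t)).
  apply HE; [lra|]. fold psi.
  rewrite <- (rate_sqr q n kap t) by (lia || lra). fold s. nra.
Qed.

(** Once above its barrier, s u v would stay bounded away from 0. *)
Lemma saddle_decay (q n : nat) (kap : R) (a b c d : R -> R) :
  (1 <= n <= q)%nat -> 0 < kap -> near_saddle q n kap a b c d -> decay_improving q a b c d.
Proof.
  intros Hn Hk HA. exists 1%nat. intros m u v h1 h2 C Hm HL HU HH.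
  destruct (saddle_barriers q n m kap a b c d Hn Hk HA) as (T1 & HT1 & HB).
  set (s := rate q n kap) in *. set (psi := tpow q (m + n)) in *.
  destruct (at_infinity_all _ (at_infinity_and _ _ HL (at_infinity_and _ _ HU
    (at_infinity_and _ _ HH (at_infinity_and _ _ (rate_small q n kap 1 Hn Hk ltac:(lra)) (at_infinity_ge T1))))))
    as (T & HT & Hev).
  assert (HTT : T1 <= T) by (apply (Hev T); lra).
  assert (HLb : forall t, T <= t -> linear_system a b c d u v h1 h2 t /\
                               bounded_pair 1 (tpow q (m + loss q)) h1 h2 t).
  { intros t Ht. split; apply (Hev t Ht). }
  assert (HD : forall t, T <= t -> s t * u t * v t - psi t ^ 2 <= 0).
  { intros t Ht. apply Rnot_lt_le. intros Hlt.
    set (del := s t * u t * v t - psi t ^ 2) in *.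
    assert (Hlow : forall r, t <= r -> del <= C ^ 2 * tpow q 1 r).
    { intros r Hr.
      assert (Hg := proj1 (HB u v h1 h2 t r ltac:(lra) (fun x h => HLb x ltac:(lra))) Hlt).
      cbv beta in Hg. fold del in Hg.
      destruct (Hev r ltac:(lra)) as (_ & [U V] & _ & Hs1 & _).
      pose proof (rate_pos q n kap r Hk) as Hs0. fold s in Hs0, Hs1.
      pose proof (pow2_ge_0 (psi r)). pose proof (tpow_pos q 1 r) as Hp.
      pose proof (tpow_le_1 q 1 r ltac:(lia) ltac:(lra)).
      assert (Huv : u r * v r <= (C * tpow q 1 r) * (C * tpow q 1 r)).
      { eapply Rle_trans; [apply Rle_abs|]. apply abs_mul_le; assumption. }
      assert (Hd : del <= s r * (u r * v r)) by lra.
      assert (Hd2 : s r * (u r * v r) <= (C * tpow q 1 r) * (C * tpow q 1 r)).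
      { assert (0 <= (C * tpow q 1 r) * (C * tpow q 1 r)) by apply Rle_0_sqr. nra. }
      pose proof (pow2_ge_0 C). nra. }
    destruct (tpow_small q 1 (del / (2 * (C ^ 2 + 1))) ltac:(lia) ltac:(lia)) as [T2 HT2].
    { apply Rdiv_lt_0_compat; [exact Hlt|]. pose proof (pow2_ge_0 C). lra. }
    pose proof (Rmax_l T2 t). pose proof (Rmax_r T2 t).
    specialize (Hlow (Rmax T2 t) ltac:(lra)). specialize (HT2 (Rmax T2 t) ltac:(lra)).
    pose proof (pow2_ge_0 C). pose proof (tpow_pos q 1 (Rmax T2 t)).
    apply Rmult_le_compat_l with (r := 2 * (C ^ 2 + 1)) in HT2; [|lra].
    replace (2 * (C ^ 2 + 1) * (del / (2 * (C ^ 2 + 1)))) with del in HT2 by (field; lra). nra. }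
  set (S0 := (v T - s T * u T) ^ 2).
  assert (Hp0 : 0 < psi T ^ 2) by (apply pow_lt, tpow_pos).
  set (B := 1 + S0 / psi T ^ 2).
  assert (HS0 : 0 <= S0 / psi T ^ 2) by (apply Rdiv_le_0_compat; [apply pow2_ge_0|exact Hp0]).
  exists 1.
  destruct (energy_bound_eventually q n m kap (B + 2) 1 Hn Hk ltac:(lra) ltac:(unfold B; lra)) as [T2 HE].
  exists (Rmax T T2). intros t Ht. pose proof (Rmax_l T T2). pose proof (Rmax_r T T2).
  apply HE; [lra|]. fold psi.
  rewrite <- (rate_sqr q n kap t) by (lia || lra). fold s.
  assert (HSt : (v t - s t * u t) ^ 2 <= B * psi t ^ 2).
  { apply (proj2 (HB u v h1 h2 T t ltac:(lra) (fun x h => HLb x ltac:(lra)))).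
    - unfold B. lra.
    - intros x Hx. apply HD. lra.
    - fold S0. unfold B. rewrite Rmult_plus_distr_r. replace (S0 / psi T ^ 2 * psi T ^ 2) with S0 by (unfold Rdiv; rewrite Rmult_assoc, Rinv_l by lra; ring). lra. }
  specialize (HD t ltac:(lra)). nra.
Qed.

(** * The rotating case *)

(** The quadratic form c u^2 + (a - d) u v + b v^2 is invariant under the
    trace-free part of the system, whose time derivative therefore sees only the
    trace, the slow change of the coefficients and the forcing. *)
Lemma form_derivative_estimate (a b c d a' b' c' d' s u v h1 h2 tau psi C : R) :
  0 < s <= 1 -> Rabs a <= s / 8 -> Rabs d <= s / 8 -> Rabs (b - 1) <= 1 / 8 ->
  Rabs (c - s ^ 2) <= s ^ 2 / 8 -> 0 < tau -> 0 <= C ->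
  Rabs a' <= C * s * tau -> Rabs d' <= C * s * tau -> Rabs b' <= C * tau -> Rabs c' <= C * s ^ 2 * tau ->
  0 < psi -> Rabs h1 <= tau * psi / 6 -> Rabs h2 <= tau * psi / 6 ->
  let Q := c * u ^ 2 + (a - d) * u * v + b * v ^ 2 in
  let R := s ^ 2 * u ^ 2 + v ^ 2 in
  let Q' := c' * u ^ 2 + (a' - d') * u * v + b' * v ^ 2
    + (2 * c * u + (a - d) * v) * (a * u + b * v + h1)
    + ((a - d) * u + 2 * b * v) * (- c * u + d * v + h2) in
  R / 2 <= Q <= 2 * R /\
  Rabs (Q' - (a + d) * Q) <= (4 * C + 1) * tau * Q + tau * psi ^ 2.
Proof.
  intros Hs Ha Hd Hb Hc Ht HC Ha' Hd' Hb' Hc' Hp H1 H2 Q R Q'.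
  set (x := s * Rabs u). set (y := Rabs v).
  assert (Hx : 0 <= x) by (apply Rmult_le_pos; [lra|apply Rabs_pos]).
  assert (Hy : 0 <= y) by apply Rabs_pos.
  assert (ER : R = x ^ 2 + y ^ 2) by (unfold R, x, y; rewrite Rpow_mult_distr, !pow2_abs; ring).
  assert (Hxy : x * y <= R / 2) by (rewrite ER; pose proof (pow2_ge_0 (x - y)); nra).
  assert (Hsu : Rabs u * s = x) by (unfold x; ring).
  pose proof (Rabs_pos u) as Pu.
  assert (T1 : Rabs ((c - s ^ 2) * u ^ 2) <= x ^ 2 / 8).
  { rewrite Rabs_mult, <- RPow_abs, <- Hsu. replace ((Rabs u * s) ^ 2 / 8) with (s ^ 2 / 8 * Rabs u ^ 2) by field.
    apply Rmult_le_compat_r; [apply pow2_ge_0|exact Hc]. }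
  assert (T2 : Rabs ((a - d) * u * v) <= x * y / 4).
  { rewrite !Rabs_mult, <- Hsu. fold y. replace (Rabs u * s * y / 4) with (s / 4 * Rabs u * y) by field.
    apply Rmult_le_compat_r; [exact Hy|]. apply Rmult_le_compat_r; [exact Pu|].
    eapply Rle_trans; [apply Rabs_triang|]. rewrite Rabs_Ropp. lra. }
  assert (T3 : Rabs ((b - 1) * v ^ 2) <= y ^ 2 / 8).
  { rewrite Rabs_mult, <- RPow_abs. fold y. pose proof (pow2_ge_0 y). nra. }
  assert (EQ : Q = R + (c - s ^ 2) * u ^ 2 + (a - d) * u * v + (b - 1) * v ^ 2) by (unfold Q, R; ring).
  assert (HQ : R / 2 <= Q <= 2 * R).
  { apply Rabs_le_between in T1, T2, T3. pose proof (pow2_ge_0 x). pose proof (pow2_ge_0 y). lra. }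
  split; [exact HQ|].
  set (E1 := c' * u ^ 2 + (a' - d') * u * v + b' * v ^ 2).
  set (E2 := (2 * c * u + (a - d) * v) * h1 + ((a - d) * u + 2 * b * v) * h2).
  replace (Q' - (a + d) * Q) with (E1 + E2) by (unfold Q', Q, E1, E2; ring).
  assert (B1 : Rabs E1 <= 2 * C * tau * R).
  { assert (S1 : Rabs (c' * u ^ 2) <= C * tau * x ^ 2).
    { rewrite Rabs_mult, <- RPow_abs, <- Hsu. replace (C * tau * (Rabs u * s) ^ 2) with (C * s ^ 2 * tau * Rabs u ^ 2) by ring.
      apply Rmult_le_compat_r; [apply pow2_ge_0|exact Hc']. }
    assert (S2 : Rabs ((a' - d') * u * v) <= C * tau * (2 * (x * y))).
    { rewrite !Rabs_mult, <- Hsu. fold y.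
      replace (C * tau * (2 * (Rabs u * s * y))) with (2 * (C * s * tau) * Rabs u * y) by ring.
      apply Rmult_le_compat_r; [exact Hy|]. apply Rmult_le_compat_r; [exact Pu|].
      eapply Rle_trans; [apply Rabs_triang|]. rewrite Rabs_Ropp. lra. }
    assert (S3 : Rabs (b' * v ^ 2) <= C * tau * y ^ 2).
    { rewrite Rabs_mult, <- RPow_abs. fold y. apply Rmult_le_compat_r; [apply pow2_ge_0|exact Hb']. }
    assert (S4 : C * tau * (2 * (x * y)) <= C * tau * R) by (apply Rmult_le_compat_l; [apply Rmult_le_pos; lra|lra]).
    unfold E1. apply Rabs_le_between in S1, S2, S3. apply Rabs_le_between.
    assert (C * tau * R = C * tau * x ^ 2 + C * tau * y ^ 2) by (rewrite ER; ring). lra. }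
  assert (B2 : Rabs E2 <= tau * psi * (x + y)).
  { set (k := tau * psi / 6) in *. assert (Hk : 0 <= k) by (pose proof (Rabs_pos h1); lra).
    assert (S1 : Rabs (2 * c * u + (a - d) * v) <= 3 * (x + y)).
    { assert (U1 : Rabs (c * u) <= 9 / 8 * x).
      { rewrite Rabs_mult, <- Hsu. apply Rabs_le_between in Hc.
        assert (Rabs c <= 9 / 8 * s) by (apply Rabs_le_between; nra).
        replace (9 / 8 * (Rabs u * s)) with (9 / 8 * s * Rabs u) by ring. apply Rmult_le_compat_r; lra. }
      assert (U2 : Rabs ((a - d) * v) <= y / 4).
      { rewrite Rabs_mult. fold y. assert (Rabs (a - d) <= s / 4) by (eapply Rle_trans; [apply Rabs_triang|]; rewrite Rabs_Ropp; lra). nra. }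
      apply Rabs_le_between in U1, U2. apply Rabs_le_between. lra. }
    assert (S2 : Rabs ((a - d) * u + 2 * b * v) <= 3 * (x + y)).
    { assert (U1 : Rabs ((a - d) * u) <= x / 4).
      { rewrite Rabs_mult, <- Hsu. assert (Rabs (a - d) <= s / 4) by (eapply Rle_trans; [apply Rabs_triang|]; rewrite Rabs_Ropp; lra). nra. }
      assert (U2 : Rabs (b * v) <= 9 / 8 * y).
      { rewrite Rabs_mult. fold y. apply Rabs_le_between in Hb. apply Rmult_le_compat_r; [exact Hy|]. apply Rabs_le_between. lra. }
      apply Rabs_le_between in U1, U2. apply Rabs_le_between. lra. }
    unfold E2. eapply Rle_trans; [apply Rabs_triang|].
    assert (A1 := abs_mul_le _ _ _ _ S1 H1). assert (A2 := abs_mul_le _ _ _ _ S2 H2).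
    replace (tau * psi) with (6 * k) by (unfold k; field). lra. }
  eapply Rle_trans; [apply Rabs_triang|].
  assert (B3 : tau * psi * (x + y) <= tau * (R / 2 + psi ^ 2)).
  { rewrite Rmult_assoc. apply Rmult_le_compat_l; [lra|]. pose proof (pow2_ge_0 (psi - (x + y) / 2)).
    assert ((x + y) ^ 2 <= 2 * R) by (rewrite ER; pose proof (pow2_ge_0 (x - y)); nra). nra. }
  assert (B4 : 2 * C * tau * R <= 2 * C * tau * (2 * Q)) by (apply Rmult_le_compat_l; [repeat apply Rmult_le_pos; lra|lra]).
  assert (B5 : tau * (R / 2) <= tau * Q) by (apply Rmult_le_compat_l; lra).
  lra.
Qed.

(** Closeness to the model rotation u' = v, v' = - s^2 u. The second field holds for
    coefficients that are smooth functions of t^(-1/q): a time derivative costs a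
    factor 1/t. *)
Record near_center (q n : nat) (kap : R) (a b c d : R -> R) : Prop := {
  near_center_size : forall eta, 0 < eta -> at_infinity (fun t =>
    let s := rate q n kap t in
    Rabs (a t) <= eta * s /\ Rabs (d t) <= eta * s /\ Rabs (b t - 1) <= eta /\
    Rabs (c t - s ^ 2) <= eta * s ^ 2);
  near_center_slow : exists C a' b' c' d', 0 <= C /\ at_infinity (fun t =>
    let s := rate q n kap t in
    (is_derive a t (a' t) /\ is_derive b t (b' t) /\ is_derive c t (c' t) /\ is_derive d t (d' t)) /\
    Rabs (a' t) <= C * s * / t /\ Rabs (d' t) <= C * s * / t /\ Rabs (b' t) <= C * / t /\
    Rabs (c' t) <= C * s ^ 2 * / t) }.

Definition energy_form (a b c d u v : R -> R) (t : R) : R :=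
  c t * u t ^ 2 + (a t - d t) * u t * v t + b t * v t ^ 2.

Lemma energy_form_estimates (q n : nat) (kap : R) (a b c d : R -> R) :
  (1 <= n <= q)%nat -> 0 < kap -> near_center q n kap a b c d ->
  exists C1, 0 <= C1 /\ forall m, exists T1, 1 <= T1 /\ forall t, T1 <= t ->
    forall u v h1 h2, linear_system a b c d u v h1 h2 t ->
    bounded_pair 1 (tpow q (m + loss q)) h1 h2 t ->
    let R := kap * tpow q n t * u t ^ 2 + v t ^ 2 in
    let Q := energy_form a b c d u v t in
    R / 2 <= Q <= 2 * R /\
    exists Q', is_derive (energy_form a b c d u v) t Q' /\
      Rabs (Q' - (a t + d t) * Q) <= C1 * / t * Q + / t * tpow q (m + n) t ^ 2.
Proof.
  intros Hn Hk [HA (C & a' & b' & c' & d' & HC & HD)].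
  exists (4 * C + 1). split; [lra|]. intros m.
  destruct (at_infinity_all _ (at_infinity_and _ _ (HA (1 / 8) ltac:(lra))
    (at_infinity_and _ _ HD (at_infinity_and _ _ (rate_small q n kap 1 Hn Hk ltac:(lra))
      (tpow_small q 1 (1 / 6) ltac:(lia) ltac:(lia) ltac:(lra)))))) as (T1 & HT1 & HT).
  exists T1. split; [exact HT1|].
  intros t Ht u v h1 h2 [Du Dv] [H1 H2] R Q.
  destruct (HT t Ht) as ((Ha & Hd & Hb & Hc) & ((Da & Db & Dc & Dd) & Ha' & Hd' & Hb' & Hc') & Hs1 & Hsm).
  pose proof (rate_pos q n kap t Hk) as Hs0.
  assert (Hti : 0 < / t) by (apply Rinv_0_lt_compat; lra).
  assert (HF : tpow q (m + loss q) t <= / t * tpow q (m + n) t / 6).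
  { replace (m + loss q)%nat with (m + n + (q + (1 + (q - n))))%nat by (unfold loss; lia).
    rewrite !(tpow_add q (m + n)), (tpow_add q q), (tpow_add q 1), (tpow_base q t) by (lia || lra).
    pose proof (tpow_le_1 q (q - n) t ltac:(lia) ltac:(lra)). pose proof (tpow_pos q (q - n) t).
    pose proof (tpow_pos q 1 t). pose proof (tpow_pos q (m + n) t).
    assert (tpow q 1 t * tpow q (q - n) t <= 1 / 6) by nra.
    replace (/ t * tpow q (m + n) t / 6) with (tpow q (m + n) t * (/ t * (1 / 6))) by (field; lra).
    apply Rmult_le_compat_l; [lra|]. apply Rmult_le_compat_l; lra. }
  rewrite Rmult_1_l in H1, H2.
  assert (E := form_derivative_estimate (a t) (b t) (c t) (d t) (a' t) (b' t) (c' t) (d' t) (rate q n kap t)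
    (u t) (v t) (h1 t) (h2 t) (/ t) (tpow q (m + n) t) C ltac:(lra) ltac:(lra) ltac:(lra) ltac:(lra)
    ltac:(lra) Hti HC Ha' Hd' Hb' Hc' (tpow_pos _ _ _) ltac:(lra) ltac:(lra)).
  cbv zeta in E. destruct E as [E1 E2].
  unfold R. rewrite <- (rate_sqr q n kap t) by (lia || lra).
  split; [exact E1|].
  eexists. split; [|exact E2].
  unfold energy_form. evar_last.
  - apply (is_derive_plus (fun t => c t * u t ^ 2 + (a t - d t) * u t * v t) (fun t => b t * v t ^ 2)).
    + apply (is_derive_plus (fun t => c t * u t ^ 2) (fun t => (a t - d t) * u t * v t)).
      * apply (is_derive_mult c (fun t => u t ^ 2)); [exact Dc| |exact Rmult_comm].
        apply (is_derive_pow u 2). exact Du.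
      * apply (is_derive_mult (fun t => (a t - d t) * u t) v); [|exact Dv|exact Rmult_comm].
        apply (is_derive_mult (fun t => a t - d t) u); [|exact Du|exact Rmult_comm].
        apply (is_derive_minus a d); [exact Da|exact Dd].
    + apply (is_derive_mult b (fun t => v t ^ 2)); [exact Db| |exact Rmult_comm].
      apply (is_derive_pow v 2). exact Dv.
  - unfold plus, mult, minus, opp, plus; simpl. unfold mult; simpl. ring.
Qed.

(** Nearly area-expanding case: t^p (Q - tube) is nondecreasing, so Q is
    controlled from later times; solutions are started at the far end. *)
Lemma expanding_barrier (q n : nat) (kap C0 : R) (a b c d : R -> R) :
  (1 <= n <= q)%nat -> 0 < kap -> near_center q n kap a b c d ->
  at_infinity (fun t => - C0 * / t <= a t + d t) ->
  exists p : nat, forall m, (q * (p + 1) <= m)%nat -> exists T1, 1 <= T1 /\ forall t0 t1, T1 <= t0 <= t1 ->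
    forall u v h1 h2, (forall t, t0 <= t <= t1 -> linear_system a b c d u v h1 h2 t /\
      bounded_pair 1 (tpow q (m + loss q)) h1 h2 t) ->
    t0 ^ p * (energy_form a b c d u v t0 - tpow q (m + n) t0 ^ 2) <=
    t1 ^ p * (energy_form a b c d u v t1 - tpow q (m + n) t1 ^ 2).
Proof.
  intros Hn Hk HA Htr.
  destruct (energy_form_estimates q n kap a b c d Hn Hk HA) as (C1 & HC1 & HE).
  destruct (INR_unbounded (C0 + C1)) as [p Hp].
  exists p. intros m Hm.
  destruct (HE m) as (T1 & HT1 & HE1).
  destruct Htr as [T2 HT2].
  exists (Rmax T1 T2). pose proof (Rmax_l T1 T2). pose proof (Rmax_r T1 T2).
  split; [lra|]. intros t0 t1 Ht u v h1 h2 HS.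
  set (Q := energy_form a b c d u v). set (psi := tpow q (m + n)).
  apply (nondecreasing_of_derive (fun t => t ^ p * (Q t - psi t ^ 2))
    (fun t => INR p * t ^ p * / t * (Q t - psi t ^ 2)
       + t ^ p * (Derive Q t - (- (2 * (INR (m + n) / INR q)) * / t * psi t ^ 2)))); [lra|].
  intros t Ht'. destruct (HS t Ht') as [HL HB].
  destruct (HE1 t ltac:(lra) u v h1 h2 HL HB) as (HQ & Q' & HQ' & HQb).
  assert (Hti : 0 < / t) by (apply Rinv_0_lt_compat; lra).
  assert (Htp : 0 < t ^ p) by (apply pow_lt; lra).
  fold Q in HQ', HQ, HQb. fold psi in HQb.
  assert (ED : Derive Q t = Q') by (apply is_derive_unique; exact HQ').
  split.
  - rewrite ED. evar_last.
    + apply (is_derive_mult (fun t => t ^ p) (fun t => Q t - psi t ^ 2)); [| |exact Rmult_comm].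
      * apply (is_derive_pow (fun t => t) p). apply is_derive_id.
      * apply (is_derive_minus Q (fun t => psi t ^ 2)); [exact HQ'|]. apply is_derive_tube. lra.
    + assert (Hpow : INR p * t ^ pred p = INR p * t ^ p * / t).
      { destruct p as [|p']; [simpl; ring|]. simpl pred. simpl pow. field. lra. }
      unfold plus, mult, minus, opp, plus, one; simpl. unfold mult; simpl. rewrite Rmult_1_r.
      fold (INR p). rewrite Hpow. fold psi. ring.
  - rewrite ED.
    set (e := 2 * (INR (m + n) / INR q)).
    assert (He : INR p + 1 <= e).
    { assert (Hq0 : 0 < INR q) by (apply lt_0_INR; lia).
      apply Rmult_le_reg_r with (INR q); [exact Hq0|].
      unfold e. replace (2 * (INR (m + n) / INR q) * INR q) with (2 * INR (m + n)) by (field; lra).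
      apply le_INR in Hm. rewrite mult_INR, plus_INR in Hm. simpl (INR 1) in Hm.
      rewrite plus_INR. pose proof (pos_INR n). pose proof (pos_INR m). lra. }
    assert (HR : 0 <= kap * tpow q n t * u t ^ 2 + v t ^ 2).
    { pose proof (pow2_ge_0 (u t)). pose proof (pow2_ge_0 (v t)). pose proof (tpow_pos q n t).
      assert (0 <= kap * tpow q n t * u t ^ 2) by (apply Rmult_le_pos; [apply Rmult_le_pos; lra|lra]). lra. }
    assert (HQ0 : 0 <= Q t) by lra.
    specialize (HT2 t ltac:(lra)).
    apply Rabs_le_between in HQb.
    assert (L1 : - C0 * / t * Q t <= (a t + d t) * Q t) by (apply Rmult_le_compat_r; lra).
    replace (INR p * t ^ p * / t * (Q t - psi t ^ 2) + t ^ p * (Q' - - e * / t * psi t ^ 2))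
      with (t ^ p * (INR p * / t * (Q t - psi t ^ 2) + Q' + e * / t * psi t ^ 2)) by ring.
    apply Rmult_le_pos; [lra|].
    pose proof (pow2_ge_0 (psi t)).
    assert (L2 : 0 <= (INR p - C0 - C1) * / t * Q t) by (repeat apply Rmult_le_pos; lra).
    assert (L3 : 0 <= (e - INR p - 1) * / t * psi t ^ 2)
      by (apply Rmult_le_pos; [apply Rmult_le_pos; lra|lra]).
    lra.
Qed.

Lemma expanding_finite_horizon (q n : nat) (kap C0 : R) (a b c d : R -> R) :
  (1 <= n <= q)%nat -> 0 < kap -> near_center q n kap a b c d ->
  at_infinity (fun t => - C0 * / t <= a t + d t) -> finite_horizon_solvable q a b c d.
Proof.
  intros Hn Hk HA Htr.
  destruct (expanding_barrier q n kap C0 a b c d Hn Hk HA Htr) as (p & HB).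
  destruct (energy_form_estimates q n kap a b c d Hn Hk HA) as (C1 & _ & HE).
  exists (q * (p + 1))%nat. intros m Hm.
  destruct (HB m Hm) as (T1 & HT1 & HB1). destruct (HE m) as (T2 & HT2 & HE1).
  destruct (energy_bound_eventually q n m kap 2 1 Hn Hk ltac:(lra) ltac:(lra)) as [T3 HEn].
  exists (Rmax T1 (Rmax T2 T3)). intros T0 T f1 f2 HT HT0 F1 F2 Hf j.
  pose proof (Rmax_l T1 (Rmax T2 T3)). pose proof (Rmax_r T1 (Rmax T2 T3)).
  pose proof (Rmax_l T2 T3). pose proof (Rmax_r T2 T3).
  set (e := T + INR j). assert (He : T <= e) by (unfold e; pose proof (pos_INR j); lra).
  destruct (picard_lindelof T0 e 0 0 f1 f2 F1 F2 ltac:(lra)) as (u & v & Hu & Hv & HS).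
  exists u, v. split; [exact HS|].
  intros t [Ht1 Ht2].
  assert (HL : forall t, T <= t ->
     linear_system a b c d u v (fun t => f1 t (u t) (v t) - (a t * u t + b t * v t))
       (fun t => f2 t (u t) (v t) - (- c t * u t + d t * v t)) t /\
     bounded_pair 1 (tpow q (m + loss q)) (fun t => f1 t (u t) (v t) - (a t * u t + b t * v t))
       (fun t => f2 t (u t) (v t) - (- c t * u t + d t * v t)) t).
  { intros r Hr. split.
    - apply (solves_linear_system T0); [exact HS|lra].
    - unfold bounded_pair. rewrite Rmult_1_l. apply Hf, Hr. }
  assert (Hm' := HB1 t e (conj (Rle_trans _ _ _ (Rle_trans _ _ _ (Rmax_l _ _) HT) Ht1) Ht2) u v _ _
     (fun r h => HL r (Rle_trans _ _ _ Ht1 (proj1 h)))).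
  assert (Qe : energy_form a b c d u v e = 0) by (unfold energy_form; rewrite Hu, Hv; ring).
  rewrite Qe in Hm'.
  destruct (HL t Ht1) as [L1 L2].
  destruct (HE1 t ltac:(lra) u v _ _ L1 L2) as (HQ & _).
  rewrite <- (Rmult_1_l (tpow q m t)).
  apply HEn; [lra|].
  assert (P1 : 0 < t ^ p) by (apply pow_lt; lra). assert (P2 : 0 < e ^ p) by (apply pow_lt; lra).
  pose proof (pow2_ge_0 (tpow q (m + n) e)).
  assert (energy_form a b c d u v t - tpow q (m + n) t ^ 2 <= 0); [|lra].
  apply Rmult_le_reg_l with (t ^ p); [exact P1|]. rewrite Rmult_0_r. nra.
Qed.

(** The monotone quantity tends to 0 for a solution that decays fast enough, so it is
    never positive. *)
Lemma expanding_decay (q n : nat) (kap C0 : R) (a b c d : R -> R) :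
  (1 <= n <= q)%nat -> 0 < kap -> near_center q n kap a b c d ->
  at_infinity (fun t => - C0 * / t <= a t + d t) -> decay_improving q a b c d.
Proof.
  intros Hn Hk HA Htr.
  destruct (expanding_barrier q n kap C0 a b c d Hn Hk HA Htr) as (p & HB).
  destruct (energy_form_estimates q n kap a b c d Hn Hk HA) as (C1 & _ & HE).
  exists (q * (p + 1))%nat. intros m u v h1 h2 C Hm HL HU HH.
  destruct (HB m Hm) as (T1 & HT1 & HB1). destruct (HE m) as (T2 & HT2 & HE1).
  destruct (energy_bound_eventually q n m kap 2 1 Hn Hk ltac:(lra) ltac:(lra)) as [T3 HEn].
  destruct (at_infinity_all _ (at_infinity_and _ _ HL (at_infinity_and _ _ HU (at_infinity_and _ _ HH
    (at_infinity_and _ _ (rate_small q n kap 1 Hn Hk ltac:(lra)) (at_infinity_ge (Rmax T1 (Rmax T2 T3)))))))) as (T & HT & Hev).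
  pose proof (Rmax_l T1 (Rmax T2 T3)). pose proof (Rmax_r T1 (Rmax T2 T3)).
  pose proof (Rmax_l T2 T3). pose proof (Rmax_r T2 T3).
  exists 1, T. intros t Ht.
  assert (HTm : forall r, T <= r -> Rmax T1 (Rmax T2 T3) <= r) by (intros r Hr; apply (Hev r Hr)).
  pose proof (HTm t Ht).
  destruct (Hev t Ht) as (L1 & _ & L2 & _).
  destruct (HE1 t ltac:(lra) u v h1 h2 L1 L2) as (HQ & _).
  apply HEn; [lra|].
  assert (energy_form a b c d u v t - tpow q (m + n) t ^ 2 <= 0); [|lra].
  assert (P1 : 0 < t ^ p) by (apply pow_lt; lra).
  apply Rmult_le_reg_l with (t ^ p); [exact P1|]. rewrite Rmult_0_r.
  apply Rnot_lt_le. intros Hlt.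
  set (del := t ^ p * (energy_form a b c d u v t - tpow q (m + n) t ^ 2)) in *.
  assert (Hlow : forall r, t <= r -> del <= 4 * C ^ 2 * / r).
  { intros r Hr. pose proof (HTm r ltac:(lra)).
    assert (Hm' := HB1 t r ltac:(lra) u v h1 h2 (fun x h => conj (proj1 (Hev x ltac:(lra)))
       (proj1 (proj2 (proj2 (Hev x ltac:(lra))))))).
    fold del in Hm'.
    destruct (Hev r ltac:(lra)) as (M1 & [U V] & M2 & Hs1 & _).
    destruct (HE1 r ltac:(lra) u v h1 h2 M1 M2) as (HQr & _).
    assert (Hpr : 0 < r ^ p) by (apply pow_lt; lra).
    pose proof (pow2_ge_0 (tpow q (m + n) r)).
    assert (Hsq : forall x, Rabs x <= C * tpow q (q * (p + 1)) r -> x ^ 2 <= C ^ 2 * (/ r ^ p * / r)).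
    { intros x Hx. rewrite <- (pow2_abs x).
      apply Rle_trans with ((C * tpow q (q * (p + 1)) r) ^ 2).
      - apply pow_incr. split; [apply Rabs_pos|exact Hx].
      - rewrite Rpow_mult_distr. apply Rmult_le_compat_l; [apply pow2_ge_0|].
        pose proof (tpow_pos q (q * (p + 1)) r). pose proof (tpow_le_1 q (q * (p + 1)) r ltac:(lia) ltac:(lra)).
        set (w := tpow q (q * (p + 1)) r) in *.
        assert (w * w <= w * 1) by (apply Rmult_le_compat_l; lra).
        replace (/ r ^ p * / r) with w; [lra|]. unfold w.
        rewrite tpow_pow, pow_mult, <- tpow_pow, tpow_base by (lia || lra).
        rewrite pow_add, pow_inv. simpl. ring. }
    assert (Hu2 := Hsq _ U). assert (Hv2 := Hsq _ V).
    rewrite <- (rate_sqr q n kap r) in HQr by (lia || lra).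
    pose proof (rate_pos q n kap r Hk) as Hs0.
    assert (Hsu : rate q n kap r ^ 2 * u r ^ 2 <= u r ^ 2).
    { rewrite <- (Rmult_1_l (u r ^ 2)) at 2. apply Rmult_le_compat_r; [apply pow2_ge_0|].
      rewrite <- (pow1 2). apply pow_incr. lra. }
    apply Rle_trans with (r ^ p * (4 * C ^ 2 * (/ r ^ p * / r))).
    - apply Rle_trans with (1 := Hm'). apply Rmult_le_compat_l; lra.
    - apply Req_le. field. split; [lra|apply Rgt_not_eq; exact Hpr]. }
  pose proof (pow2_ge_0 C) as HC2.
  set (r := Rmax t ((4 * C ^ 2 + 1) / del)).
  assert (Hr1 : t <= r) by apply Rmax_l. assert (Hr2 : (4 * C ^ 2 + 1) / del <= r) by apply Rmax_r.
  specialize (Hlow r Hr1).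
  apply Rmult_le_compat_r with (r := r) in Hlow; [|lra].
  replace (4 * C ^ 2 * / r * r) with (4 * C ^ 2) in Hlow by (field; lra).
  apply Rmult_le_compat_l with (r := del) in Hr2; [|lra].
  replace (del * ((4 * C ^ 2 + 1) / del)) with (4 * C ^ 2 + 1) in Hr2 by (field; lra). lra.
Qed.

(** Since a + d is eventually below - K/t for every K, the form decays faster than
    the tube, a power of t, shrinks; so the tube is not left forward in time. *)
Lemma contracting_barrier (q n m : nat) (kap : R) (a b c d : R -> R) :
  (1 <= n <= q)%nat -> 0 < kap -> near_center q n kap a b c d ->
  (forall K, at_infinity (fun t => a t + d t <= - K * / t)) ->
  exists T1, 1 <= T1 /\ forall t0 t1, T1 <= t0 <= t1 ->
    forall u v h1 h2, (forall t, t0 <= t <= t1 -> linear_system a b c d u v h1 h2 t /\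
      bounded_pair 1 (tpow q (m + loss q)) h1 h2 t) ->
    (forall B, 1 <= B -> energy_form a b c d u v t0 <= B * tpow q (m + n) t0 ^ 2 ->
       kap * tpow q n t1 * u t1 ^ 2 + v t1 ^ 2 <= 2 * B * tpow q (m + n) t1 ^ 2).
Proof.
  intros Hn Hk HA Htr.
  destruct (energy_form_estimates q n kap a b c d Hn Hk HA) as (C1 & HC1 & HE).
  destruct (HE m) as (T1 & HT1 & HE1).
  set (e := 2 * (INR (m + n) / INR q)).
  destruct (Htr (C1 + 1 + e)) as [T2 HT2].
  exists (Rmax T1 T2). pose proof (Rmax_l T1 T2). pose proof (Rmax_r T1 T2).
  split; [lra|]. intros t0 t1 Ht u v h1 h2 HS B HB H0'.
  set (Q := energy_form a b c d u v) in *. set (psi := tpow q (m + n)) in *.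
  assert (He : 0 <= e).
  { unfold e. assert (0 <= INR (m + n) / INR q) by (apply Rdiv_le_0_compat; [apply pos_INR|apply lt_0_INR; lia]). lra. }
  assert (Hend : Q t1 - B * psi t1 ^ 2 <= 0).
  { apply (barrier_forward (fun t => Q t - B * psi t ^ 2)
      (fun t => Derive Q t - B * (- e * / t * psi t ^ 2)) t0 t1); [lra| | |lra].
    - intros t Ht'. destruct (HS t Ht') as [HL HBd].
      destruct (HE1 t ltac:(lra) u v h1 h2 HL HBd) as (HQ & Q' & HQ' & HQb).
      apply (is_derive_minus Q (fun t => B * psi t ^ 2)).
      + apply Derive_correct. exists Q'. exact HQ'.
      + apply (is_derive_scal (fun t => psi t ^ 2)), is_derive_tube. lra.
    - intros t Ht' Hpos. destruct (HS t Ht') as [HL HBd].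
      destruct (HE1 t ltac:(lra) u v h1 h2 HL HBd) as (HQ & Q' & HQ' & HQb).
      fold Q in HQ', HQb. fold psi in HQb.
      assert (ED : Derive Q t = Q') by (apply is_derive_unique; exact HQ'). rewrite ED.
      assert (Hti : 0 < / t) by (apply Rinv_0_lt_compat; lra).
      specialize (HT2 t ltac:(lra)).
      assert (Hp2 : 0 < psi t ^ 2) by (apply pow_lt, tpow_pos).
      assert (HQp : psi t ^ 2 <= Q t) by nra.
      apply Rabs_le_between in HQb.
      assert (L1 : (a t + d t) * Q t <= - (C1 + 1 + e) * / t * Q t) by (apply Rmult_le_compat_r; lra).
      assert (L2 : / t * psi t ^ 2 <= / t * Q t) by (apply Rmult_le_compat_l; lra).
      assert (L3 : e * / t * (B * psi t ^ 2) <= e * / t * Q t).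
      { apply Rmult_le_compat_l; [apply Rmult_le_pos; lra|lra]. }
      lra. }
  destruct (HS t1 ltac:(lra)) as [HL HBd].
  destruct (HE1 t1 ltac:(lra) u v h1 h2 HL HBd) as (HQ & _). fold Q in HQ. lra.
Qed.

Lemma contracting_finite_horizon (q n : nat) (kap : R) (a b c d : R -> R) :
  (1 <= n <= q)%nat -> 0 < kap -> near_center q n kap a b c d ->
  (forall K, at_infinity (fun t => a t + d t <= - K * / t)) -> finite_horizon_solvable q a b c d.
Proof.
  intros Hn Hk HA Htr. exists 0%nat. intros m _.
  destruct (contracting_barrier q n m kap a b c d Hn Hk HA Htr) as (T1 & HT1 & HB).
  destruct (energy_bound_eventually q n m kap 2 1 Hn Hk ltac:(lra) ltac:(lra)) as [T3 HEn].
  exists (Rmax T1 T3). intros T0 T f1 f2 HT HT0 F1 F2 Hf j.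
  pose proof (Rmax_l T1 T3). pose proof (Rmax_r T1 T3).
  destruct (picard_lindelof T0 T 0 0 f1 f2 F1 F2 HT0) as (u & v & Hu & Hv & HS).
  exists u, v. split; [exact HS|].
  intros t Ht. rewrite <- (Rmult_1_l (tpow q m t)).
  apply HEn; [lra|].
  assert (kap * tpow q n t * u t ^ 2 + v t ^ 2 <= 2 * 1 * tpow q (m + n) t ^ 2); [|lra].
  apply (HB T t ltac:(lra) u v (fun t => f1 t (u t) (v t) - (a t * u t + b t * v t))
       (fun t => f2 t (u t) (v t) - (- c t * u t + d t * v t))).
  - intros r Hr. split.
    + apply (solves_linear_system T0); [exact HS|lra].
    + unfold bounded_pair. rewrite Rmult_1_l. apply Hf. lra.
  - lra.
  - unfold energy_form. rewrite Hu, Hv. pose proof (pow2_ge_0 (tpow q (m + n) T)). lra.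
Qed.

Lemma contracting_decay (q n : nat) (kap : R) (a b c d : R -> R) :
  (1 <= n <= q)%nat -> 0 < kap -> near_center q n kap a b c d ->
  (forall K, at_infinity (fun t => a t + d t <= - K * / t)) -> decay_improving q a b c d.
Proof.
  intros Hn Hk HA Htr. exists 0%nat. intros m u v h1 h2 C _ HL _ HH.
  destruct (contracting_barrier q n m kap a b c d Hn Hk HA Htr) as (T1 & HT1 & HB).
  destruct (at_infinity_all _ (at_infinity_and _ _ HL (at_infinity_and _ _ HH (at_infinity_ge T1)))) as (T & HT & Hev).
  assert (HTT : T1 <= T) by (apply (Hev T); lra).
  set (Q0 := energy_form a b c d u v T). set (f0 := tpow q (m + n) T ^ 2).
  assert (Hf0 : 0 < f0) by (apply pow_lt, tpow_pos).
  set (B := 1 + Rabs Q0 / f0).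
  assert (HQ0 : 0 <= Rabs Q0 / f0) by (apply Rdiv_le_0_compat; [apply Rabs_pos|exact Hf0]).
  exists 1.
  destruct (energy_bound_eventually q n m kap (2 * B) 1 Hn Hk ltac:(lra) ltac:(unfold B; lra)) as [T2 HE].
  exists (Rmax T T2). intros t Ht. pose proof (Rmax_l T T2). pose proof (Rmax_r T T2).
  apply HE; [lra|].
  apply (HB T t ltac:(lra) u v h1 h2).
  - intros r Hr. split; apply (Hev r ltac:(lra)).
  - unfold B. lra.
  - fold Q0 f0. unfold B. rewrite Rmult_plus_distr_r.
    replace (Rabs Q0 / f0 * f0) with (Rabs Q0) by (field; lra). pose proof (Rle_abs Q0). lra.
Qed.

(** * Smooth functions of one variable and their order at 0+ *)

Fixpoint Ck1 (m : nat) (f : R -> R) : Prop :=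
  match m with
  | O => forall x, continuous f x
  | S m' => (forall x, ex_derive f x) /\ Ck1 m' (Derive f)
  end.

Definition smooth1 (f : R -> R) : Prop := forall m, Ck1 m f.

Lemma Ck1_S (m : nat) (f : R -> R) : Ck1 (S m) f -> Ck1 m f.
Proof.
  revert f. induction m as [|m IH]; intros f [H1 H2].
  - intros x. apply (ex_derive_continuous f), H1.
  - split; [exact H1|apply IH, H2].
Qed.

Lemma smooth1_ex_derive (f : R -> R) (x : R) : smooth1 f -> ex_derive f x.
Proof. intros H. apply (H 1%nat). Qed.

Lemma smooth1_Derive (f : R -> R) : smooth1 f -> smooth1 (Derive f).
Proof. intros H m. apply (H (S m)). Qed.

Lemma Ck1_const (m : nat) (c : R) : Ck1 m (fun _ => c).
Proof.
  revert c. induction m as [|m IH]; intros c.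
  - intros x. apply continuous_const.
  - split. { intros x. apply (ex_derive_const c). }
    replace (Derive (fun _ : R => c)) with (fun _ : R => 0); [apply IH|].
    apply functional_extensionality. intros x. symmetry. apply Derive_const.
Qed.

Lemma smooth1_const (c : R) : smooth1 (fun _ => c).
Proof. intros m. apply Ck1_const. Qed.

Lemma smooth1_id : smooth1 (fun x => x).
Proof.
  intros [|m].
  - intros x. apply continuous_id.
  - split. { intros x. apply (ex_derive_id x). }
    replace (Derive (fun x : R => x)) with (fun _ : R => 1); [apply Ck1_const|].
    apply functional_extensionality. intros x. symmetry. apply Derive_id.
Qed.

Lemma Ck1_plus (m : nat) (f g : R -> R) : Ck1 m f -> Ck1 m g -> Ck1 m (fun x => f x + g x).
Proof.
  revert f g. induction m as [|m IH]; intros f g Hf Hg.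
  - intros x. apply (continuous_plus f g); [apply Hf|apply Hg].
  - destruct Hf as [Hf1 Hf2], Hg as [Hg1 Hg2]. split.
    + intros x. apply (ex_derive_plus f g); auto.
    + replace (Derive (fun x => f x + g x)) with (fun x => Derive f x + Derive g x); [apply IH; assumption|].
      apply functional_extensionality. intros x. symmetry. apply Derive_plus; auto.
Qed.

Lemma Ck1_mult (m : nat) (f g : R -> R) : Ck1 m f -> Ck1 m g -> Ck1 m (fun x => f x * g x).
Proof.
  revert f g. induction m as [|m IH]; intros f g Hf Hg.
  - intros x. apply (continuous_mult f g); [apply Hf|apply Hg].
  - assert (Hf0 := Ck1_S _ _ Hf). assert (Hg0 := Ck1_S _ _ Hg).
    destruct Hf as [Hf1 Hf2], Hg as [Hg1 Hg2]. split.
    + intros x. apply (ex_derive_mult f g); auto.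
    + replace (Derive (fun x => f x * g x)) with (fun x => Derive f x * g x + f x * Derive g x).
      * apply Ck1_plus; apply IH; assumption.
      * apply functional_extensionality. intros x. symmetry. apply Derive_mult; auto.
Qed.

Lemma smooth1_plus (f g : R -> R) : smooth1 f -> smooth1 g -> smooth1 (fun x => f x + g x).
Proof. intros Hf Hg m. apply Ck1_plus; auto. Qed.

Lemma smooth1_mult (f g : R -> R) : smooth1 f -> smooth1 g -> smooth1 (fun x => f x * g x).
Proof. intros Hf Hg m. apply Ck1_mult; auto. Qed.

Lemma smooth1_scal (c : R) (f : R -> R) : smooth1 f -> smooth1 (fun x => c * f x).
Proof. intros Hf. apply (smooth1_mult (fun _ => c)); [apply smooth1_const|exact Hf]. Qed.

Lemma smooth1_minus (f g : R -> R) : smooth1 f -> smooth1 g -> smooth1 (fun x => f x - g x).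
Proof.
  intros Hf Hg.
  replace (fun x => f x - g x) with (fun x => f x + (-1) * g x).
  - apply smooth1_plus; [exact Hf|apply smooth1_scal, Hg].
  - apply functional_extensionality. intros x. ring.
Qed.

Lemma smooth1_pow (k : nat) : smooth1 (fun x => x ^ k).
Proof.
  induction k as [|k IH].
  - exact (smooth1_const 1).
  - apply (smooth1_mult (fun x => x)); [apply smooth1_id|exact IH].
Qed.

Lemma is_derive_comp_smooth2 (f : R -> R -> R) (p r : R -> R) (e dp dr : R) :
  smooth2 f -> is_derive p e dp -> is_derive r e dr ->
  is_derive (fun e => f (p e) (r e)) e (pdx f (p e) (r e) * dp + pdy f (p e) (r e) * dr).
Proof.
  intros Hf Hp Hr. apply is_derive_Reals.
  apply derivable_pt_lim_comp_2d; [|apply is_derive_Reals, Hp|apply is_derive_Reals, Hr].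
  set (x := p e). set (y := r e).
  set (b := Rmax (Rabs x) (Rabs y) + 1).
  assert (Hx : Rabs x <= b - 1) by (unfold b; pose proof (Rmax_l (Rabs x) (Rabs y)); lra).
  assert (Hy : Rabs y <= b - 1) by (unfold b; pose proof (Rmax_r (Rabs x) (Rabs y)); lra).
  destruct (smooth2_linearization f b Hf) as (L & HL & HB).
  intros eps. pose proof (cond_pos eps) as He.
  assert (Hd : 0 < Rmin 1 (eps / (4 * L + 1))) by (apply Rmin_glb_lt; [lra|apply Rdiv_lt_0_compat; lra]).
  exists (mkposreal _ Hd). intros u v Hu Hv. simpl in Hu, Hv.
  pose proof (Rmin_l 1 (eps / (4 * L + 1))). pose proof (Rmin_r 1 (eps / (4 * L + 1))).
  assert (Hu' : Rabs u <= b).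
  { replace u with ((u - x) + x) by ring. eapply Rle_trans; [apply Rabs_triang|]. lra. }
  assert (Hv' : Rabs v <= b).
  { replace v with ((v - y) + y) by ring. eapply Rle_trans; [apply Rabs_triang|]. lra. }
  specialize (HB x y u v x y ltac:(lra) ltac:(lra) Hu' Hv' ltac:(lra) ltac:(lra)).
  replace (x - x) with 0 in HB by ring. replace (y - y) with 0 in HB by ring. rewrite Rabs_R0 in HB.
  replace (f u v - f x y - (pdx f x y * (u - x) + pdy f x y * (v - y)))
    with (f u v - f x y - pdx f x y * (u - x) - pdy f x y * (v - y)) by ring.
  apply Rle_trans with (1 := HB).
  set (M := Rmax (Rabs (u - x)) (Rabs (v - y))).
  assert (M1 : Rabs (u - x) <= M) by apply Rmax_l. assert (M2 : Rabs (v - y) <= M) by apply Rmax_r.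
  pose proof (Rabs_pos (u - x)). pose proof (Rabs_pos (v - y)).
  assert (M3 : M < eps / (4 * L + 1)) by (apply Rmax_lub_lt; lra).
  assert (M4 : (4 * L + 1) * M <= eps).
  { apply Rmult_lt_compat_l with (r := 4 * L + 1) in M3; [|lra].
    replace ((4 * L + 1) * (eps / (4 * L + 1))) with (pos eps) in M3 by (field; lra). lra. }
  apply Rle_trans with (L * (2 * M) * (2 * M)).
  - apply Rmult_le_compat; [apply Rmult_le_pos; lra|lra| |lra]. apply Rmult_le_compat_l; lra.
  - nra.
Qed.

Lemma smooth1_comp_smooth2 (f : R -> R -> R) (p r : R -> R) :
  smooth2 f -> smooth1 p -> smooth1 r -> smooth1 (fun e => f (p e) (r e)).
Proof.
  intros Hf Hp Hr m. revert f Hf. induction m as [|m IH]; intros f Hf.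
  - intros x. apply (ex_derive_continuous (fun e => f (p e) (r e))). eexists.
    apply is_derive_comp_smooth2; [exact Hf|apply Derive_correct, smooth1_ex_derive, Hp|apply Derive_correct, smooth1_ex_derive, Hr].
  - assert (HD : forall x, is_derive (fun e => f (p e) (r e)) x
        (pdx f (p x) (r x) * Derive p x + pdy f (p x) (r x) * Derive r x)).
    { intros x. apply is_derive_comp_smooth2; [exact Hf|apply Derive_correct, smooth1_ex_derive, Hp|apply Derive_correct, smooth1_ex_derive, Hr]. }
    split. { intros x. eexists. apply HD. }
    replace (Derive (fun e => f (p e) (r e))) with
      (fun x => pdx f (p x) (r x) * Derive p x + pdy f (p x) (r x) * Derive r x).
    + apply Ck1_plus; apply Ck1_mult; try (apply IH; apply smooth2_pdx || apply smooth2_pdy; exact Hf);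
        apply smooth1_Derive; assumption.
    + apply functional_extensionality. intros x. symmetry. apply is_derive_unique, HD.
Qed.

(** f(e) = O(e^m) as e -> 0+ *)
Definition bO (m : nat) (f : R -> R) : Prop :=
  exists C d, 0 <= C /\ 0 < d <= 1 /\ forall e, 0 < e <= d -> Rabs (f e) <= C * e ^ m.

(** f(e) = eta e^m + O(e^(m+1)) as e -> 0+ *)
Definition lead (m : nat) (eta : R) (f : R -> R) : Prop :=
  bO (S m) (fun e => f e - eta * e ^ m).

Lemma bO_ext (m : nat) (f g : R -> R) : (forall e, f e = g e) -> bO m f -> bO m g.
Proof.
  intros E (C & d & HC & Hd & H). exists C, d. repeat split; try lra.
  intros e He. rewrite <- E. apply H, He.
Qed.

Lemma bO_plus (m : nat) (f g : R -> R) : bO m f -> bO m g -> bO m (fun e => f e + g e).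
Proof.
  intros (C1 & d1 & HC1 & Hd1 & H1) (C2 & d2 & HC2 & Hd2 & H2).
  exists (C1 + C2), (Rmin d1 d2). pose proof (Rmin_l d1 d2). pose proof (Rmin_r d1 d2).
  split; [lra|]. split. { split; [apply Rmin_glb_lt; lra|lra]. }
  intros e He. eapply Rle_trans; [apply Rabs_triang|].
  specialize (H1 e ltac:(lra)). specialize (H2 e ltac:(lra)). lra.
Qed.

Lemma bO_mult (j k : nat) (f g : R -> R) : bO j f -> bO k g -> bO (j + k) (fun e => f e * g e).
Proof.
  intros (C1 & d1 & HC1 & Hd1 & H1) (C2 & d2 & HC2 & Hd2 & H2).
  exists (C1 * C2), (Rmin d1 d2). pose proof (Rmin_l d1 d2). pose proof (Rmin_r d1 d2).
  split; [apply Rmult_le_pos; lra|]. split. { split; [apply Rmin_glb_lt; lra|lra]. }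
  intros e He. rewrite Rabs_mult, pow_add.
  specialize (H1 e ltac:(lra)). specialize (H2 e ltac:(lra)).
  replace (C1 * C2 * (e ^ j * e ^ k)) with ((C1 * e ^ j) * (C2 * e ^ k)) by ring.
  apply Rmult_le_compat; try apply Rabs_pos; assumption.
Qed.

Lemma pow_le_pow_small (e : R) (j k : nat) : 0 <= e <= 1 -> (j <= k)%nat -> e ^ k <= e ^ j.
Proof.
  intros He Hjk. replace k with (j + (k - j))%nat by lia. rewrite pow_add.
  assert (0 <= e ^ j) by (apply pow_le; lra).
  assert (e ^ (k - j) <= 1) by (rewrite <- (pow1 (k - j)); apply pow_incr; lra).
  assert (0 <= e ^ (k - j)) by (apply pow_le; lra). nra.
Qed.

Lemma bO_weaken (j k : nat) (f : R -> R) : (j <= k)%nat -> bO k f -> bO j f.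
Proof.
  intros Hjk (C & d & HC & Hd & H). exists C, d. split; [exact HC|]. split; [exact Hd|].
  intros e He. apply Rle_trans with (1 := H e He). apply Rmult_le_compat_l; [exact HC|].
  apply pow_le_pow_small; [lra|exact Hjk].
Qed.

Lemma bO_pow (m : nat) : bO m (fun e => e ^ m).
Proof.
  exists 1, 1. repeat split; try lra. intros e He.
  rewrite Rabs_pos_eq by (apply pow_le; lra). lra.
Qed.

Lemma bO_const (c : R) : bO 0 (fun _ => c).
Proof.
  exists (Rabs c), 1. split; [apply Rabs_pos|]. split; [lra|]. intros e He. simpl. lra.
Qed.

Lemma bO_scal (m : nat) (c : R) (f : R -> R) : bO m f -> bO m (fun e => c * f e).
Proof. intros H. exact (bO_mult 0 m _ _ (bO_const c) H). Qed.

Lemma bO_scal_pow (c : R) (j m : nat) : (m <= j)%nat -> bO m (fun e => c * e ^ j).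
Proof. intros H. apply bO_scal, (bO_weaken m j); [exact H|apply bO_pow]. Qed.

Lemma bO_minus (m : nat) (f g : R -> R) : bO m f -> bO m g -> bO m (fun e => f e - g e).
Proof.
  intros Hf Hg. apply (bO_ext m (fun e => f e + (-1) * g e)); [intros e; ring|].
  apply bO_plus; [exact Hf|apply bO_scal, Hg].
Qed.

Lemma bO_zero (m : nat) (f : R -> R) : (forall e, f e = 0) -> bO m f.
Proof.
  intros H. exists 0, 1. split; [lra|]. split; [lra|]. intros e He. rewrite H, Rabs_R0. lra.
Qed.

Lemma lead_bO (m : nat) (eta : R) (f : R -> R) : lead m eta f -> bO m f.
Proof.
  intros H. apply (bO_ext m (fun e => (f e - eta * e ^ m) + eta * e ^ m)); [intros e; ring|].
  apply bO_plus; [apply (bO_weaken m (S m)); [lia|exact H]|apply bO_scal, bO_pow].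
Qed.

Lemma bO_coefficient_zero (m : nat) (eta : R) : bO (S m) (fun e => eta * e ^ m) -> eta = 0.
Proof.
  intros (C & d & HC & Hd & H).
  destruct (Req_dec eta 0) as [E|E]; [exact E|exfalso].
  apply Rabs_pos_lt in E.
  set (e := Rmin d (Rabs eta / (2 * (C + 1)))).
  assert (He : 0 < e) by (apply Rmin_glb_lt; [lra|apply Rdiv_lt_0_compat; lra]).
  assert (He1 : e <= d) by apply Rmin_l. assert (He2 : e <= Rabs eta / (2 * (C + 1))) by apply Rmin_r.
  specialize (H e ltac:(lra)).
  assert (Hp : 0 < e ^ m) by (apply pow_lt; exact He).
  rewrite Rabs_mult, (Rabs_pos_eq (e ^ m)) in H by lra.
  replace (C * e ^ S m) with ((C * e) * e ^ m) in H by (simpl; ring).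
  apply Rmult_le_reg_r in H; [|exact Hp].
  apply Rmult_le_compat_l with (r := 2 * (C + 1)) in He2; [|lra].
  replace (2 * (C + 1) * (Rabs eta / (2 * (C + 1)))) with (Rabs eta) in He2 by (field; lra). nra.
Qed.

Lemma smooth1_bounded_derive (f : R -> R) :
  smooth1 f -> exists M, 0 <= M /\ forall e, 0 <= e <= 1 -> Rabs (Derive f e) <= M.
Proof.
  intros Hf.
  destruct (continuous_on_box_bounded (fun _ _ s => Derive f s) 0 0 1) as (M & HM & HB).
  { intros x y s _ _ _.
    apply (continuous_comp (fun p : R * R * R => snd p) (Derive f)); [apply continuous_snd|].
    apply (Hf 1%nat). }
  exists M. split; [exact HM|]. intros e He. apply (HB 0 0 e); try (rewrite Rabs_R0; lra). exact He.
Qed.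

(** Mean value inequality for the difference; its derivative at 0 is bounded by
    continuity, as the expansion of f' concerns e > 0 only. *)
Lemma lead_of_lead_Derive (m : nat) (theta : R) (f : R -> R) :
  smooth1 f -> lead m theta (Derive f) ->
  bO (S (S m)) (fun e => f e - f 0 - theta / INR (S m) * e ^ S m).
Proof.
  intros Hf (C & d & HC & Hd & H).
  exists C, d. split; [exact HC|]. split; [exact Hd|].
  intros e He.
  assert (Hm : 0 < INR (S m)) by (apply lt_0_INR; lia).
  assert (HD : forall s, is_derive (fun e => f e - theta / INR (S m) * e ^ S m) s (Derive f s - theta * s ^ m)).
  { intros s. apply (is_derive_minus f (fun e => theta / INR (S m) * e ^ S m)).
    - apply Derive_correct, smooth1_ex_derive, Hf.
    - evar_last.
      + apply (is_derive_scal (fun e => e ^ S m)). apply (is_derive_pow (fun e => e) (S m)). apply is_derive_id.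
      + change one with 1. simpl pred. field. lra. }
  assert (HL := mvt_lipschitz (fun e => f e - theta / INR (S m) * e ^ S m) 0 e (C * e ^ S m)).
  cbv beta in HL. rewrite Rmin_left, Rmax_right in HL by lra.
  replace (f e - theta / INR (S m) * e ^ S m - (f 0 - theta / INR (S m) * 0 ^ S m))
    with (f e - f 0 - theta / INR (S m) * e ^ S m) in HL by (simpl; ring).
  rewrite Rminus_0_r, (Rabs_pos_eq e) in HL by lra.
  replace (C * e ^ S (S m)) with (C * e ^ S m * e) by (simpl; ring).
  apply HL. intros s Hs. split; [eexists; apply HD|].
  replace (Derive _ s) with (Derive f s - theta * s ^ m) by (symmetry; apply is_derive_unique, HD).
  destruct (proj1 Hs) as [Hs0|Hs0].
  - apply Rle_trans with (1 := H s ltac:(lra)). apply Rmult_le_compat_l; [exact HC|]. apply pow_incr. lra.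
  - subst s. apply Rnot_lt_le. intros Hlt.
    assert (Hc : continuous (fun s => Derive f s - theta * s ^ m) 0).
    { apply (ex_derive_continuous (fun s => Derive f s - theta * s ^ m)).
      apply (ex_derive_minus (Derive f) (fun s => theta * s ^ m)).
      - apply smooth1_ex_derive, smooth1_Derive, Hf.
      - apply smooth1_ex_derive, smooth1_scal, smooth1_pow. }
    destruct (proj1 (continuous_eps _ _) Hc (Rabs (Derive f 0 - theta * 0 ^ m) - C * e ^ S m) ltac:(lra))
      as (d' & Hd' & Hdd).
    set (s := Rmin (d' / 2) e).
    assert (S1 : 0 < s) by (apply Rmin_glb_lt; lra). assert (S2 : s <= d' / 2) by apply Rmin_l.
    assert (S3 : s <= e) by apply Rmin_r.
    specialize (Hdd s). rewrite Rminus_0_r, (Rabs_pos_eq s) in Hdd by lra. specialize (Hdd ltac:(lra)).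
    assert (S4 := H s ltac:(lra)).
    assert (S5 : C * s ^ S m <= C * e ^ S m) by (apply Rmult_le_compat_l; [exact HC|apply pow_incr; lra]).
    rewrite Rabs_minus_sym in Hdd.
    pose proof (Rabs_triang ((Derive f 0 - theta * 0 ^ m) - (Derive f s - theta * s ^ m)) (Derive f s - theta * s ^ m)) as Ht.
    replace ((Derive f 0 - theta * 0 ^ m) - (Derive f s - theta * s ^ m) + (Derive f s - theta * s ^ m))
      with (Derive f 0 - theta * 0 ^ m) in Ht by ring.
    lra.
Qed.

(** By induction on the order of vanishing: f = O(e^(m+1))
    forces the coefficient of e^m to vanish, so that f' = O(e^m) and the case m
    applies to f'. *)
Lemma smooth1_lead_Derive (m : nat) (f : R -> R) :
  smooth1 f -> bO m f ->
  exists eta, lead m eta f /\ bO m (fun e => Derive f e - INR m * eta * e ^ pred m).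
Proof.
  revert f. induction m as [|m IH]; intros f Hf HO.
  - exists (f 0). destruct (smooth1_bounded_derive f Hf) as (M & HM & HB). split.
    + exists M, 1. split; [exact HM|]. split; [lra|]. intros e He.
      simpl pow. rewrite !Rmult_1_r.
      replace e with (Rabs (e - 0)) at 2 by (rewrite Rminus_0_r; apply Rabs_pos_eq; lra).
      apply (mvt_lipschitz f 0 e). intros s Hs. rewrite Rmin_left, Rmax_right in Hs by lra.
      split; [apply smooth1_ex_derive, Hf|apply HB; lra].
    + exists M, 1. split; [exact HM|]. split; [lra|]. intros e He.
      simpl. rewrite Rmult_0_l, Rmult_0_l, Rminus_0_r, Rmult_1_r. apply HB. lra.
  - destruct (IH f Hf (bO_weaken m (S m) f ltac:(lia) HO)) as (eta & L1 & L2).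
    assert (Eeta : eta = 0).
    { apply (bO_coefficient_zero m).
      apply (bO_ext _ (fun e => f e - (f e - eta * e ^ m))); [intros e; ring|].
      apply bO_minus; [exact HO|exact L1]. }
    subst eta.
    assert (HO' : bO m (Derive f)) by (apply (bO_ext _ _ (Derive f)) in L2; [exact L2|intros e; ring]).
    destruct (IH (Derive f) (smooth1_Derive f Hf) HO') as (theta & M1 & _).
    assert (HI := lead_of_lead_Derive m theta f Hf M1).
    assert (Hf0 : f 0 = 0).
    { apply (bO_coefficient_zero 0).
      apply (bO_ext _ (fun e => f e - ((f e - f 0 - theta / INR (S m) * e ^ S m) + theta / INR (S m) * e ^ S m)));
        [intros e; simpl; ring|].
      apply bO_minus; [apply (bO_weaken 1 (S m)); [lia|exact HO]|].
      apply bO_plus; [apply (bO_weaken 1 (S (S m))); [lia|exact HI]|apply bO_scal_pow; lia]. }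
    exists (theta / INR (S m)). split.
    + apply (bO_ext _ (fun e => f e - f 0 - theta / INR (S m) * e ^ S m)); [|exact HI].
      intros e. rewrite Hf0. ring.
    + simpl pred. apply (bO_ext _ (fun e => Derive f e - theta * e ^ m)); [|exact M1].
      intros e. field. apply not_0_INR. lia.
Qed.

Lemma smooth1_lead (m : nat) (f : R -> R) : smooth1 f -> bO m f -> exists eta, lead m eta f.
Proof. intros Hf HO. destruct (smooth1_lead_Derive m f Hf HO) as (eta & H & _). exists eta. exact H. Qed.

Lemma smooth1_bO_0 (f : R -> R) : smooth1 f -> bO 0 f.
Proof.
  intros Hf. destruct (smooth1_bounded_derive f Hf) as (M & HM & HB).
  exists (Rabs (f 0) + M), 1. pose proof (Rabs_pos (f 0)). split; [lra|]. split; [lra|]. intros e He.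
  assert (HL := mvt_lipschitz f 0 e M). rewrite Rmin_left, Rmax_right in HL by lra.
  specialize (HL (fun x h => conj (smooth1_ex_derive f x Hf) (HB x ltac:(lra)))).
  rewrite Rminus_0_r, (Rabs_pos_eq e) in HL by lra.
  replace (f e) with ((f e - f 0) + f 0) by ring. eapply Rle_trans; [apply Rabs_triang|]. simpl. nra.
Qed.

Lemma smooth1_bO_Derive (m : nat) (f : R -> R) : smooth1 f -> bO m f -> bO (pred m) (Derive f).
Proof.
  intros Hf HO. destruct (smooth1_lead_Derive m f Hf HO) as (eta & _ & H).
  apply (bO_ext _ (fun e => (Derive f e - INR m * eta * e ^ pred m) + INR m * eta * e ^ pred m));
    [intros e; ring|].
  apply bO_plus; [apply (bO_weaken _ m); [lia|exact H]|apply bO_scal_pow; lia].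
Qed.

(** * Truncated expansions of the right-hand sides *)

(** Truncated expansion of a right-hand side, with e = t^(-1/q); recursive, so that
    orders are added one at a time. *)
Fixpoint trunc (F : nat -> R -> R -> R) (K : nat) (x y e : R) : R :=
  match K with
  | O => F O x y
  | S K' => trunc F K' x y e + e ^ K * F K x y
  end.

Lemma smooth1_trunc (F : nat -> R -> R -> R) (K : nat) (p r : R -> R) :
  (forall k, smooth2 (F k)) -> smooth1 p -> smooth1 r ->
  smooth1 (fun e => trunc F K (p e) (r e) e).
Proof.
  intros HF Hp Hr. induction K as [|K IH]; cbn [trunc].
  - apply smooth1_comp_smooth2; auto.
  - apply (smooth1_plus (fun e => trunc F K (p e) (r e) e)); [exact IH|].
    apply smooth1_mult; [apply smooth1_pow|apply smooth1_comp_smooth2; auto].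
Qed.

Lemma trunc_linearization_full (F : nat -> R -> R -> R) (K : nat) (r : R) :
  (forall k, smooth2 (F k)) ->
  exists L, 0 <= L /\ forall x y x' y' x0 y0 e,
    Rabs x <= r -> Rabs y <= r -> Rabs x' <= r -> Rabs y' <= r ->
    Rabs x0 <= r -> Rabs y0 <= r -> 0 <= e <= 1 ->
    Rabs (trunc F K x' y' e - trunc F K x y e - trunc (fun k => pdx (F k)) K x0 y0 e * (x' - x)
          - trunc (fun k => pdy (F k)) K x0 y0 e * (y' - y))
      <= L * (Rabs (x' - x) + Rabs (y' - y))
           * (Rabs (x' - x) + Rabs (y' - y) + Rabs (x - x0) + Rabs (y - y0)).
Proof.
  intros HF. induction K as [|K IHK]; cbn [trunc].
  - destruct (smooth2_linearization (F 0%nat) r (HF 0%nat)) as (L & HL & HB).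
    exists L. split; [exact HL|]. intros. apply HB; assumption.
  - destruct IHK as (L1 & HL1 & B1).
    destruct (smooth2_linearization (F (S K)) r (HF (S K))) as (L2 & HL2 & B2).
    exists (L1 + L2). split; [lra|]. intros x y x' y' x0 y0 e Hx Hy Hx' Hy' Hx0 Hy0 He.
    specialize (B1 x y x' y' x0 y0 e Hx Hy Hx' Hy' Hx0 Hy0 He).
    specialize (B2 x y x' y' x0 y0 Hx Hy Hx' Hy' Hx0 Hy0).
    set (D := Rabs (x' - x) + Rabs (y' - y)) in *.
    set (M := D + Rabs (x - x0) + Rabs (y - y0)) in *.
    assert (Hp1 : 0 <= e ^ S K) by (apply pow_le; lra).
    assert (Hp2 : e ^ S K <= 1) by (rewrite <- (pow1 (S K)); apply pow_incr; lra).
    match goal with |- Rabs ?g <= _ => replace g with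
      ((trunc F K x' y' e - trunc F K x y e - trunc (fun k => pdx (F k)) K x0 y0 e * (x' - x)
         - trunc (fun k => pdy (F k)) K x0 y0 e * (y' - y))
       + e ^ S K * (F (S K) x' y' - F (S K) x y - pdx (F (S K)) x0 y0 * (x' - x)
         - pdy (F (S K)) x0 y0 * (y' - y))) by ring end.
    eapply Rle_trans; [apply Rabs_triang|]. rewrite Rabs_mult, (Rabs_pos_eq (e ^ S K)) by lra.
    match type of B2 with Rabs ?g <= _ => pose proof (Rabs_pos g); set (G2 := Rabs g) in * end.
    assert (e ^ S K * G2 <= 1 * G2) by (apply Rmult_le_compat_r; lra).
    lra.
Qed.

(** Only the terms up to K0 need enter the linear part: this makes one and the
    same linear part serve truncations of every order. *)
Lemma trunc_linearization (F : nat -> R -> R -> R) (K0 K : nat) (r : R) :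
  (forall k, smooth2 (F k)) -> (K0 <= K)%nat ->
  exists L, 0 <= L /\ forall x y x' y' x0 y0 e,
    Rabs x <= r -> Rabs y <= r -> Rabs x' <= r -> Rabs y' <= r ->
    Rabs x0 <= r -> Rabs y0 <= r -> 0 <= e <= 1 ->
    Rabs (trunc F K x' y' e - trunc F K x y e - trunc (fun k => pdx (F k)) K0 x0 y0 e * (x' - x)
          - trunc (fun k => pdy (F k)) K0 x0 y0 e * (y' - y))
      <= L * (Rabs (x' - x) + Rabs (y' - y))
           * (Rabs (x' - x) + Rabs (y' - y) + Rabs (x - x0) + Rabs (y - y0) + e ^ S K0).
Proof.
  intros HF HK. induction HK as [|K HK IH].
  - destruct (trunc_linearization_full F K0 r HF) as (L & HL & HB).
    exists L. split; [exact HL|]. intros x y x' y' x0 y0 e Hx Hy Hx' Hy' Hx0 Hy0 He.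
    eapply Rle_trans; [apply HB; assumption|].
    assert (0 <= e ^ S K0) by (apply pow_le; lra).
    apply Rmult_le_compat_l; [|lra]. apply Rmult_le_pos; [exact HL|].
    pose proof (Rabs_pos (x' - x)). pose proof (Rabs_pos (y' - y)). lra.
  - destruct IH as (L1 & HL1 & B1).
    destruct (smooth2_lipschitz (F (S K)) r (HF (S K))) as (L2 & HL2 & B2).
    exists (L1 + L2). split; [lra|]. intros x y x' y' x0 y0 e Hx Hy Hx' Hy' Hx0 Hy0 He.
    specialize (B1 x y x' y' x0 y0 e Hx Hy Hx' Hy' Hx0 Hy0 He).
    specialize (B2 x' y' x y Hx' Hy' Hx Hy).
    set (D := Rabs (x' - x) + Rabs (y' - y)) in *.
    assert (HD : 0 <= D) by (unfold D; pose proof (Rabs_pos (x' - x)); pose proof (Rabs_pos (y' - y)); lra).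
    pose proof (Rabs_pos (x - x0)). pose proof (Rabs_pos (y - y0)).
    assert (Hp0 : 0 <= e ^ S K) by (apply pow_le; lra).
    assert (Hp1 : e ^ S K <= e ^ S K0) by (apply pow_le_pow_small; [lra|lia]).
    change (trunc F (S K) x' y' e) with (trunc F K x' y' e + e ^ S K * F (S K) x' y').
    change (trunc F (S K) x y e) with (trunc F K x y e + e ^ S K * F (S K) x y).
    match goal with |- Rabs ?g <= _ => replace g with
      ((trunc F K x' y' e - trunc F K x y e - trunc (fun k => pdx (F k)) K0 x0 y0 e * (x' - x)
         - trunc (fun k => pdy (F k)) K0 x0 y0 e * (y' - y))
       + e ^ S K * (F (S K) x' y' - F (S K) x y)) by ring end.
    eapply Rle_trans; [apply Rabs_triang|]. rewrite Rabs_mult, (Rabs_pos_eq (e ^ S K)) by lra.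
    assert (e ^ S K * Rabs (F (S K) x' y' - F (S K) x y) <= e ^ S K0 * (L2 * D)).
    { apply Rmult_le_compat; [lra|apply Rabs_pos|lra|exact B2]. }
    assert (0 <= L2 * D * (D + Rabs (x - x0) + Rabs (y - y0)))
      by (apply Rmult_le_pos; [apply Rmult_le_pos; lra|lra]).
    lra.
Qed.

Lemma bO_1_small (f : R -> R) :
  bO 1 f -> exists C d, 0 <= C /\ 0 < d <= 1 /\ forall e, 0 < e <= d -> Rabs (f e) <= C * e /\ Rabs (f e) <= 1.
Proof.
  intros (C & d & HC & Hd & H).
  exists C, (Rmin d (/ (C + 1))).
  assert (Hi : 0 < / (C + 1)) by (apply Rinv_0_lt_compat; lra).
  pose proof (Rmin_l d (/ (C + 1))). pose proof (Rmin_r d (/ (C + 1))).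
  split; [exact HC|]. split. { split; [apply Rmin_glb_lt; lra|lra]. }
  intros e He. specialize (H e ltac:(lra)). simpl in H. rewrite Rmult_1_r in H.
  split; [exact H|]. apply Rle_trans with (1 := H).
  assert (He2 : e <= / (C + 1)) by lra.
  apply Rmult_le_compat_l with (r := C + 1) in He2; [|lra]. rewrite Rinv_r in He2 by lra. lra.
Qed.

Lemma bO_comp_smooth2 (f : R -> R -> R) (m : nat) (p r : R -> R) :
  smooth2 f -> (1 <= m)%nat -> bO m p -> bO m r -> bO m (fun e => f (p e) (r e) - f 0 0).
Proof.
  intros Hf Hm Hp Hr.
  destruct (smooth2_lipschitz f 1 Hf) as (L & HL & HB).
  destruct (bO_1_small p (bO_weaken 1 m p Hm Hp)) as (D1 & e1 & HD1 & He1 & S1).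
  destruct (bO_1_small r (bO_weaken 1 m r Hm Hr)) as (D2 & e2 & HD2 & He2 & S2).
  destruct Hp as (C1 & d1 & HC1 & Hd1 & B1). destruct Hr as (C2 & d2 & HC2 & Hd2 & B2).
  set (dd := Rmin (Rmin d1 d2) (Rmin e1 e2)).
  pose proof (Rmin_l (Rmin d1 d2) (Rmin e1 e2)). pose proof (Rmin_r (Rmin d1 d2) (Rmin e1 e2)).
  pose proof (Rmin_l d1 d2). pose proof (Rmin_r d1 d2). pose proof (Rmin_l e1 e2). pose proof (Rmin_r e1 e2).
  exists (L * (C1 + C2)), dd.
  split; [apply Rmult_le_pos; lra|].
  split. { unfold dd. split; [apply Rmin_glb_lt; apply Rmin_glb_lt; lra|lra]. }
  intros e He. unfold dd in He.
  specialize (B1 e ltac:(lra)). specialize (B2 e ltac:(lra)).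
  destruct (S1 e ltac:(lra)) as [_ P2]. destruct (S2 e ltac:(lra)) as [_ R2].
  assert (Hz : Rabs 0 <= 1) by (rewrite Rabs_R0; lra).
  specialize (HB (p e) (r e) 0 0 P2 R2 Hz Hz). rewrite !Rminus_0_r in HB.
  apply Rle_trans with (1 := HB). rewrite Rmult_assoc.
  apply Rmult_le_compat_l; [exact HL|]. lra.
Qed.

Lemma bO_0_comp_smooth2 (f : R -> R -> R) (p r : R -> R) :
  smooth2 f -> bO 1 p -> bO 1 r -> bO 0 (fun e => f (p e) (r e)).
Proof.
  intros Hf Hp Hr. apply (bO_ext 0 (fun e => (f (p e) (r e) - f 0 0) + f 0 0)); [intros e; ring|].
  apply bO_plus; [apply (bO_weaken 0 1); [lia|apply bO_comp_smooth2; auto]|apply bO_const].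
Qed.

Ltac leb_cases :=
  repeat match goal with
  | |- context [(?a <=? ?b)%nat] => destruct (Nat.leb_spec a b)
  | H : context [(?a <=? ?b)%nat] |- _ => destruct (Nat.leb_spec a b)
  end; try lia.

Lemma trunc_lead (A : nat -> R -> R -> R) (n K : nat) (p r : R -> R) :
  (forall k, smooth2 (A k)) -> (1 <= n)%nat -> (forall k, (1 <= k < n)%nat -> forall x y, A k x y = 0) ->
  bO 1 p -> bO 1 r -> (n <= K)%nat ->
  lead n (A n 0 0) (fun e => trunc A K (p e) (r e) e - A O (p e) (r e)).
Proof.
  intros HA Hn Hv Hp Hr HK.
  assert (G : forall K, bO (S n) (fun e => trunc A K (p e) (r e) e - A O (p e) (r e)
            - (if (n <=? K)%nat then A n 0 0 else 0) * e ^ n)).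
  { clear K HK. induction K as [|K IH].
    - leb_cases. apply bO_zero. intros e. simpl. ring.
    - destruct (Nat.lt_total (S K) n) as [H|[H|H]].
      + leb_cases.
        revert IH. apply bO_ext. intros e. cbn [trunc]. rewrite (Hv (S K) ltac:(lia)). ring.
      + leb_cases.
        apply (bO_ext _ (fun e => (trunc A K (p e) (r e) e - A O (p e) (r e) - 0 * e ^ n)
           + e ^ n * (A n (p e) (r e) - A n 0 0))).
        * intros e. cbn [trunc]. rewrite H. ring.
        * apply bO_plus; [exact IH|]. replace (S n) with (n + 1)%nat by lia.
          apply bO_mult; [apply bO_pow|apply bO_comp_smooth2; auto].
      + leb_cases.
        apply (bO_ext _ (fun e => (trunc A K (p e) (r e) e - A O (p e) (r e) - A n 0 0 * e ^ n)
           + e ^ S K * (A (S K) (p e) (r e)))).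
        * intros e. cbn [trunc]. ring.
        * apply bO_plus; [exact IH|]. apply (bO_weaken _ (S K + 0)); [lia|].
          apply bO_mult; [apply bO_pow|apply bO_0_comp_smooth2; auto]. }
  specialize (G K). leb_cases. exact G.
Qed.

Lemma trunc_increment (F : nat -> R -> R -> R) (K j : nat) (p r : R -> R) (c d : R) :
  (forall k, smooth2 (F k)) -> (j <= K)%nat -> bO 1 p -> bO 1 r ->
  bO (2 * S j) (fun e => trunc F K (p e + c * e ^ S j) (r e + d * e ^ S j) e - trunc F K (p e) (r e) e
     - trunc (fun k => pdx (F k)) K (p e) (r e) e * (c * e ^ S j)
     - trunc (fun k => pdy (F k)) K (p e) (r e) e * (d * e ^ S j)).
Proof.
  intros HF HjK Hp Hr.
  set (s := Rabs c + Rabs d).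
  assert (Hs : 0 <= s) by (unfold s; pose proof (Rabs_pos c); pose proof (Rabs_pos d); lra).
  destruct (trunc_linearization F K K (1 + s) HF (Nat.le_refl K)) as (L & HL & HB).
  destruct (bO_1_small p Hp) as (C1 & d1 & HC1 & Hd1 & B1).
  destruct (bO_1_small r Hr) as (C2 & d2 & HC2 & Hd2 & B2).
  exists (L * s * (s + 1)), (Rmin d1 d2). pose proof (Rmin_l d1 d2). pose proof (Rmin_r d1 d2).
  split; [repeat apply Rmult_le_pos; lra|]. split. { split; [apply Rmin_glb_lt; lra|lra]. }
  intros e He. destruct (B1 e ltac:(lra)) as [_ P2]. destruct (B2 e ltac:(lra)) as [_ R2].
  assert (Hp0 : 0 <= e ^ S j) by (apply pow_le; lra).
  assert (Hp1 : e ^ S j <= 1) by (rewrite <- (pow1 (S j)); apply pow_incr; lra).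
  assert (Hp2 : e ^ S K <= e ^ S j) by (apply pow_le_pow_small; [lra|lia]).
  assert (A1 : Rabs (c * e ^ S j) = Rabs c * e ^ S j) by (rewrite Rabs_mult, (Rabs_pos_eq (e ^ S j)); lra).
  assert (A2 : Rabs (d * e ^ S j) = Rabs d * e ^ S j) by (rewrite Rabs_mult, (Rabs_pos_eq (e ^ S j)); lra).
  assert (G1 : Rabs (p e + c * e ^ S j) <= 1 + s).
  { eapply Rle_trans; [apply Rabs_triang|]. rewrite A1. pose proof (Rabs_pos c). pose proof (Rabs_pos d). unfold s. nra. }
  assert (G2 : Rabs (r e + d * e ^ S j) <= 1 + s).
  { eapply Rle_trans; [apply Rabs_triang|]. rewrite A2. pose proof (Rabs_pos c). pose proof (Rabs_pos d). unfold s. nra. }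
  specialize (HB (p e) (r e) _ _ (p e) (r e) e ltac:(lra) ltac:(lra) G1 G2 ltac:(lra) ltac:(lra) ltac:(lra)).
  replace (p e + c * e ^ S j - p e) with (c * e ^ S j) in HB by ring.
  replace (r e + d * e ^ S j - r e) with (d * e ^ S j) in HB by ring.
  replace (p e - p e) with 0 in HB by ring. replace (r e - r e) with 0 in HB by ring.
  rewrite Rabs_R0, A1, A2 in HB. apply Rle_trans with (1 := HB).
  replace (2 * S j)%nat with (S j + S j)%nat by lia. rewrite pow_add.
  set (g := e ^ S j) in *.
  replace (L * s * (s + 1) * (g * g)) with (L * (s * g) * ((s + 1) * g)) by ring.
  replace (Rabs c * g + Rabs d * g) with (s * g) by (unfold s; ring).
  apply Rmult_le_compat_l; [apply Rmult_le_pos; [exact HL|apply Rmult_le_pos; lra]|]. lra.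
Qed.

(** * The formal solution, order by order *)

(** F_0 = y and G_0 = - x^2 w(x) are the unperturbed right-hand sides; what is used of
    the second is its behaviour to second order at x = 0. *)
Record degenerate_system (n : nat) (w0 : R) (F G : nat -> R -> R -> R) : Prop := {
  ds_smooth_F : forall k, smooth2 (F k);
  ds_smooth_G : forall k, smooth2 (G k);
  ds_F_0 : forall x y, F O x y = y;
  ds_F_vanish : forall k, (1 <= k < n)%nat -> forall x y, F k x y = 0;
  ds_G_vanish : forall k, (1 <= k < n)%nat -> forall x y, G k x y = 0;
  ds_G_origin : forall k, (n <= k < 2 * n)%nat -> G k 0 0 = 0;
  ds_G_0 : exists C, 0 <= C /\ forall x y, Rabs x <= 1 ->
    Rabs (G O x y + w0 * x ^ 2) <= C * Rabs x ^ 3 /\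
    Rabs (pdx (G O) x y + 2 * w0 * x) <= C * Rabs x ^ 2 /\ pdy (G O) x y = 0 }.

Lemma pdx_zero (f : R -> R -> R) : (forall x y, f x y = 0) -> forall x y, pdx f x y = 0.
Proof.
  intros H x y. unfold pdx. rewrite (Derive_ext _ (fun _ => 0)); [apply Derive_const|intros; apply H].
Qed.

Lemma pdy_zero (f : R -> R -> R) : (forall x y, f x y = 0) -> forall x y, pdy f x y = 0.
Proof.
  intros H x y. unfold pdy. rewrite (Derive_ext _ (fun _ => 0)); [apply Derive_const|intros; apply H].
Qed.

Lemma bO_comp_bound (g : R -> R -> R) (a b : nat) (C : R) (p r : R -> R) :
  (1 <= a)%nat -> 0 <= C -> (forall x y, Rabs x <= 1 -> Rabs (g x y) <= C * Rabs x ^ b) ->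
  bO a p -> bO (a * b) (fun e => g (p e) (r e)).
Proof.
  intros Ha HC Hg Hp.
  destruct (bO_1_small p (bO_weaken 1 a p Ha Hp)) as (D1 & e1 & HD1 & He1 & S1).
  destruct Hp as (C1 & d1 & HC1 & Hd1 & B1).
  exists (C * C1 ^ b), (Rmin d1 e1). pose proof (Rmin_l d1 e1). pose proof (Rmin_r d1 e1).
  split. { apply Rmult_le_pos; [exact HC|apply pow_le, HC1]. }
  split. { split; [apply Rmin_glb_lt; lra|lra]. }
  intros e He. destruct (S1 e ltac:(lra)) as [_ S2]. specialize (B1 e ltac:(lra)).
  apply Rle_trans with (1 := Hg _ _ S2).
  rewrite Rmult_assoc. apply Rmult_le_compat_l; [exact HC|].
  rewrite pow_mult, <- Rpow_mult_distr. apply pow_incr. split; [apply Rabs_pos|exact B1].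
Qed.

Section Formal.
Variables (q n : nat) (w0 nu : R) (F G : nat -> R -> R -> R).
Hypothesis (Hn : (1 <= n <= q)%nat) (HD : degenerate_system n w0 F G).

(** The coefficient sigma: minus the leading coefficient of the x-derivative of the
    y-equation along the approximate solution. *)
Definition restoring : R := 2 * w0 * nu - pdx (G n) 0 0.

(** The linear part along an approximate solution: the degenerate force - x^2 w(x)
    contributes - 2 w(0) nu e^n to the derivative of the y-equation in x, at the same
    order as the perturbation G_n. *)
Lemma jacobian_lead (K : nat) (p r : R -> R) :
  (n <= K)%nat -> lead n nu p -> bO n r ->
  bO n (fun e => trunc (fun k => pdx (F k)) K (p e) (r e) e) /\
  bO n (fun e => trunc (fun k => pdy (F k)) K (p e) (r e) e - 1) /\
  lead n (- restoring) (fun e => trunc (fun k => pdx (G k)) K (p e) (r e) e) /\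
  lead n (pdy (G n) 0 0) (fun e => trunc (fun k => pdy (G k)) K (p e) (r e) e).
Proof.
  intros HK Hp Hr.
  assert (Hp1 : bO 1 p) by (apply (bO_weaken 1 n); [lia|apply (lead_bO _ _ _ Hp)]).
  assert (Hr1 : bO 1 r) by (apply (bO_weaken 1 n); [lia|exact Hr]).
  destruct HD as [SF SG F0 FV GV GO (C & HC & G0)].
  assert (L := fun A h1 h2 => trunc_lead A n K p r h1 (proj1 Hn) h2 Hp1 Hr1 HK).
  repeat split.
  - apply (lead_bO n (pdx (F n) 0 0)).
    apply (bO_ext _ _ _ (fun e => eq_refl)).
    assert (L1 := L (fun k => pdx (F k)) (fun k => smooth2_pdx _ (SF k)) (fun k h => pdx_zero _ (FV k h))).
    revert L1. apply bO_ext. intros e.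
    replace (pdx (F O) (p e) (r e)) with 0; [ring|]. symmetry.
    unfold pdx. rewrite (Derive_ext _ (fun _ => r e)); [apply Derive_const|intros; apply F0].
  - apply (lead_bO n (pdy (F n) 0 0)).
    assert (L1 := L (fun k => pdy (F k)) (fun k => smooth2_pdy _ (SF k)) (fun k h => pdy_zero _ (FV k h))).
    revert L1. apply bO_ext. intros e.
    replace (pdy (F O) (p e) (r e)) with 1; [ring|]. symmetry.
    unfold pdy. rewrite (Derive_ext _ (fun v => v)); [apply Derive_id|intros; apply F0].
  - assert (L1 := L (fun k => pdx (G k)) (fun k => smooth2_pdx _ (SG k)) (fun k h => pdx_zero _ (GV k h))).
    assert (L2 : bO (n * 2) (fun e => pdx (G O) (p e) (r e) + 2 * w0 * p e)).
    { apply (bO_comp_bound (fun x y => pdx (G O) x y + 2 * w0 * x) n 2 C p r (proj1 Hn) HC);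
        [intros x y Hx; apply (G0 x y Hx)|apply (lead_bO _ _ _ Hp)]. }
    apply (bO_ext _ (fun e => (trunc (fun k => pdx (G k)) K (p e) (r e) e - pdx (G O) (p e) (r e) - pdx (G n) 0 0 * e ^ n)
       + (pdx (G O) (p e) (r e) + 2 * w0 * p e) - 2 * w0 * (p e - nu * e ^ n))).
    { intros e. unfold restoring. ring. }
    apply bO_minus; [apply bO_plus; [exact L1|apply (bO_weaken _ (n * 2)); [lia|exact L2]]|apply bO_scal, Hp].
  - assert (L1 := L (fun k => pdy (G k)) (fun k => smooth2_pdy _ (SG k)) (fun k h => pdy_zero _ (GV k h))).
    destruct (bO_1_small p Hp1) as (D1 & e1 & HD1 & He1 & S1).
    destruct L1 as (C1 & d1 & HC1 & Hd1 & B1).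
    exists C1, (Rmin d1 e1). pose proof (Rmin_l d1 e1). pose proof (Rmin_r d1 e1).
    split; [exact HC1|]. split. { split; [apply Rmin_glb_lt; lra|lra]. }
    intros e He. specialize (B1 e ltac:(lra)). destruct (S1 e ltac:(lra)) as [_ S2].
    rewrite (proj2 (proj2 (G0 (p e) (r e) S2))), Rminus_0_r in B1. exact B1.
Qed.

(** The defect of (x, y) = (p, r) in one of the equations, as a function of
    e = t^(-1/q); z is p or r, and dz/dt = -(1/q) e^(q+1) dz/de. *)
Definition residual (A : nat -> R -> R -> R) (K : nat) (p r z : R -> R) (e : R) : R :=
  - / INR q * e ^ (q + 1) * Derive z e - trunc A K (p e) (r e) e.

Lemma smooth1_residual (A : nat -> R -> R -> R) (K : nat) (p r z : R -> R) :
  (forall k, smooth2 (A k)) -> smooth1 p -> smooth1 r -> smooth1 z -> smooth1 (residual A K p r z).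
Proof.
  intros HA Hp Hr Hz. apply (smooth1_minus (fun e => - / INR q * e ^ (q + 1) * Derive z e)).
  - apply smooth1_mult; [apply smooth1_scal, smooth1_pow|apply smooth1_Derive, Hz].
  - apply smooth1_trunc; assumption.
Qed.

Lemma residual_raise (A : nat -> R -> R -> R) (K K' m : nat) (p r z : R -> R) :
  (forall k, smooth2 (A k)) -> bO 1 p -> bO 1 r -> (K <= K')%nat -> (m <= S K)%nat ->
  bO m (residual A K p r z) -> bO m (residual A K' p r z).
Proof.
  intros HA Hp Hr HK Hm H. induction HK as [|K' HK IH]; [exact H|].
  apply (bO_ext _ (fun e => residual A K' p r z e - e ^ S K' * A (S K') (p e) (r e))).
  { intros e. unfold residual. cbn [trunc]. ring. }
  apply bO_minus; [exact IH|]. apply (bO_weaken _ (S K' + 0)); [lia|].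
  apply bO_mult; [apply bO_pow|apply bO_0_comp_smooth2; auto].
Qed.

(** The residual of the y-equation is required to be smaller by e^n than that of the
    x-equation, because the coefficient x_j enters the y-equation only at order
    e^(j+n). *)
Definition good_to_order (j : nat) (p r : R -> R) : Prop :=
  smooth1 p /\ smooth1 r /\ lead n nu p /\ bO n r /\
  bO (S j) (residual F (j + n) p r p) /\ bO (S (j + n)) (residual G (j + n) p r r).

Lemma Derive_add_pow (z : R -> R) (c : R) (j : nat) (e : R) :
  smooth1 z -> Derive (fun e => z e + c * e ^ S j) e = Derive z e + c * (INR (S j) * e ^ j).
Proof.
  intros Hz. apply is_derive_unique. apply (is_derive_plus z (fun e => c * e ^ S j)).
  - apply Derive_correct, smooth1_ex_derive, Hz.
  - apply (is_derive_scal (fun e => e ^ S j)). evar_last.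
    + apply (is_derive_pow (fun e => e) (S j)). apply is_derive_id.
    + change one with 1. simpl pred. ring.
Qed.

(** The time derivative of y_n e^n is of order e^(n+q); it reaches the order e^(2n) of
    the leading balance exactly when n = q. *)
Definition resonance : R := if Nat.eqb n q then 1 else 0.

Lemma resonance_pow (j : nat) : bO (S (n + j)) (fun e => e ^ (q + j) - resonance * e ^ (n + j)).
Proof.
  unfold resonance. destruct (Nat.eqb_spec n q) as [E|E].
  - rewrite E. apply bO_zero. intros e. ring.
  - apply (bO_ext _ (fun e => e ^ (q + j))); [intros e; ring|].
    apply (bO_weaken _ (q + j)); [lia|apply bO_pow].
Qed.

(** At order j + 1 the x-equation determines d and, as the restoring coefficient
    does not vanish, the y-equation determines c. *)
Lemma formal_step (j : nat) (p r : R -> R) :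
  restoring <> 0 -> (n <= j)%nat -> good_to_order j p r ->
  exists c d, good_to_order (S j) (fun e => p e + c * e ^ S j) (fun e => r e + d * e ^ S j).
Proof.
  intros Hrest Hj (Sp & Sr & Lp & Br & BX & BY).
  destruct HD as [SF SG F0 FV GV GO G0].
  assert (Hp1 : bO 1 p) by (apply (bO_weaken 1 n); [lia|apply (lead_bO _ _ _ Lp)]).
  assert (Hr1 : bO 1 r) by (apply (bO_weaken 1 n); [lia|exact Br]).
  apply (residual_raise F (j + n) (S j + n)) in BX; try assumption; try lia.
  apply (residual_raise G (j + n) (S j + n)) in BY; try assumption; try lia.
  set (K := (S j + n)%nat) in *.
  destruct (smooth1_lead (S j) _ (smooth1_residual F K p r p SF Sp Sr Sp) BX) as (xi & LX).
  destruct (smooth1_lead (S (j + n)) _ (smooth1_residual G K p r r SG Sp Sr Sr) BY) as (eta & LY).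
  destruct (jacobian_lead K p r ltac:(unfold K; lia) Lp Br) as (J1 & J2 & J3 & J4).
  assert (Hq0 : INR q <> 0) by (apply not_0_INR; lia).
  set (d := xi).
  set (c := (pdy (G n) 0 0 * d + resonance * (INR (S j) / INR q) * d - eta) / restoring).
  assert (Hc : eta - resonance * (INR (S j) / INR q) * d + restoring * c - pdy (G n) 0 0 * d = 0)
    by (unfold c; field; split; [exact Hq0|exact Hrest]).
  exists c, d.
  assert (Sp' : smooth1 (fun e => p e + c * e ^ S j)) by (apply smooth1_plus; [exact Sp|apply smooth1_scal, smooth1_pow]).
  assert (Sr' : smooth1 (fun e => r e + d * e ^ S j)) by (apply smooth1_plus; [exact Sr|apply smooth1_scal, smooth1_pow]).
  assert (Lp' : lead n nu (fun e => p e + c * e ^ S j)).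
  { apply (bO_ext _ (fun e => (p e - nu * e ^ n) + c * e ^ S j)); [intros e; ring|].
    apply bO_plus; [exact Lp|apply bO_scal_pow; lia]. }
  assert (Br' : bO n (fun e => r e + d * e ^ S j)).
  { apply bO_plus; [exact Br|apply bO_scal_pow; lia]. }
  assert (Hp1' : bO 1 (fun e => p e + c * e ^ S j)) by (apply (bO_weaken 1 n); [lia|apply (lead_bO _ _ _ Lp')]).
  assert (Hr1' : bO 1 (fun e => r e + d * e ^ S j)) by (apply (bO_weaken 1 n); [lia|exact Br']).
  assert (IF := trunc_increment F K j p r c d SF ltac:(unfold K; lia) Hp1 Hr1).
  assert (IG := trunc_increment G K j p r c d SG ltac:(unfold K; lia) Hp1 Hr1).
  split; [exact Sp'|]. split; [exact Sr'|]. split; [exact Lp'|]. split; [exact Br'|].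
  split.
  - match type of IF with bO _ ?rem => set (rm := rem) in IF end.
    apply (bO_ext _ (fun e => (residual F K p r p e - xi * e ^ S j)
       + (- / INR q * c * INR (S j)) * e ^ (q + 1 + j)
       - (trunc (fun k => pdx (F k)) K (p e) (r e) e) * (c * e ^ S j)
       - (trunc (fun k => pdy (F k)) K (p e) (r e) e - 1) * (d * e ^ S j) - rm e)).
    { intros e. unfold rm, residual. rewrite (Derive_add_pow p c j e Sp). unfold d.
      rewrite !pow_add. simpl pow. fold K. ring. }
    apply bO_minus; [apply bO_minus; [apply bO_minus; [apply bO_plus|]|]|].
    + exact LX.
    + apply bO_scal_pow. lia.
    + apply (bO_weaken _ (n + S j)); [lia|]. apply bO_mult; [exact J1|apply bO_scal_pow; lia].
    + apply (bO_weaken _ (n + S j)); [lia|]. apply bO_mult; [exact J2|apply bO_scal_pow; lia].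
    + apply (bO_weaken _ (2 * S j)); [lia|exact IF].
  - match type of IG with bO _ ?rem => set (rm := rem) in IG end.
    replace (S (S j + n)) with (S (n + S j)) by lia.
    apply (bO_ext _ (fun e => (residual G K p r r e - eta * e ^ S (j + n))
       + (- (INR (S j) / INR q) * d) * (e ^ (q + S j) - resonance * e ^ (n + S j))
       - (trunc (fun k => pdx (G k)) K (p e) (r e) e - - restoring * e ^ n) * (c * e ^ S j)
       - (trunc (fun k => pdy (G k)) K (p e) (r e) e - pdy (G n) 0 0 * e ^ n) * (d * e ^ S j) - rm e)).
    { intros e. unfold rm, residual. rewrite (Derive_add_pow r d j e Sr).
      match goal with |- ?l = ?r => assert (E : l - r = (eta * (-1) + resonance * (INR (S j) / INR q) * d - restoring * c
        + pdy (G n) 0 0 * d) * (e ^ n * e ^ S j)) end.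
      { fold K. replace (S (j + n)) with (n + S j)%nat by lia. rewrite !pow_add. simpl pow. field. exact Hq0. }
      replace (eta * (-1) + resonance * (INR (S j) / INR q) * d - restoring * c + pdy (G n) 0 0 * d) with 0 in E
        by lra. lra. }
    apply bO_minus; [apply bO_minus; [apply bO_minus; [apply bO_plus|]|]|].
    + replace (S (n + S j)) with (S (S (j + n))) by lia. exact LY.
    + apply bO_scal. apply resonance_pow.
    + apply (bO_weaken _ (S n + S j)); [lia|]. apply bO_mult; [exact J3|apply bO_scal_pow; lia].
    + apply (bO_weaken _ (S n + S j)); [lia|]. apply bO_mult; [exact J4|apply bO_scal_pow; lia].
    + apply (bO_weaken _ (2 * S j)); [lia|exact IG].
Qed.

(** At order e^(2n), G_n contributes through its first derivatives, as it vanishes at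
    the origin, and G_(2n) through its value; the terms in between vanish at the
    origin and are of higher order. *)
Lemma trunc_G_second_order (K : nat) (p r : R -> R) (be : R) :
  lead n nu p -> lead n be r ->
  bO (S (2 * n)) (fun e => trunc G K (p e) (r e) e - G O (p e) (r e)
    - ((if (n <=? K)%nat then pdx (G n) 0 0 * nu + pdy (G n) 0 0 * be else 0)
       + (if (2 * n <=? K)%nat then G (2 * n)%nat 0 0 else 0)) * e ^ (2 * n)).
Proof.
  intros Lp Lr.
  destruct HD as [SF SG F0 FV GV GO G0].
  pose proof (lead_bO _ _ _ Lp) as Hp. pose proof (lead_bO _ _ _ Lr) as Hr.
  assert (Hp1 : bO 1 p) by (apply (bO_weaken 1 n); [lia|exact Hp]).
  assert (Hr1 : bO 1 r) by (apply (bO_weaken 1 n); [lia|exact Hr]).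
  induction K as [|K IH].
  - leb_cases.
    apply bO_zero. intros e. cbn [trunc]. ring.
  - match type of IH with bO _ ?g => set (g0 := g) in IH end.
    destruct (Nat.lt_total (S K) n) as [H|[H|H]].
    + apply (bO_ext _ g0); [|exact IH]. intros e. unfold g0. cbn [trunc]. rewrite (GV (S K) ltac:(lia)).
      leb_cases. ring.
    + apply (bO_ext _ (fun e => g0 e + e ^ n * ((G n (p e) (r e) - pdx (G n) 0 0 * p e - pdy (G n) 0 0 * r e)
         + pdx (G n) 0 0 * (p e - nu * e ^ n) + pdy (G n) 0 0 * (r e - be * e ^ n)))).
      { intros e. unfold g0. cbn [trunc]. rewrite <- H.
        leb_cases.
        replace (2 * S K)%nat with (S K + S K)%nat by lia. rewrite pow_add. ring. }
      apply bO_plus; [exact IH|]. replace (S (2 * n)) with (n + S n)%nat by lia.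
      apply bO_mult; [apply bO_pow|]. apply bO_plus; [apply bO_plus|apply bO_scal, Lr]; [|apply bO_scal, Lp].
      destruct (smooth2_linearization (G n) 1 (SG n)) as (L & HL0 & HB).
      destruct (bO_1_small p Hp1) as (D1 & e1 & HD1 & He1 & S1).
      destruct (bO_1_small r Hr1) as (D2 & e2 & HD2 & He2 & S2).
      destruct Hp as (C1 & d1 & HC1 & Hd1 & B1). destruct Hr as (C2 & d2 & HC2 & Hd2 & B2).
      pose proof (Rmin_l (Rmin d1 d2) (Rmin e1 e2)). pose proof (Rmin_r (Rmin d1 d2) (Rmin e1 e2)).
      pose proof (Rmin_l d1 d2). pose proof (Rmin_r d1 d2). pose proof (Rmin_l e1 e2). pose proof (Rmin_r e1 e2).
      exists (L * (C1 + C2) * (C1 + C2)), (Rmin (Rmin d1 d2) (Rmin e1 e2)).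
      split; [repeat apply Rmult_le_pos; lra|].
      split. { split; [apply Rmin_glb_lt; apply Rmin_glb_lt; lra|lra]. }
      intros e He. specialize (B1 e ltac:(lra)). specialize (B2 e ltac:(lra)).
      destruct (S1 e ltac:(lra)) as [_ P2]. destruct (S2 e ltac:(lra)) as [_ R2].
      assert (Hz : Rabs 0 <= 1) by (rewrite Rabs_R0; lra).
      specialize (HB 0 0 (p e) (r e) 0 0 Hz Hz P2 R2 Hz Hz).
      rewrite !Rminus_0_r, (GO n ltac:(lia)), !Rminus_0_r, Rabs_R0, !Rplus_0_r in HB.
      apply Rle_trans with (1 := HB).
      assert (Hpn : 0 <= e ^ n) by (apply pow_le; lra).
      assert (Hpn2 : e ^ n * e ^ n <= e ^ S n).
      { rewrite <- pow_add. apply pow_le_pow_small; [lra|lia]. }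
      pose proof (Rabs_pos (p e)). pose proof (Rabs_pos (r e)).
      apply Rle_trans with (L * ((C1 + C2) * e ^ n) * ((C1 + C2) * e ^ n)).
      * apply Rmult_le_compat; [apply Rmult_le_pos; lra|lra| |lra]. apply Rmult_le_compat_l; lra.
      * replace (L * ((C1 + C2) * e ^ n) * ((C1 + C2) * e ^ n)) with (L * (C1 + C2) * (C1 + C2) * (e ^ n * e ^ n)) by ring.
        apply Rmult_le_compat_l; [repeat apply Rmult_le_pos; lra|exact Hpn2].
    + destruct (Nat.lt_total (S K) (2 * n)) as [H'|[H'|H']].
      * apply (bO_ext _ (fun e => g0 e + e ^ S K * (G (S K) (p e) (r e) - G (S K) 0 0))).
        { intros e. unfold g0. cbn [trunc]. rewrite (GO (S K) ltac:(lia)).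
          leb_cases. ring. }
        apply bO_plus; [exact IH|]. apply (bO_weaken _ (S K + n)); [lia|].
        apply bO_mult; [apply bO_pow|apply bO_comp_smooth2; auto; lia].
      * apply (bO_ext _ (fun e => g0 e + e ^ S K * (G (S K) (p e) (r e) - G (S K) 0 0))).
        { intros e. unfold g0. cbn [trunc]. rewrite <- H'.
          leb_cases. ring. }
        apply bO_plus; [exact IH|]. apply (bO_weaken _ (S K + n)); [lia|].
        apply bO_mult; [apply bO_pow|apply bO_comp_smooth2; auto; lia].
      * apply (bO_ext _ (fun e => g0 e + e ^ S K * (G (S K) (p e) (r e)))).
        { intros e. unfold g0. cbn [trunc].
          leb_cases. ring. }
        apply bO_plus; [exact IH|]. apply (bO_weaken _ (S K + 0)); [lia|].
        apply bO_mult; [apply bO_pow|apply bO_0_comp_smooth2; auto].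
Qed.

(** The equation for nu is the balance of the terms of order e^(2n) in the
    y-equation. *)
Lemma formal_base :
  w0 * nu ^ 2 - pdx (G n) 0 0 * nu - G (2 * n)%nat 0 0 + (pdy (G n) 0 0 + resonance) * F n 0 0 = 0 ->
  good_to_order n (fun e => nu * e ^ n) (fun e => - F n 0 0 * e ^ n).
Proof.
  intros Hnu.
  set (be := - F n 0 0). set (p := fun e => nu * e ^ n). set (r := fun e => be * e ^ n).
  destruct HD as [SF SG F0 FV GV GO (C & HC & G0)].
  assert (Sp : smooth1 p) by apply smooth1_scal, smooth1_pow.
  assert (Sr : smooth1 r) by apply smooth1_scal, smooth1_pow.
  assert (Lp : lead n nu p) by (apply bO_zero; intros e; unfold p; ring).
  assert (Lr : lead n be r) by (apply bO_zero; intros e; unfold r; ring).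
  pose proof (lead_bO _ _ _ Lp) as Hp. pose proof (lead_bO _ _ _ Lr) as Hr.
  assert (Hp1 : bO 1 p) by (apply (bO_weaken 1 n); [lia|exact Hp]).
  assert (Hr1 : bO 1 r) by (apply (bO_weaken 1 n); [lia|exact Hr]).
  split; [exact Sp|]. split; [exact Sr|]. split; [exact Lp|]. split; [exact Hr|].
  assert (Hq0 : INR q <> 0) by (apply not_0_INR; lia).
  assert (EDz : forall c e, Derive (fun e => c * e ^ n) e = c * (INR n * e ^ pred n)).
  { intros c e. apply is_derive_unique. apply (is_derive_scal (fun e => e ^ n)). evar_last.
    - apply (is_derive_pow (fun e => e) n). apply is_derive_id.
    - change one with 1. ring. }
  assert (Epow : forall e, e ^ (q + 1) * e ^ pred n = e ^ (q + n)).
  { intros e. rewrite <- pow_add. f_equal. lia. }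
  split.
  - assert (LF := trunc_lead F n (n + n) p r SF (proj1 Hn) FV Hp1 Hr1 ltac:(lia)).
    apply (bO_ext _ (fun e => (- / INR q * nu * INR n) * e ^ (q + n)
       - (trunc F (n + n) (p e) (r e) e - F O (p e) (r e) - F n 0 0 * e ^ n))).
    { intros e. unfold residual. change (Derive p e) with (Derive (fun e => nu * e ^ n) e).
      rewrite EDz, <- Epow, F0. unfold r at 2. unfold be. ring. }
    apply bO_minus; [apply bO_scal_pow; lia|exact LF].
  - assert (LG := trunc_G_second_order (n + n) p r be Lp Lr).
    replace (2 * n)%nat with (n + n)%nat in LG by lia.
    destruct (Nat.leb_spec n (n + n)) as [_|]; [|lia]. rewrite Nat.leb_refl in LG.
    match type of LG with bO _ ?g => set (g0 := g) in LG end.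
    assert (L0 : bO (n * 3) (fun e => G O (p e) (r e) + w0 * p e ^ 2)).
    { apply (bO_comp_bound (fun x y => G O x y + w0 * x ^ 2) n 3 C p r (proj1 Hn) HC); [|exact Hp].
      intros x y Hx. apply (G0 x y Hx). }
    apply (bO_ext _ (fun e => (- (INR n / INR q) * be) * (e ^ (q + n) - resonance * e ^ (n + n))
       - g0 e - (G O (p e) (r e) + w0 * p e ^ 2))).
    { intros e. unfold residual. change (Derive r e) with (Derive (fun e => be * e ^ n) e).
      rewrite EDz. unfold g0.
      replace (- / INR q * e ^ (q + 1) * (be * (INR n * e ^ pred n))) with (- (INR n / INR q) * be * (e ^ (q + 1) * e ^ pred n))
        by (field; exact Hq0).
      rewrite Epow.
      replace (2 * n)%nat with (n + n)%nat in Hnu by lia.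
      assert (Hres : resonance * (INR n / INR q) = resonance).
      { unfold resonance. destruct (Nat.eqb_spec n q) as [E|E]; [rewrite E; field; exact Hq0|ring]. }
      match goal with |- ?l = ?r => assert (E : l - r = (resonance * (INR n / INR q) * be + pdx (G n) 0 0 * nu + pdy (G n) 0 0 * be
        + G (n + n)%nat 0 0 - w0 * nu ^ 2) * e ^ (n + n)) end.
      { rewrite !pow_add. unfold p. ring. }
      rewrite Hres in E.
      replace (resonance * be + pdx (G n) 0 0 * nu + pdy (G n) 0 0 * be + G (n + n)%nat 0 0 - w0 * nu ^ 2) with 0 in E
        by (unfold be; lra). lra. }
    apply bO_minus; [apply bO_minus; [apply bO_scal, resonance_pow|exact LG]|].
    apply (bO_weaken _ (n * 3)); [lia|exact L0].
Qed.

End Formal.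

(** * The formal series, and the linear part along it *)

Definition pol (n : nat) (a : nat -> R) (N : nat) (e : R) : R :=
  sum_n_m (fun k => e ^ k * a k) n N.

Lemma pol_S (n : nat) (a : nat -> R) (N : nat) (e : R) :
  (n <= S N)%nat -> pol n a (S N) e = pol n a N e + a (S N) * e ^ S N.
Proof.
  intros H. unfold pol. rewrite sum_n_Sm by exact H. change plus with Rplus. ring.
Qed.

Lemma pol_n (n : nat) (a : nat -> R) (e : R) : pol n a n e = a n * e ^ n.
Proof. unfold pol. rewrite sum_n_n. ring. Qed.

Lemma bO_pol_diff (n N M : nat) (a : nat -> R) :
  (n <= N <= M)%nat -> bO (S N) (fun e => pol n a M e - pol n a N e).
Proof.
  intros [Hn HM]. induction HM as [|M HM IH].
  - apply bO_zero. intros e. ring.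
  - apply (bO_ext _ (fun e => (pol n a M e - pol n a N e) + a (S M) * e ^ S M)).
    + intros e. rewrite (pol_S n a M) by lia. ring.
    + apply bO_plus; [exact IH|apply bO_scal_pow; lia].
Qed.

Section Series.
Variables (q n : nat) (w0 nu : R) (F G : nat -> R -> R -> R).

(** The formal solution as a sequence of polynomials; step j chooses the coefficients
    of order j + 1 for a given pair of polynomials. *)
Fixpoint approximants (step : nat -> (R -> R) * (R -> R) -> R * R) (i : nat) : (R -> R) * (R -> R) :=
  match i with
  | O => (fun e => nu * e ^ n, fun e => - F n 0 0 * e ^ n)
  | S i' => let w := approximants step i' in let cd := step (n + i')%nat w in
      (fun e => fst w e + fst cd * e ^ S (n + i'), fun e => snd w e + snd cd * e ^ S (n + i'))
  end.

Lemma formal_series :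
  (1 <= n <= q)%nat -> degenerate_system n w0 F G -> restoring n w0 nu G <> 0 ->
  w0 * nu ^ 2 - pdx (G n) 0 0 * nu - G (2 * n)%nat 0 0 + (pdy (G n) 0 0 + resonance q n) * F n 0 0 = 0 ->
  exists a b : nat -> R, a n = nu /\
    forall N, (n <= N)%nat -> good_to_order q n nu F G N (pol n a N) (pol n b N).
Proof.
  intros Hn HD Hr Hnu.
  assert (HS : forall jw : nat * ((R -> R) * (R -> R)), exists cd : R * R,
     (n <= fst jw)%nat -> good_to_order q n nu F G (fst jw) (fst (snd jw)) (snd (snd jw)) ->
     good_to_order q n nu F G (S (fst jw)) (fun e => fst (snd jw) e + fst cd * e ^ S (fst jw))
       (fun e => snd (snd jw) e + snd cd * e ^ S (fst jw))).
  { intros [j [p r]]. simpl fst. simpl snd.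
    destruct (classic ((n <= j)%nat /\ good_to_order q n nu F G j p r)) as [[H1 H2]|H].
    - destruct (formal_step q n w0 nu F G Hn HD j p r Hr H1 H2) as (c & d & Hcd).
      exists (c, d). intros _ _. exact Hcd.
    - exists (0, 0). intros H1 H2. exfalso. auto. }
  set (step := fun j w => proj1_sig (constructive_indefinite_description _ (HS (j, w)))).
  assert (Hstep : forall j p r, (n <= j)%nat -> good_to_order q n nu F G j p r ->
     good_to_order q n nu F G (S j) (fun e => p e + fst (step j (p, r)) * e ^ S j)
       (fun e => r e + snd (step j (p, r)) * e ^ S j)).
  { intros j p r H1 H2. unfold step.
    apply (proj2_sig (constructive_indefinite_description _ (HS (j, (p, r)))) H1 H2). }
  set (st := approximants step).
  assert (Hst : forall i, good_to_order q n nu F G (n + i) (fst (st i)) (snd (st i))).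
  { induction i as [|i IH].
    - rewrite Nat.add_0_r. apply (formal_base q n w0); assumption.
    - rewrite Nat.add_succ_r. unfold st. cbn [approximants]. fold st. cbn [fst snd].
      rewrite (surjective_pairing (st i)). cbn [fst snd]. apply Hstep; [lia|exact IH]. }
  exists (fun k => if (k <=? n)%nat then nu else fst (step (k - 1)%nat (st (k - 1 - n)%nat))).
  exists (fun k => if (k <=? n)%nat then - F n 0 0 else snd (step (k - 1)%nat (st (k - 1 - n)%nat))).
  split. { rewrite Nat.leb_refl. reflexivity. }
  intros N HN.
  match goal with |- good_to_order _ _ _ _ _ _ (pol n ?a _) (pol n ?b _) => set (a0 := a); set (b0 := b) end.
  assert (Hp : forall i e, pol n a0 (n + i) e = fst (st i) e /\ pol n b0 (n + i) e = snd (st i) e).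
  { induction i as [|i IH]; intros e.
    - rewrite Nat.add_0_r, !pol_n. unfold a0, b0. rewrite Nat.leb_refl. split; reflexivity.
    - rewrite Nat.add_succ_r, !pol_S by lia. destruct (IH e) as [-> ->].
      unfold a0, b0. destruct (Nat.leb_spec (S (n + i)) n); [lia|].
      replace (S (n + i) - 1)%nat with (n + i)%nat by lia. replace (n + i - n)%nat with i by lia.
      split; reflexivity. }
  replace N with (n + (N - n))%nat by lia.
  replace (pol n a0 (n + (N - n))) with (fst (st (N - n)%nat)) by (apply functional_extensionality; intros e; symmetry; apply Hp).
  replace (pol n b0 (n + (N - n))) with (snd (st (N - n)%nat)) by (apply functional_extensionality; intros e; symmetry; apply Hp).
  apply Hst.
Qed.
End Series.

(** * From e -> 0+ to t -> oo *)

Lemma bO_at_infinity (q m : nat) (f : R -> R) :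
  (0 < q)%nat -> bO m f -> exists C, 0 <= C /\ at_infinity (fun t => Rabs (f (tpow q 1 t)) <= C * tpow q m t).
Proof.
  intros Hq (C & d & HC & Hd & H). exists C. split; [exact HC|].
  apply (at_infinity_imp (fun t => tpow q 1 t <= d)); [|apply tpow_small; lia || lra].
  intros t Ht. rewrite (tpow_pow q m). apply H. split; [apply tpow_pos|exact Ht].
Qed.

Lemma tpow_absorb (q j k : nat) (C eps : R) :
  (0 < q)%nat -> (j < k)%nat -> 0 < eps -> at_infinity (fun t => C * tpow q k t <= eps * tpow q j t).
Proof.
  intros Hq Hjk He.
  assert (HC : 0 < Rabs C + 1) by (pose proof (Rabs_pos C); lra).
  apply (at_infinity_imp (fun t => tpow q (k - j) t <= eps / (Rabs C + 1))).
  - intros t Ht. replace k with (j + (k - j))%nat by lia. rewrite tpow_add.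
    pose proof (tpow_pos q j t). pose proof (tpow_pos q (k - j) t). pose proof (Rle_abs C).
    apply Rmult_le_compat_l with (r := Rabs C + 1) in Ht; [|lra].
    replace ((Rabs C + 1) * (eps / (Rabs C + 1))) with eps in Ht by (field; lra).
    set (w := tpow q (k - j) t) in *. assert (C * w <= eps) by nra.
    replace (C * (tpow q j t * w)) with (C * w * tpow q j t) by ring. apply Rmult_le_compat_r; lra.
  - apply tpow_small; [exact Hq|lia|apply Rdiv_lt_0_compat; lra].
Qed.

Lemma is_derive_eps_comp (q : nat) (f : R -> R) (t : R) :
  (0 < q)%nat -> 0 < t -> smooth1 f ->
  is_derive (fun t => f (tpow q 1 t)) t (- / INR q * tpow q 1 t ^ (q + 1) * Derive f (tpow q 1 t)).
Proof.
  intros Hq Ht Hf. evar_last.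
  - apply (is_derive_comp f (tpow q 1)).
    + apply Derive_correct, smooth1_ex_derive, Hf.
    + apply is_derive_tpow, Ht.
  - rewrite <- tpow_pow, tpow_add, (tpow_base q t) by assumption.
    unfold scal; simpl. unfold mult; simpl. unfold Rdiv. ring.
Qed.

Lemma tpow_le_rate (q n : nat) (kap C eta : R) :
  (1 <= n <= q)%nat -> 0 < kap -> 0 < eta -> at_infinity (fun t => C * tpow q n t <= eta * rate q n kap t).
Proof.
  intros Hn Hk He. pose proof (sqrt_lt_R0 kap Hk) as Hs.
  apply (at_infinity_imp (fun t => C * tpow (2 * q) (2 * n) t <= eta * sqrt kap * tpow (2 * q) n t)).
  - intros t Ht. rewrite <- tpow_half by lia. rewrite <- tpow_mul2. unfold rate. lra.
  - apply tpow_absorb; [lia|lia|apply Rmult_lt_0_compat; assumption].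
Qed.

Lemma leading_term_or_bO (f : R -> R) (N : nat) :
  smooth1 f -> bO N f \/ exists m eta, (m < N)%nat /\ eta <> 0 /\ lead m eta f.
Proof.
  intros Hf. induction N as [|N IH]; [left; apply smooth1_bO_0, Hf|].
  destruct IH as [H|(m & eta & Hm & He & H)].
  - destruct (smooth1_lead N f Hf H) as (eta & HL).
    destruct (Req_dec eta 0) as [E|E].
    + left. subst eta. apply (bO_ext _ (fun e => f e - 0 * e ^ N)); [intros e; ring|exact HL].
    + right. exists N, eta. auto.
  - right. exists m, eta. auto.
Qed.

(** Only the leading term of f below the order e^q = 1/t matters: if there is none, f is
    O(1/t); otherwise the term outweighs 1/t and its sign decides. *)
Lemma trace_alternative (q : nat) (f : R -> R) :
  (0 < q)%nat -> smooth1 f ->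
  (exists C0, at_infinity (fun t => - C0 * / t <= f (tpow q 1 t))) \/
  (forall K, at_infinity (fun t => f (tpow q 1 t) <= - K * / t)).
Proof.
  intros Hq Sf.
  destruct (leading_term_or_bO f q Sf) as [HB|(m & eta & Hm & Heta & HL)].
  - left. destruct (bO_at_infinity q q _ Hq HB) as (C0 & HC0 & HT). exists C0.
    apply (at_infinity_imp _ _) with (2 := at_infinity_and _ _ HT (at_infinity_ge 1)).
    intros t [H1 H2]. rewrite tpow_base in H1 by (lia || lra). apply Rabs_le_between in H1. lra.
  - destruct (bO_at_infinity q (S m) _ Hq HL) as (C1 & HC1 & HT).
    destruct (Rlt_dec 0 eta) as [Hp|Hnp].
    + left. exists 0.
      apply (at_infinity_imp _ _) with (2 := at_infinity_and _ _ HT (tpow_absorb q m (S m) C1 eta Hq ltac:(lia) Hp)).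
      intros t [H1 H2]. rewrite <- tpow_pow in H1. apply Rabs_le_between in H1. lra.
    + right. intros K.
      apply (at_infinity_imp _ _) with (2 := at_infinity_and _ _
        (at_infinity_and _ _ HT (tpow_absorb q m (S m) C1 (- eta / 2) Hq ltac:(lia) ltac:(lra)))
        (at_infinity_and _ _ (tpow_absorb q m q K (- eta / 2) Hq Hm ltac:(lra)) (at_infinity_ge 1))).
      intros t [[H1 H2] [H3 H4]]. rewrite <- tpow_pow in H1. rewrite tpow_base in H3 by (lia || lra).
      apply Rabs_le_between in H1. lra.
Qed.

Lemma slow_coefficient (q n : nat) (f : R -> R) :
  (1 <= n <= q)%nat -> smooth1 f -> bO (pred n) (Derive f) -> exists C, 0 <= C /\ at_infinity (fun t =>
    is_derive (fun t => f (tpow q 1 t)) t (- / INR q * tpow q 1 t ^ (q + 1) * Derive f (tpow q 1 t)) /\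
    Rabs (- / INR q * tpow q 1 t ^ (q + 1) * Derive f (tpow q 1 t)) <= C * tpow q n t * / t).
Proof.
  intros Hn Sf Bf. assert (Hq : (0 < q)%nat) by lia.
  destruct (bO_at_infinity q (pred n) _ Hq Bf) as (C & HC & HI).
  assert (Hqi : 0 < / INR q) by (apply Rinv_0_lt_compat, lt_0_INR; lia).
  exists (/ INR q * C). split; [apply Rmult_le_pos; lra|].
  apply (at_infinity_imp _ _) with (2 := at_infinity_and _ _ HI (at_infinity_ge 1)).
  intros t [H1 H2]. split; [apply is_derive_eps_comp; lia || lra || assumption|].
  pose proof (tpow_pos q 1 t) as Pe.
  assert (Pq : 0 < tpow q 1 t ^ (q + 1)) by (apply pow_lt; exact Pe).
  rewrite !Rabs_mult, Rabs_Ropp, (Rabs_pos_eq (/ INR q)), (Rabs_pos_eq (tpow q 1 t ^ (q + 1))) by lra.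
  replace (/ INR q * C * tpow q n t * / t) with (/ INR q * tpow q 1 t ^ (q + 1) * (C * tpow q (pred n) t)).
  - apply Rmult_le_compat_l; [apply Rmult_le_pos; lra|exact H1].
  - rewrite <- (tpow_base q t) by (lia || lra). rewrite <- tpow_pow, (tpow_add q q 1).
    assert (En : tpow q n t = tpow q 1 t * tpow q (pred n) t) by (rewrite <- tpow_add; f_equal; lia).
    rewrite En. ring.
Qed.

Lemma coefficient_sizes (q n : nat) (kap sig : R) (a b c d : R -> R) :
  (1 <= n <= q)%nat -> 0 < kap ->
  bO n a -> bO n (fun e => b e - 1) -> lead n sig c -> bO n d ->
  forall eta, 0 < eta -> at_infinity (fun t =>
    let s := rate q n kap t in let e := tpow q 1 t in
    Rabs (a e) <= eta * s /\ Rabs (d e) <= eta * s /\ Rabs (b e - 1) <= eta /\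
    Rabs (c e - sig * tpow q n t) <= eta * s ^ 2).
Proof.
  intros Hn Hk Ba Bb Lc Bd eta He. assert (Hq : (0 < q)%nat) by lia.
  destruct (bO_at_infinity q n a Hq Ba) as (Ca & _ & Ha).
  destruct (bO_at_infinity q n _ Hq Bb) as (Cb & _ & Hb).
  destruct (bO_at_infinity q n d Hq Bd) as (Cd & _ & Hd).
  destruct (bO_at_infinity q (S n) _ Hq Lc) as (Cc & _ & Hc).
  apply (at_infinity_imp _ _) with (2 := at_infinity_and _ _
    (at_infinity_and _ _ (at_infinity_and _ _ Ha Hb) (at_infinity_and _ _ Hd Hc))
    (at_infinity_and _ _
      (at_infinity_and _ _ (tpow_le_rate q n kap Ca eta Hn Hk He) (tpow_le_rate q n kap Cd eta Hn Hk He))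
      (at_infinity_and _ _ (tpow_absorb q 0 n Cb eta Hq ltac:(lia) He)
        (tpow_absorb q n (S n) Cc (eta * kap) Hq ltac:(lia) ltac:(apply Rmult_lt_0_compat; assumption))))).
  intros t (((H1 & H2) & (H3 & H4)) & (H5 & H6) & (H7 & H8)). cbv zeta.
  rewrite tpow_0 in H7. rewrite <- tpow_pow in H4. rewrite (rate_sqr q n kap t Hq Hk).
  repeat split; lra.
Qed.

(** The sign of sig decides between saddle and rotation; in the second case the trace
    a + d decides the direction of time. *)
Lemma linear_part_dichotomy (q n : nat) (sig : R) (a b c d : R -> R) :
  (1 <= n <= q)%nat -> smooth1 a -> smooth1 b -> smooth1 c -> smooth1 d ->
  bO n a -> bO n (fun e => b e - 1) -> sig <> 0 -> lead n sig c -> bO n d ->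
  let at_eps := fun (f : R -> R) t => f (tpow q 1 t) in
  finite_horizon_solvable q (at_eps a) (at_eps b) (at_eps c) (at_eps d) /\
  decay_improving q (at_eps a) (at_eps b) (at_eps c) (at_eps d).
Proof.
  intros Hn Sa Sb Sc Sd Ba Bb Hsig Lc Bd at_eps.
  assert (Hq : (0 < q)%nat) by lia.
  set (kap := Rabs sig). assert (Hk : 0 < kap) by (apply Rabs_pos_lt, Hsig).
  pose proof (coefficient_sizes q n kap sig a b c d Hn Hk Ba Bb Lc Bd) as Hsize.
  assert (Hcase : sig < 0 \/ 0 < sig) by lra.
  destruct Hcase as [Hneg|Hpos].
  - assert (HA : near_saddle q n kap (at_eps a) (at_eps b) (at_eps c) (at_eps d)).
    { intros eta He. apply (at_infinity_imp _ _) with (2 := Hsize eta He).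
      intros t (H1 & H2 & H3 & H4). cbv zeta in *. repeat split; try assumption.
      rewrite (rate_sqr q n kap t Hq Hk) in *.
      replace (kap * tpow q n t) with (- (sig * tpow q n t)) at 1 by (unfold kap; rewrite Rabs_left by lra; ring).
      exact H4. }
    split; [apply (saddle_finite_horizon q n kap)|apply (saddle_decay q n kap)]; assumption.
  - assert (Ek : kap = sig) by (unfold kap; apply Rabs_pos_eq; lra).
    assert (HA : near_center q n kap (at_eps a) (at_eps b) (at_eps c) (at_eps d)).
    { split.
      - intros eta He. apply (at_infinity_imp _ _) with (2 := Hsize eta He).
        intros t (H1 & H2 & H3 & H4). cbv zeta in *. repeat split; try assumption.
        rewrite (rate_sqr q n kap t Hq Hk) in *. rewrite Ek at 1. exact H4.
      - destruct (slow_coefficient q n a Hn Sa (smooth1_bO_Derive n a Sa Ba)) as (C1 & HC1 & H1).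
        destruct (slow_coefficient q n b Hn Sb) as (C2 & HC2 & H2).
        { apply (bO_ext _ (Derive (fun e => b e - 1))).
          - intros e. replace (Derive b e) with (Derive b e - Derive (fun _ => 1) e) by (rewrite Derive_const; ring).
            apply Derive_minus; [apply smooth1_ex_derive, Sb|apply ex_derive_const].
          - apply smooth1_bO_Derive; [|exact Bb]. apply smooth1_minus; [exact Sb|apply smooth1_const]. }
        destruct (slow_coefficient q n c Hn Sc (smooth1_bO_Derive n c Sc (lead_bO _ _ _ Lc))) as (C3 & HC3 & H3).
        destruct (slow_coefficient q n d Hn Sd (smooth1_bO_Derive n d Sd Bd)) as (C4 & HC4 & H4).
        set (dd := fun f t => - / INR q * tpow q 1 t ^ (q + 1) * Derive f (tpow q 1 t)) in *.
        exists (C1 + C2 + C3 * / kap + C4), (dd a), (dd b), (dd c), (dd d).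
        assert (Hki : 0 < / kap) by (apply Rinv_0_lt_compat; exact Hk).
        assert (HC3k : 0 <= C3 * / kap) by (apply Rmult_le_pos; lra).
        split; [lra|].
        apply (at_infinity_imp _ _) with (2 := at_infinity_and _ _ (at_infinity_and _ _ H1 H2)
          (at_infinity_and _ _ (at_infinity_and _ _ H3 H4)
            (at_infinity_and _ _ (tpow_le_rate q n kap 1 1 Hn Hk ltac:(lra)) (at_infinity_ge 1)))).
        intros t (((Da & Ea) & (Db & Eb)) & ((Dc & Ec) & (Dd & Ed)) & Hr & Ht). cbv zeta.
        pose proof (tpow_pos q n t) as Pn. pose proof (tpow_le_1 q n t Hq Ht) as Pn1.
        assert (Hti : 0 < / t) by (apply Rinv_0_lt_compat; lra).
        pose proof (rate_pos q n kap t Hk) as Hs.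
        split; [exact (conj Da (conj Db (conj Dc Dd)))|].
        assert (M : forall A B X Y, 0 <= A <= B -> 0 <= X <= Y -> A * X * / t <= B * Y * / t).
        { intros A B X Y HAB HXY. apply Rmult_le_compat_r; [lra|]. apply Rmult_le_compat; lra. }
        unfold dd. repeat split.
        + apply Rle_trans with (1 := Ea). apply M; lra.
        + apply Rle_trans with (1 := Ed). apply M; lra.
        + apply Rle_trans with (1 := Eb). rewrite <- (Rmult_1_r (C1 + C2 + C3 * / kap + C4)). apply M; lra.
        + apply Rle_trans with (1 := Ec). rewrite (rate_sqr q n kap t Hq Hk).
          replace (C3 * tpow q n t * / t) with ((C3 * / kap) * (kap * tpow q n t) * / t) by (field; lra).
          apply M; [lra|]. split; [apply Rmult_le_pos; lra|lra]. }
    destruct (trace_alternative q (fun e => a e + d e) Hq (smooth1_plus _ _ Sa Sd)) as [[C0 Htr]|Htr].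
    + split; [apply (expanding_finite_horizon q n kap C0)|apply (expanding_decay q n kap C0)]; assumption.
    + split; [apply (contracting_finite_horizon q n kap)|apply (contracting_decay q n kap)]; assumption.
Qed.

(** * Solutions that follow the formal series *)

Definition clamp (h x : R) : R := Rmax (- h) (Rmin h x).

Lemma clamp_bound (h x : R) : 0 <= h -> Rabs (clamp h x) <= h.
Proof.
  intros Hh. apply Rabs_le_between. unfold clamp.
  pose proof (Rmax_l (- h) (Rmin h x)). pose proof (Rmin_l h x).
  split; [lra|]. apply Rmax_lub; lra.
Qed.

Lemma clamp_id (h x : R) : Rabs x <= h -> clamp h x = x.
Proof.
  intros Hx. apply Rabs_le_between in Hx. unfold clamp.
  rewrite Rmin_right by lra. apply Rmax_right. lra.
Qed.

Lemma clamp_lipschitz (h k x y M : R) :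
  Rabs (h - k) <= M -> Rabs (x - y) <= M -> Rabs (clamp h x - clamp k y) <= M.
Proof.
  intros H1 H2. apply Rabs_le_between in H1, H2. apply Rabs_le_between. unfold clamp, Rmax, Rmin.
  destruct (Rle_dec h x) as [G1|G1], (Rle_dec k y) as [G2|G2];
    try apply Rnot_le_lt in G1; try apply Rnot_le_lt in G2;
    match goal with |- context [Rle_dec (- h) ?a] => destruct (Rle_dec (- h) a) as [G3|G3] end;
    match goal with |- context [Rle_dec (- k) ?a] => destruct (Rle_dec (- k) a) as [G4|G4] end;
    try apply Rnot_le_lt in G3; try apply Rnot_le_lt in G4; lra.
Qed.

Lemma continuous_clamp (h : R -> R) (x t : R) : continuous h t -> continuous (fun s => clamp (h s) x) t.
Proof.
  intros Hh. apply continuous_eps. intros eps He.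
  destruct (proj1 (continuous_eps _ _) Hh eps He) as (d & Hd & H).
  exists d. split; [exact Hd|]. intros s Hs.
  apply Rle_lt_trans with (Rabs (h s - h t)); [|apply H, Hs].
  apply clamp_lipschitz; [lra|]. replace (x - x) with 0 by ring. rewrite Rabs_R0. apply Rabs_pos.
Qed.

Lemma continuous_cont3_comp (X : R -> R -> R -> R) (p r : R -> R) (t : R) :
  cont3 X (p t) (r t) t -> continuous p t -> continuous r t -> continuous (fun s => X (p s) (r s) s) t.
Proof.
  intros HX Hp Hr. apply continuous_eps. intros eps He.
  destruct (cont3_eps X _ _ _ HX eps He) as (d & Hd & H).
  destruct (proj1 (continuous_eps _ _) Hp d Hd) as (d1 & Hd1 & H1).
  destruct (proj1 (continuous_eps _ _) Hr d Hd) as (d2 & Hd2 & H2).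
  exists (Rmin d (Rmin d1 d2)). split; [apply Rmin_glb_lt; [exact Hd|apply Rmin_glb_lt; assumption]|].
  intros s Hs. pose proof (Rmin_l d (Rmin d1 d2)). pose proof (Rmin_r d (Rmin d1 d2)).
  pose proof (Rmin_l d1 d2). pose proof (Rmin_r d1 d2).
  apply H; [apply H1|apply H2|]; lra.
Qed.

(** The remainder of the expansion is bounded only in value, and the Lipschitz
    constant only locally in time, as for F and G. *)
Record asymptotic_field (q : nat) (X : R -> R -> R -> R) (A : nat -> R -> R -> R) : Prop := {
  af_smooth : forall k, smooth2 (A k);
  af_cont : forall x y t, 0 < t -> cont3 X x y t;
  af_lip : forall r al be, 0 < al -> exists L, 0 <= L /\ forall x y x' y' t,
    Rabs x <= r -> Rabs y <= r -> Rabs x' <= r -> Rabs y' <= r -> al <= t <= be ->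
    Rabs (X x y t - X x' y' t) <= L * (Rabs (x - x') + Rabs (y - y'));
  af_exp : forall N r eps, 0 < eps -> at_infinity (fun t => forall x y, Rabs x <= r -> Rabs y <= r ->
    Rabs (X x y t - trunc A N x y (tpow q 1 t)) <= eps * tpow q N t) }.

(** Truncating the deviation (u, v) at h turns the equation for the deviation
    from (p, r) into one with a globally Lipschitz right-hand side. *)
Definition clamped_field (X : R -> R -> R -> R) (p r dz a b h : R -> R) (t u v : R) : R :=
  a t * u + b t * v +
  (X (p t + clamp (h t) u) (r t + clamp (h t) v) t - dz t - a t * clamp (h t) u - b t * clamp (h t) v).

Lemma clamped_field_ode_field (q : nat) (X : R -> R -> R -> R) (A : nat -> R -> R -> R)
    (p r dz a b h : R -> R) (T0 M : R) :
  asymptotic_field q X A -> 0 <= T0 ->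
  (forall t, T0 < t -> (continuous p t /\ continuous r t) /\ (continuous dz t /\ continuous h t) /\
                       (continuous a t /\ continuous b t)) ->
  (forall t, T0 < t -> (Rabs (p t) <= 1 /\ Rabs (r t) <= 1) /\ 0 <= h t <= 1 /\
                       (Rabs (a t) <= M /\ Rabs (b t) <= M)) ->
  ode_field T0 (clamped_field X p r dz a b h).
Proof.
  intros HX HT0 HC HB. split.
  - intros u v t Ht. destruct (HC t Ht) as ((Cp & Cr) & (Cz & Ch) & (Ca & Cb)).
    pose proof (continuous_clamp h u t Ch) as Cu. pose proof (continuous_clamp h v t Ch) as Cv.
    unfold clamped_field.
    apply (continuous_plus (fun s => a s * u + b s * v)).
    + apply (continuous_plus (fun s => a s * u) (fun s => b s * v)).
      * apply (continuous_mult a (fun _ => u)); [exact Ca|apply continuous_const].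
      * apply (continuous_mult b (fun _ => v)); [exact Cb|apply continuous_const].
    + apply (continuous_minus (fun s => X (p s + clamp (h s) u) (r s + clamp (h s) v) s - dz s - a s * clamp (h s) u)
        (fun s => b s * clamp (h s) v)); [|apply (continuous_mult b); assumption].
      apply (continuous_minus (fun s => X (p s + clamp (h s) u) (r s + clamp (h s) v) s - dz s)
        (fun s => a s * clamp (h s) u)); [|apply (continuous_mult a); assumption].
      apply (continuous_minus (fun s => X (p s + clamp (h s) u) (r s + clamp (h s) v) s) dz); [|exact Cz].
      apply (continuous_cont3_comp X (fun s => p s + clamp (h s) u) (fun s => r s + clamp (h s) v)).
      * apply (af_cont _ _ _ HX). lra.
      * apply (continuous_plus p); assumption.
      * apply (continuous_plus r); assumption.
  - intros al be Hal.
    destruct (af_lip _ _ _ HX 2 al be ltac:(lra)) as (L & HL & HLip).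
    assert (HM : 0 <= Rmax M 0) by apply Rmax_r. pose proof (Rmax_l M 0).
    set (M0 := Rmax M 0) in *.
    exists (2 * M0 + L + 1). split; [lra|].
    intros t u v u' v' Ht. destruct (HB t ltac:(lra)) as ((Bp & Br) & Bh & (Ba & Bb)).
    assert (Bc : forall x, Rabs (clamp (h t) x) <= 1).
    { intros x. eapply Rle_trans; [apply clamp_bound; lra|lra]. }
    assert (Bs : forall y x, Rabs y <= 1 -> Rabs (y + clamp (h t) x) <= 2).
    { intros y x Hy. eapply Rle_trans; [apply Rabs_triang|]. specialize (Bc x). lra. }
    assert (Lc : forall x y, Rabs (clamp (h t) x - clamp (h t) y) <= Rabs (x - y)).
    { intros x y. apply clamp_lipschitz; [|lra].
      replace (h t - h t) with 0 by ring. rewrite Rabs_R0. apply Rabs_pos. }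
    assert (HXL := HLip _ _ _ _ t (Bs _ u Bp) (Bs _ v Br) (Bs _ u' Bp) (Bs _ v' Br) Ht).
    replace (p t + clamp (h t) u - (p t + clamp (h t) u')) with (clamp (h t) u - clamp (h t) u') in HXL by ring.
    replace (r t + clamp (h t) v - (r t + clamp (h t) v')) with (clamp (h t) v - clamp (h t) v') in HXL by ring.
    unfold clamped_field.
    match goal with |- Rabs (_ + (?x1 - _ - _ - _) - (_ + (?x2 - _ - _ - _))) <= _ => set (X1 := x1) in *; set (X2 := x2) in * end.
    replace (_ - _) with (a t * (u - u') + b t * (v - v') + (X1 - X2)
       + - (a t * (clamp (h t) u - clamp (h t) u')) + - (b t * (clamp (h t) v - clamp (h t) v'))) by ring.
    pose proof (Lc u u') as Lu. pose proof (Lc v v') as Lv.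
    pose proof (Rabs_pos (u - u')). pose proof (Rabs_pos (v - v')).
    assert (A1 : Rabs (a t * (u - u')) <= M0 * Rabs (u - u')) by (apply abs_mul_le; lra).
    assert (A2 : Rabs (b t * (v - v')) <= M0 * Rabs (v - v')) by (apply abs_mul_le; lra).
    assert (A3 : Rabs (a t * (clamp (h t) u - clamp (h t) u')) <= M0 * Rabs (u - u')) by (apply abs_mul_le; lra).
    assert (A4 : Rabs (b t * (clamp (h t) v - clamp (h t) v')) <= M0 * Rabs (v - v')) by (apply abs_mul_le; lra).
    assert (A5 : Rabs (X1 - X2) <= L * (Rabs (u - u') + Rabs (v - v'))).
    { apply Rle_trans with (1 := HXL). apply Rmult_le_compat_l; lra. }
    eapply Rle_trans; [apply Rabs_triang|]. rewrite Rabs_Ropp.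
    eapply Rle_trans; [apply Rplus_le_compat_r, Rabs_triang|]. rewrite Rabs_Ropp.
    eapply Rle_trans; [apply Rplus_le_compat_r, Rplus_le_compat_r, Rabs_triang|].
    eapply Rle_trans; [apply Rplus_le_compat_r, Rplus_le_compat_r, Rplus_le_compat_r, Rabs_triang|].
    lra.
Qed.

Lemma bO_bounded_at_infinity (q : nat) (f : R -> R) :
  (0 < q)%nat -> bO 0 f -> exists M, 0 <= M /\ at_infinity (fun t => Rabs (f (tpow q 1 t)) <= M).
Proof.
  intros Hq Hf. destruct (bO_at_infinity q 0 f Hq Hf) as (M & HM & HI). exists M. split; [exact HM|].
  apply (at_infinity_imp _ _) with (2 := HI). intros t Ht. rewrite tpow_0 in Ht. lra.
Qed.

Lemma bO_1_at_infinity (q : nat) (f : R -> R) :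
  (0 < q)%nat -> bO 1 f -> at_infinity (fun t => Rabs (f (tpow q 1 t)) <= 1).
Proof.
  intros Hq Hf. destruct (bO_at_infinity q 1 f Hq Hf) as (C & HC & HI).
  apply (at_infinity_imp (fun t => Rabs (f (tpow q 1 t)) <= C * tpow q 1 t /\ C * tpow q 1 t <= 1 * tpow q 0 t)).
  - intros t [G1 G2]. rewrite tpow_0 in G2. lra.
  - apply at_infinity_and; [exact HI|apply tpow_absorb; lia || lra].
Qed.

Lemma remainder_in_tube (q i j k l : nat) (B C u v t : R) :
  (0 < q)%nat -> 1 <= t -> (j <= k + k)%nat -> (j <= k + l)%nat -> (j <= i)%nat -> 0 <= C -> 0 <= B ->
  Rabs u <= B * tpow q k t -> Rabs v <= B * tpow q k t ->
  C * ((Rabs u + Rabs v) * (Rabs u + Rabs v + tpow q l t) + tpow q i t)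
    <= C * (4 * B ^ 2 + 2 * B + 1) * tpow q j t.
Proof.
  intros Hq Ht H1 H2 H3 HC HB Hu Hv. rewrite Rmult_assoc. apply Rmult_le_compat_l; [exact HC|].
  pose proof (Rabs_pos u). pose proof (Rabs_pos v). pose proof (tpow_pos q l t).
  assert (E1 : tpow q k t * tpow q k t <= tpow q j t) by (rewrite <- tpow_add; apply tpow_le; lia || lra).
  assert (E2 : tpow q k t * tpow q l t <= tpow q j t) by (rewrite <- tpow_add; apply tpow_le; lia || lra).
  assert (E3 : tpow q i t <= tpow q j t) by (apply tpow_le; lia || lra).
  set (h := tpow q k t) in *.
  assert ((Rabs u + Rabs v) * (Rabs u + Rabs v + tpow q l t) <= (2 * (B * h)) * (2 * (B * h) + tpow q l t))
    by (apply Rmult_le_compat; lra).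
  assert (4 * B ^ 2 * (h * h) <= 4 * B ^ 2 * tpow q j t)
    by (apply Rmult_le_compat_l; [pose proof (pow2_ge_0 B); lra|exact E1]).
  assert (2 * B * (h * tpow q l t) <= 2 * B * tpow q j t) by (apply Rmult_le_compat_l; lra).
  lra.
Qed.

Lemma continuous_eps_comp (q : nat) (f : R -> R) (t : R) :
  (0 < q)%nat -> 0 < t -> smooth1 f -> continuous (fun t => f (tpow q 1 t)) t.
Proof. intros Hq Ht Hf. exact (is_derive_continuous _ _ _ (is_derive_eps_comp q f t Hq Ht Hf)). Qed.

Section Tracking.
Variables (q n : nat) (w0 nu : R) (F G : nat -> R -> R -> R) (X Y : R -> R -> R -> R) (x_ y_ : nat -> R).
Hypotheses (Hn : (1 <= n <= q)%nat) (HD : degenerate_system n w0 F G)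
  (HX : asymptotic_field q X F) (HY : asymptotic_field q Y G)
  (Hrest : restoring n w0 nu G <> 0)
  (Hgood : forall N, (n <= N)%nat -> good_to_order q n nu F G N (pol n x_ N) (pol n y_ N)).

(** The order at which the approximate solution is cut to define the linear part;
    it exceeds the loss of the linear theory. *)
Definition N0 : nat := (loss q + n)%nat.

(** The same linear part is used for approximate solutions of all orders N >= N0: its
    constants must not depend on the order, which is chosen after them. *)
Definition lin_coeff (A : nat -> R -> R -> R) (e : R) : R :=
  trunc A (N0 + n) (pol n x_ N0 e) (pol n y_ N0 e) e.

Definition eps_velocity (z : R -> R) (t : R) : R :=
  - / INR q * tpow q 1 t ^ (q + 1) * Derive z (tpow q 1 t).

Lemma small_approximants (N : nat) : (n <= N)%nat -> bO 1 (pol n x_ N) /\ bO 1 (pol n y_ N).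
Proof.
  intros HN. destruct (Hgood N HN) as (_ & _ & L & B & _).
  split; (apply (bO_weaken 1 n); [lia|]); [apply (lead_bO _ _ _ L)|exact B].
Qed.

Lemma remainder_bound (Z : R -> R -> R -> R) (A : nat -> R -> R -> R) (z : R -> R) (N : nat) :
  asymptotic_field q Z A -> (N0 <= N)%nat ->
  bO (S N) (residual q A (N + n) (pol n x_ N) (pol n y_ N) z) ->
  exists C, 0 <= C /\ at_infinity (fun t => forall u v, Rabs u <= 1 -> Rabs v <= 1 ->
    let e := tpow q 1 t in
    Rabs (Z (pol n x_ N e + u) (pol n y_ N e + v) t - eps_velocity z t
          - lin_coeff (fun k => pdx (A k)) e * u - lin_coeff (fun k => pdy (A k)) e * v)
      <= C * ((Rabs u + Rabs v) * (Rabs u + Rabs v + tpow q (S N0) t) + tpow q (S N) t)).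
Proof.
  intros HZ HN HR.
  assert (Hq : (0 < q)%nat) by lia.
  assert (HnN : (n <= N0)%nat) by (unfold N0; lia).
  destruct (trunc_linearization A (N0 + n) (N + n) 2 (af_smooth _ _ _ HZ) ltac:(lia)) as (L & HL & HB).
  destruct (bO_at_infinity q (S N) _ Hq HR) as (C1 & HC1 & H1).
  destruct (bO_at_infinity q (S N0) _ Hq (bO_pol_diff n N0 N x_ (conj HnN HN))) as (C2 & HC2 & H2).
  destruct (bO_at_infinity q (S N0) _ Hq (bO_pol_diff n N0 N y_ (conj HnN HN))) as (C3 & HC3 & H3).
  destruct (small_approximants N ltac:(lia)) as [Sx Sy].
  destruct (small_approximants N0 HnN) as [Sx0 Sy0].
  exists (L * (1 + C2 + C3 + 1) + 1 + C1).
  split. { assert (0 <= L * (1 + C2 + C3 + 1)) by (apply Rmult_le_pos; lra). lra. }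
  apply (at_infinity_imp (fun t => (((Rabs (pol n x_ N (tpow q 1 t)) <= 1 /\ Rabs (pol n y_ N (tpow q 1 t)) <= 1) /\
    (Rabs (pol n x_ N0 (tpow q 1 t)) <= 1 /\ Rabs (pol n y_ N0 (tpow q 1 t)) <= 1)) /\
    (Rabs (residual q A (N + n) (pol n x_ N) (pol n y_ N) z (tpow q 1 t)) <= C1 * tpow q (S N) t /\
     (Rabs (pol n x_ N (tpow q 1 t) - pol n x_ N0 (tpow q 1 t)) <= C2 * tpow q (S N0) t /\
      Rabs (pol n y_ N (tpow q 1 t) - pol n y_ N0 (tpow q 1 t)) <= C3 * tpow q (S N0) t))) /\
    ((forall x y, Rabs x <= 2 -> Rabs y <= 2 ->
       Rabs (Z x y t - trunc A (N + n) x y (tpow q 1 t)) <= 1 * tpow q (N + n) t) /\ 1 <= t))).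
  - intros t ((((P1 & P2) & (P3 & P4)) & (R1 & (D1 & D2))) & (E1 & Ht)) u v Hu Hv e.
    fold e in P1, P2, P3, P4, R1, D1, D2, E1.
    set (px := pol n x_ N e) in *. set (py := pol n y_ N e) in *.
    set (px0 := pol n x_ N0 e) in *. set (py0 := pol n y_ N0 e) in *.
    assert (He : 0 <= e <= 1) by (unfold e; split; [left; apply tpow_pos|apply tpow_le_1; lia || lra]).
    assert (B1 : Rabs (px + u) <= 2) by (eapply Rle_trans; [apply Rabs_triang|]; lra).
    assert (B2 : Rabs (py + v) <= 2) by (eapply Rle_trans; [apply Rabs_triang|]; lra).
    specialize (HB px py (px + u) (py + v) px0 py0 e ltac:(lra) ltac:(lra) B1 B2 ltac:(lra) ltac:(lra) He).
    specialize (E1 _ _ B1 B2).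
    replace (px + u - px) with u in HB by ring. replace (py + v - py) with v in HB by ring.
    set (D := Rabs u + Rabs v) in *.
    assert (HD0 : 0 <= D) by (unfold D; pose proof (Rabs_pos u); pose proof (Rabs_pos v); lra).
    assert (EN : tpow q (N + n) t <= tpow q (S N) t) by (apply tpow_le; lia || lra).
    assert (EK : e ^ S (N0 + n) <= tpow q (S N0) t).
    { unfold e. rewrite <- tpow_pow. apply tpow_le; lia || lra. }
    pose proof (tpow_pos q (S N0) t) as PN0. pose proof (tpow_pos q (S N) t) as PN.
    set (g0 := tpow q (S N0) t) in *. set (g := tpow q (S N) t) in *.
    unfold lin_coeff. fold px0 py0.
    set (ax := trunc (fun k => pdx (A k)) (N0 + n) px0 py0 e) in *.
    set (ay := trunc (fun k => pdy (A k)) (N0 + n) px0 py0 e) in *.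
    match type of HB with Rabs ?w <= _ => set (W := w) in * end.
    replace (Z (px + u) (py + v) t - eps_velocity z t - ax * u - ay * v)
      with ((Z (px + u) (py + v) t - trunc A (N + n) (px + u) (py + v) e) + W
            + - residual q A (N + n) (pol n x_ N) (pol n y_ N) z e)
      by (unfold W, residual, eps_velocity; fold e px py; ring).
    eapply Rle_trans; [apply Rabs_triang|]. rewrite Rabs_Ropp.
    eapply Rle_trans; [apply Rplus_le_compat_r, Rabs_triang|].
    assert (HW : Rabs W <= L * (1 + C2 + C3 + 1) * (D * (D + g0))).
    { apply Rle_trans with (1 := HB). 
      replace (L * (1 + C2 + C3 + 1) * (D * (D + g0))) with (L * D * ((1 + C2 + C3 + 1) * (D + g0))) by ring.
      apply Rmult_le_compat_l; [apply Rmult_le_pos; lra|].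
      assert (0 <= C2 * D) by (apply Rmult_le_pos; lra). assert (0 <= C3 * D) by (apply Rmult_le_pos; lra). lra. }
    assert (0 <= D * (D + g0)) by (apply Rmult_le_pos; lra).
    assert (0 <= L * (1 + C2 + C3 + 1) * g) by (apply Rmult_le_pos; [apply Rmult_le_pos; lra|lra]).
    assert (0 <= (1 + C1) * (D * (D + g0))) by (apply Rmult_le_pos; lra).
    lra.
  - apply at_infinity_and; [apply at_infinity_and|].
    + apply at_infinity_and; apply at_infinity_and; apply bO_1_at_infinity; assumption.
    + apply at_infinity_and; [exact H1|apply at_infinity_and; assumption].
    + apply at_infinity_and; [apply (af_exp _ _ _ HZ); lra|apply at_infinity_ge].
Qed.

Lemma smooth1_approximants (N : nat) : (n <= N)%nat -> smooth1 (pol n x_ N) /\ smooth1 (pol n y_ N).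
Proof. intros HN. destruct (Hgood N HN) as (S1 & S2 & _). split; assumption. Qed.

Lemma smooth1_lin_coeff (A : nat -> R -> R -> R) : (forall k, smooth2 (A k)) -> smooth1 (lin_coeff A).
Proof.
  intros HA. destruct (smooth1_approximants N0 ltac:(unfold N0; lia)) as [S1 S2].
  apply (smooth1_trunc A); assumption.
Qed.

Definition lin_a (t : R) : R := lin_coeff (fun k => pdx (F k)) (tpow q 1 t).
Definition lin_b (t : R) : R := lin_coeff (fun k => pdy (F k)) (tpow q 1 t).
Definition lin_c (t : R) : R := - lin_coeff (fun k => pdx (G k)) (tpow q 1 t).
Definition lin_d (t : R) : R := lin_coeff (fun k => pdy (G k)) (tpow q 1 t).

Lemma smooth1_opp (f : R -> R) : smooth1 f -> smooth1 (fun e => - f e).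
Proof.
  intros Hf. replace (fun e => - f e) with (fun e => (-1) * f e); [apply smooth1_scal, Hf|].
  apply functional_extensionality. intros e. ring.
Qed.

Lemma linear_part :
  finite_horizon_solvable q lin_a lin_b lin_c lin_d /\ decay_improving q lin_a lin_b lin_c lin_d.
Proof.
  destruct (Hgood N0 ltac:(unfold N0; lia)) as (_ & _ & Lp & Br & _).
  destruct (jacobian_lead q n w0 nu F G Hn HD (N0 + n) _ _ ltac:(lia) Lp Br) as (J1 & J2 & J3 & J4).
  pose proof (ds_smooth_F _ _ _ _ HD) as SF. pose proof (ds_smooth_G _ _ _ _ HD) as SG.
  apply (linear_part_dichotomy q n (restoring n w0 nu G) (lin_coeff (fun k => pdx (F k)))
    (lin_coeff (fun k => pdy (F k))) (fun e => - lin_coeff (fun k => pdx (G k)) e)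
    (lin_coeff (fun k => pdy (G k))) Hn).
  - apply smooth1_lin_coeff. intros k. apply smooth2_pdx, SF.
  - apply smooth1_lin_coeff. intros k. apply smooth2_pdy, SF.
  - apply smooth1_opp, smooth1_lin_coeff. intros k. apply smooth2_pdx, SG.
  - apply smooth1_lin_coeff. intros k. apply smooth2_pdy, SG.
  - exact J1.
  - exact J2.
  - exact Hrest.
  - apply (bO_ext _ (fun e => (-1) * (trunc (fun k => pdx (G k)) (N0 + n) (pol n x_ N0 e) (pol n y_ N0 e) e - - restoring n w0 nu G * e ^ n))).
    + intros e. unfold lin_coeff. ring.
    + apply bO_scal, J3.
  - apply (lead_bO _ _ _ J4).
Qed.

Lemma remainder_bounds (N : nat) :
  (N0 <= N)%nat ->
  exists C, 0 <= C /\ at_infinity (fun t => forall u v, Rabs u <= 1 -> Rabs v <= 1 ->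
    let px := pol n x_ N (tpow q 1 t) in let py := pol n y_ N (tpow q 1 t) in
    let M := C * ((Rabs u + Rabs v) * (Rabs u + Rabs v + tpow q (S N0) t) + tpow q (S N) t) in
    Rabs (X (px + u) (py + v) t - eps_velocity (pol n x_ N) t - lin_a t * u - lin_b t * v) <= M /\
    Rabs (Y (px + u) (py + v) t - eps_velocity (pol n y_ N) t - - lin_c t * u - lin_d t * v) <= M).
Proof.
  intros HN.
  destruct (Hgood N ltac:(unfold N0 in HN; lia)) as (_ & _ & _ & _ & RX & RY).
  destruct (remainder_bound X F (pol n x_ N) N HX HN RX) as (C1 & HC1 & B1).
  destruct (remainder_bound Y G (pol n y_ N) N HY HN
     (bO_weaken (S N) (S (N + n)) _ ltac:(lia) RY)) as (C2 & HC2 & B2).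
  exists (C1 + C2). split; [lra|].
  apply (at_infinity_imp _ _) with (2 := at_infinity_and _ _ B1 B2).
  intros t [E1 E2] u v Hu Hv. specialize (E1 u v Hu Hv). specialize (E2 u v Hu Hv). cbv zeta in *.
  set (g := (Rabs u + Rabs v) * (Rabs u + Rabs v + tpow q (S N0) t) + tpow q (S N) t) in *.
  assert (Hg : 0 <= g).
  { unfold g. pose proof (Rabs_pos u). pose proof (Rabs_pos v). pose proof (tpow_pos q (S N0) t).
    pose proof (tpow_pos q (S N) t). apply Rplus_le_le_0_compat; [apply Rmult_le_pos|]; lra. }
  assert (0 <= C1 * g) by (apply Rmult_le_pos; lra). assert (0 <= C2 * g) by (apply Rmult_le_pos; lra).
  unfold lin_c. rewrite Ropp_involutive. split; [apply Rle_trans with (1 := E1)|apply Rle_trans with (1 := E2)]; lra.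
Qed.

(** Truncating the deviation at t^(-m/q) bounds all nonlinear terms by
    t^(-(m + loss)/q) as soon as m exceeds the loss; the solution then obtained is
    so small that the truncation is inactive. *)
Lemma tracking_solution (m1 : nat) :
  exists (m N : nat) (T : R) (x y : R -> R), (m1 <= m)%nat /\ (m + N0 <= N)%nat /\ 1 <= T /\
    solves T (fun t x y => X x y t) (fun t x y => Y x y t) x y /\
    forall t, T <= t -> bounded_pair 1 (tpow q m) (fun t => x t - pol n x_ N (tpow q 1 t))
      (fun t => y t - pol n y_ N (tpow q 1 t)) t.
Proof.
  destruct linear_part as [[m0 Hfin] _].
  set (m := (m0 + loss q + 1 + m1)%nat). set (N := (N0 + 2 * m)%nat).
  assert (Hq : (0 < q)%nat) by lia.
  assert (HnN : (n <= N)%nat) by (unfold N, N0; lia).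
  destruct (smooth1_approximants N HnN) as [Sx Sy].
  destruct (remainder_bounds N ltac:(unfold N; lia)) as (C & HC & HR).
  pose proof (ds_smooth_F _ _ _ _ HD) as SF. pose proof (ds_smooth_G _ _ _ _ HD) as SG.
  pose proof (smooth1_lin_coeff _ (fun k => smooth2_pdx _ (SF k))) as Sa.
  pose proof (smooth1_lin_coeff _ (fun k => smooth2_pdy _ (SF k))) as Sb.
  pose proof (smooth1_lin_coeff _ (fun k => smooth2_pdx _ (SG k))) as Sc.
  pose proof (smooth1_lin_coeff _ (fun k => smooth2_pdy _ (SG k))) as Sd.
  destruct (bO_bounded_at_infinity q _ Hq (smooth1_bO_0 _ Sa)) as (Ma & HMa & Ia).
  destruct (bO_bounded_at_infinity q _ Hq (smooth1_bO_0 _ Sb)) as (Mb & HMb & Ib).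
  destruct (bO_bounded_at_infinity q _ Hq (smooth1_bO_0 _ Sc)) as (Mc & HMc & Ic).
  destruct (bO_bounded_at_infinity q _ Hq (smooth1_bO_0 _ Sd)) as (Md & HMd & Id).
  destruct (small_approximants N HnN) as [Bx By].
  destruct (Hfin m ltac:(unfold m; lia)) as [T1 HT1].
  set (k := (m + loss q)%nat).
  destruct (at_infinity_all _ (at_infinity_and _ _ HR
    (at_infinity_and _ _ (at_infinity_and _ _ (bO_1_at_infinity q _ Hq Bx) (bO_1_at_infinity q _ Hq By))
    (at_infinity_and _ _ (at_infinity_and _ _ (at_infinity_and _ _ Ia Ib) (at_infinity_and _ _ Ic Id))
    (at_infinity_and _ _ (tpow_absorb q k (S k) (C * (4 * 1 ^ 2 + 2 * 1 + 1)) 1 Hq ltac:(lia) ltac:(lra))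
       (at_infinity_ge T1)))))) as (T0 & HT0 & HE).
  set (h := tpow q m).
  set (p := fun t => pol n x_ N (tpow q 1 t)). set (r := fun t => pol n y_ N (tpow q 1 t)).
  set (f1 := clamped_field X p r (eps_velocity (pol n x_ N)) lin_a lin_b h).
  set (f2 := clamped_field Y p r (eps_velocity (pol n y_ N))
    (fun t => lin_coeff (fun k => pdx (G k)) (tpow q 1 t)) lin_d h).
  assert (Hh : forall t, 1 <= t -> 0 <= h t <= 1).
  { intros t Ht. split; [left; apply tpow_pos|apply tpow_le_1; lia || lra]. }
  assert (Cf : forall f t, T0 < t -> smooth1 f -> continuous (fun t => f (tpow q 1 t)) t).
  { intros f t Ht Sf. apply continuous_eps_comp; lia || lra || assumption. }
  assert (Cv : forall z t, T0 < t -> smooth1 z -> continuous (eps_velocity z) t).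
  { intros z t Ht Sz. apply (Cf (fun e => - / INR q * e ^ (q + 1) * Derive z e) t Ht).
    apply smooth1_mult; [apply smooth1_scal, smooth1_pow|apply smooth1_Derive, Sz]. }
  assert (Ch : forall t, T0 < t -> continuous h t).
  { intros t Ht. apply (is_derive_continuous _ _ _ (is_derive_tpow q m t ltac:(lra))). }
  assert (F1 : ode_field T0 f1).
  { apply (clamped_field_ode_field q X F _ _ _ _ _ _ T0 (Ma + Mb) HX ltac:(lra)).
    - intros t Ht. split; [split; apply Cf; assumption|].
      split; [split; [apply Cv; assumption|apply Ch, Ht]|split; apply Cf; assumption].
    - intros t Ht. destruct (HE t ltac:(lra)) as (_ & P & ((Pa & Pb) & _) & _).
      split; [exact P|]. split; [apply Hh; lra|]. unfold lin_a, lin_b. lra. }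
  assert (F2 : ode_field T0 f2).
  { apply (clamped_field_ode_field q Y G _ _ _ _ _ _ T0 (Mc + Md) HY ltac:(lra)).
    - intros t Ht. split; [split; apply Cf; assumption|].
      split; [split; [apply Cv; assumption|apply Ch, Ht]|split; apply Cf; assumption].
    - intros t Ht. destruct (HE t ltac:(lra)) as (_ & P & (_ & (Pc & Pd)) & _).
      split; [exact P|]. split; [apply Hh; lra|]. unfold lin_d. lra. }
  set (T := T0 + 1).
  assert (HTT1 : T1 <= T) by (unfold T; destruct (HE T0 (Rle_refl _)) as (_ & _ & _ & _ & H); lra).
  assert (Hforce : forall t u v, T <= t ->
       Rabs (f1 t u v - (lin_a t * u + lin_b t * v)) <= tpow q (m + loss q) t /\
       Rabs (f2 t u v - (- lin_c t * u + lin_d t * v)) <= tpow q (m + loss q) t).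
  { intros t u v Ht. unfold T in Ht.
    destruct (HE t ltac:(lra)) as (E & _ & _ & A1 & _).
    pose proof (Hh t ltac:(lra)) as Hht.
    pose proof (clamp_bound (h t) u (proj1 Hht)) as Cu.
    pose proof (clamp_bound (h t) v (proj1 Hht)) as Cv'.
    destruct (E _ _ (Rle_trans _ _ _ Cu (proj2 Hht)) (Rle_trans _ _ _ Cv' (proj2 Hht))) as [E1 E2].
    cbv zeta in E1, E2.
    set (cu := clamp (h t) u) in *. set (cv := clamp (h t) v) in *.
    assert (HQ := remainder_in_tube q (S N) (S k) m (S N0) 1 C cu cv t Hq ltac:(lra)
      ltac:(unfold k, m; lia) ltac:(unfold k, N0; lia) ltac:(unfold k, N, N0; lia) HC ltac:(lra)
      ltac:(fold h; lra) ltac:(fold h; lra)).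
    fold k. rewrite Rmult_1_l in A1.
    split.
    - replace (f1 t u v - (lin_a t * u + lin_b t * v)) with
        (X (p t + cu) (r t + cv) t - eps_velocity (pol n x_ N) t - lin_a t * cu - lin_b t * cv)
        by (unfold f1, clamped_field; fold cu cv; ring).
      apply Rle_trans with (1 := E1). lra.
    - replace (f2 t u v - (- lin_c t * u + lin_d t * v)) with
        (Y (p t + cu) (r t + cv) t - eps_velocity (pol n y_ N) t - - lin_c t * cu - lin_d t * cv)
        by (unfold f2, clamped_field, lin_c; fold cu cv; ring).
      apply Rle_trans with (1 := E2). lra. }
  destruct (solution_of_finite_horizons T0 T f1 f2 h F1 F2 ltac:(unfold T; lra)
     (HT1 T0 T f1 f2 HTT1 ltac:(unfold T; lra) F1 F2 Hforce)) as (u & v & HS & Huv).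
  exists m, N, T, (fun t => p t + u t), (fun t => r t + v t).
  split; [unfold m; lia|]. split; [unfold N; lia|]. split; [unfold T; lra|].
  split.
  - intros t Ht. destruct (HS t ltac:(unfold T in Ht; lra)) as [Du Dv].
    destruct (Huv t ltac:(lra)) as [Bu Bv].
    unfold f1, clamped_field in Du. unfold f2, clamped_field in Dv.
    rewrite !clamp_id in Du, Dv by assumption.
    assert (Dp := is_derive_eps_comp q (pol n x_ N) t Hq ltac:(unfold T in Ht; lra) Sx).
    assert (Dr := is_derive_eps_comp q (pol n y_ N) t Hq ltac:(unfold T in Ht; lra) Sy).
    split.
    + evar_last; [apply (is_derive_plus p u); [exact Dp|exact Du]|].
      unfold plus; simpl. unfold eps_velocity. ring.
    + evar_last; [apply (is_derive_plus r v); [exact Dr|exact Dv]|].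
      unfold plus; simpl. unfold eps_velocity. ring.
  - intros t Ht. destruct (Huv t Ht) as [Bu Bv]. unfold bounded_pair. fold (p t) (r t). rewrite Rmult_1_l.
    replace (p t + u t - p t) with (u t) by ring. replace (r t + v t - r t) with (v t) by ring.
    split; assumption.
Qed.

Lemma decay_improving_scaled (a b c d : R -> R) :
  decay_improving q a b c d ->
  exists m0, forall m u v h1 h2 C K, (m0 <= m)%nat ->
    at_infinity (linear_system a b c d u v h1 h2) ->
    at_infinity (bounded_pair C (tpow q m0) u v) ->
    at_infinity (bounded_pair K (tpow q (m + loss q)) h1 h2) ->
    exists C', at_infinity (bounded_pair C' (tpow q m) u v).
Proof.
  intros [m0 H]. exists m0. intros m u v h1 h2 C K Hm HL HU HH.
  set (s := Rabs K + 1). assert (Hs : 0 < s) by (unfold s; pose proof (Rabs_pos K); lra).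
  assert (Hsc : forall (f g : R -> R) B t, Rabs (f t) <= B * g t -> Rabs (/ s * f t) <= / s * B * g t).
  { intros f g B t Hf. rewrite Rabs_mult, Rabs_pos_eq by (left; apply Rinv_0_lt_compat; exact Hs).
    rewrite Rmult_assoc. apply Rmult_le_compat_l; [left; apply Rinv_0_lt_compat; exact Hs|exact Hf]. }
  destruct (H m (fun t => / s * u t) (fun t => / s * v t) (fun t => / s * h1 t) (fun t => / s * h2 t) (/ s * C) Hm) as (C' & HC').
  - apply (at_infinity_imp _ _) with (2 := HL). intros t [Du Dv]. split.
    + evar_last; [apply (is_derive_scal u), Du|]. ring.
    + evar_last; [apply (is_derive_scal v), Dv|]. ring.
  - apply (at_infinity_imp _ _) with (2 := HU). intros t [Bu Bv]. split; apply Hsc; assumption.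
  - apply (at_infinity_imp _ _) with (2 := HH). intros t [B1 B2].
    assert (HK : / s * K <= 1).
    { apply Rmult_le_reg_l with s; [exact Hs|]. rewrite <- Rmult_assoc, Rinv_r by lra. unfold s. pose proof (Rle_abs K). lra. }
    pose proof (tpow_pos q (m + loss q) t).
    split; (eapply Rle_trans; [apply (Hsc _ _ _ _ B1) || apply (Hsc _ _ _ _ B2)|]; apply Rmult_le_compat_r; lra).
  - exists (s * C'). apply (at_infinity_imp _ _) with (2 := HC'). intros t [B1 B2].
    assert (Hun : forall w z, Rabs (/ s * w) <= z -> Rabs w <= s * z).
    { intros w z Hw. replace w with (s * (/ s * w)) by (field; lra). rewrite Rabs_mult, (Rabs_pos_eq s) by lra.
      apply Rmult_le_compat_l; lra. }
    split; rewrite Rmult_assoc; apply Hun; assumption.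
Qed.

(** Partial sums of different orders differ by the first omitted power. *)
Lemma approximant_change (x y : R -> R) (N N' k : nat) (C : R) :
  (n <= N)%nat -> (n <= N')%nat -> (k <= S N)%nat -> (k <= S N')%nat ->
  at_infinity (bounded_pair C (tpow q k) (fun t => x t - pol n x_ N (tpow q 1 t)) (fun t => y t - pol n y_ N (tpow q 1 t))) ->
  exists C', at_infinity (bounded_pair C' (tpow q k) (fun t => x t - pol n x_ N' (tpow q 1 t)) (fun t => y t - pol n y_ N' (tpow q 1 t))).
Proof.
  intros H1 H2 Hk Hk' H. assert (Hq : (0 < q)%nat) by lia.
  assert (HB : forall a, bO k (fun e => pol n a N e - pol n a N' e)).
  { intros a. destruct (Nat.le_ge_cases N' N) as [Hle|Hle].
    - apply (bO_weaken k (S N')); [exact Hk'|apply bO_pol_diff; lia].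
    - apply (bO_ext _ (fun e => (-1) * (pol n a N' e - pol n a N e))); [intros e; ring|].
      apply bO_scal, (bO_weaken k (S N)); [exact Hk|apply bO_pol_diff; lia]. }
  destruct (bO_at_infinity q k _ Hq (HB x_)) as (D1 & HD1 & I1).
  destruct (bO_at_infinity q k _ Hq (HB y_)) as (D2 & HD2 & I2).
  exists (C + D1 + D2).
  apply (at_infinity_imp _ _) with (2 := at_infinity_and _ _ H (at_infinity_and _ _ I1 I2)).
  intros t [[B1 B2] [E1 E2]]. cbv beta in *. pose proof (tpow_pos q k t).
  assert (0 <= D1 * tpow q k t) by (apply Rmult_le_pos; lra).
  assert (0 <= D2 * tpow q k t) by (apply Rmult_le_pos; lra).
  assert (M : forall z s s', Rabs (z - s') <= Rabs (z - s) + Rabs (s - s')).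
  { intros z s s'. replace (z - s') with ((z - s) + (s - s')) by ring. apply Rabs_triang. }
  split.
  - apply Rle_trans with (1 := M _ (pol n x_ N (tpow q 1 t)) _). lra.
  - apply Rle_trans with (1 := M _ (pol n y_ N (tpow q 1 t)) _). lra.
Qed.

(** Every further step of the linear theory gains one power of t^(-1/q), up to
    the order of the approximate solution; so the solution, chosen once, follows
    the approximate solutions of all orders. *)
Lemma tracking_all_orders :
  exists (T : R) (x y : R -> R), 1 <= T /\
    solves T (fun t x y => X x y t) (fun t x y => Y x y t) x y /\
    forall N, (n <= N)%nat -> exists C, at_infinity (bounded_pair C (tpow q (S N))
      (fun t => x t - pol n x_ N (tpow q 1 t)) (fun t => y t - pol n y_ N (tpow q 1 t))).
Proof.
  assert (Hq : (0 < q)%nat) by lia.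
  destruct (decay_improving_scaled _ _ _ _ (proj2 linear_part)) as [m0 Hdec].
  destruct (tracking_solution (m0 + loss q + 1)) as (m & M & T & x & y & Hm & HM & HT & HS & HB).
  exists T, x, y. split; [exact HT|]. split; [exact HS|].
  assert (HM0 : (N0 <= M)%nat) by lia. assert (HnM : (n <= M)%nat) by (unfold N0 in HM0; lia).
  assert (Hgain : forall N' i, (M <= N')%nat -> (m + i + loss q <= S N')%nat ->
     exists C, at_infinity (bounded_pair C (tpow q (m + i)) (fun t => x t - pol n x_ N' (tpow q 1 t)) (fun t => y t - pol n y_ N' (tpow q 1 t)))).
  { intros N' i HN' Hi. induction i as [|i IH].
    - rewrite Nat.add_0_r. apply (approximant_change x y M N' m 1); try lia. exists T. exact HB.
    - destruct IH as [C HC]; [lia|].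
      destruct (smooth1_approximants N' ltac:(lia)) as [Sx Sy].
      destruct (remainder_bounds N' ltac:(lia)) as (C1 & HC1 & HR).
      set (u := fun t => x t - pol n x_ N' (tpow q 1 t)) in *.
      set (v := fun t => y t - pol n y_ N' (tpow q 1 t)) in *.
      set (h1 := fun t => X (x t) (y t) t - eps_velocity (pol n x_ N') t - lin_a t * u t - lin_b t * v t).
      set (h2 := fun t => Y (x t) (y t) t - eps_velocity (pol n y_ N') t - - lin_c t * u t - lin_d t * v t).
      set (C0 := Rabs C + 1). pose proof (Rle_abs C). pose proof (Rabs_pos C).
      replace (m + S i)%nat with (S (m + i)) by lia.
      apply (Hdec (S (m + i)) u v h1 h2 C0 (C1 * (4 * C0 ^ 2 + 2 * C0 + 1))); [lia| | |].
      + exists (T + 1). intros t Ht. destruct (HS t ltac:(lra)) as [Dx Dy].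
        assert (Dp := is_derive_eps_comp q (pol n x_ N') t Hq ltac:(lra) Sx).
        assert (Dr := is_derive_eps_comp q (pol n y_ N') t Hq ltac:(lra) Sy).
        split.
        * evar_last; [apply (is_derive_minus x (fun t => pol n x_ N' (tpow q 1 t))); [exact Dx|exact Dp]|].
          unfold minus, plus, opp; simpl. unfold h1, eps_velocity. ring.
        * evar_last; [apply (is_derive_minus y (fun t => pol n y_ N' (tpow q 1 t))); [exact Dy|exact Dr]|].
          unfold minus, plus, opp; simpl. unfold h2, eps_velocity. ring.
      + apply (at_infinity_imp _ _) with (2 := at_infinity_and _ _ HC (at_infinity_ge 1)).
        intros t [[Bu Bv] Ht].
        assert (E : tpow q (m + i) t <= tpow q m0 t) by (apply tpow_le; lia || lra).
        pose proof (tpow_pos q (m + i) t).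
        assert (C * tpow q (m + i) t <= C0 * tpow q (m + i) t) by (apply Rmult_le_compat_r; unfold C0; lra).
        assert (C0 * tpow q (m + i) t <= C0 * tpow q m0 t) by (apply Rmult_le_compat_l; unfold C0; lra).
        split; lra.
      + apply (at_infinity_imp _ _) with (2 := at_infinity_and _ _ (at_infinity_and _ _ HC HR)
          (at_infinity_and _ _ (at_infinity_ge 1) (tpow_absorb q 0 (m + i) C0 1 Hq ltac:(lia) ltac:(lra)))).
        intros t [[[Bu Bv] E] [Ht Hsm]]. rewrite tpow_0 in Hsm.
        pose proof (tpow_pos q (m + i) t) as Pm.
        assert (C * tpow q (m + i) t <= C0 * tpow q (m + i) t) by (apply Rmult_le_compat_r; unfold C0; lra).
        destruct (E (u t) (v t) ltac:(lra) ltac:(lra)) as [E1 E2]. cbv zeta in E1, E2.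
        replace (pol n x_ N' (tpow q 1 t) + u t) with (x t) in E1, E2 by (unfold u; ring).
        replace (pol n y_ N' (tpow q 1 t) + v t) with (y t) in E1, E2 by (unfold v; ring).
        assert (HQ := remainder_in_tube q (S N') (S (m + i) + loss q) (m + i) (S N0) C0 C1 (u t) (v t) t Hq Ht
          ltac:(lia) ltac:(unfold N0; lia) ltac:(lia) HC1 ltac:(unfold C0; lra) ltac:(lra) ltac:(lra)).
        split; [apply Rle_trans with (1 := E1)|apply Rle_trans with (1 := E2)]; exact HQ. }
  intros N HN.
  set (N' := (M + m + S N + loss q)%nat).
  destruct (Hgain N' (S N) ltac:(unfold N'; lia) ltac:(unfold N'; lia)) as [C HC].
  apply (approximant_change x y N' N (S N) (Rabs C)); try (unfold N'; lia).
  apply (at_infinity_imp _ _) with (2 := at_infinity_and _ _ HC (at_infinity_ge 1)).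
  intros t [[B1 B2] Ht]. cbv beta in *.
  assert (E : tpow q (m + S N) t <= tpow q (S N) t) by (apply tpow_le; lia || lra).
  pose proof (tpow_pos q (m + S N) t).
  assert (C * tpow q (m + S N) t <= Rabs C * tpow q (m + S N) t) by (apply Rmult_le_compat_r; [lra|apply Rle_abs]).
  assert (Rabs C * tpow q (m + S N) t <= Rabs C * tpow q (S N) t) by (apply Rmult_le_compat_l; [apply Rabs_pos|lra]).
  split; lra.
Qed.
End Tracking.

(** * The Hamiltonian system *)

Lemma smooth2_const (c : R) : smooth2 (fun _ _ => c).
Proof.
  intros m. revert c. induction m as [|m IH]; intros c.
  - intros x y. apply continuous_const.
  - split; [intros x y; split; apply (ex_derive_const c)|].
    split.
    + replace (pdx (fun _ _ => c)) with (fun _ _ : R => 0); [apply IH|].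
      apply functional_extensionality. intros x. apply functional_extensionality. intros y.
      symmetry. exact (Derive_const c x).
    + replace (pdy (fun _ _ => c)) with (fun _ _ : R => 0); [apply IH|].
      apply functional_extensionality. intros x. apply functional_extensionality. intros y.
      symmetry. exact (Derive_const c y).
Qed.

Lemma smooth2_snd : smooth2 (fun _ y => y).
Proof.
  intros [|m].
  - intros x y. apply continuous_snd.
  - split; [intros x y; split; [apply (ex_derive_const y)|apply (ex_derive_id y)]|].
    split.
    + replace (pdx (fun _ y => y)) with (fun _ _ : R => 0); [apply smooth2_const|].
      apply functional_extensionality. intros x. apply functional_extensionality. intros y.
      symmetry. exact (Derive_const y x).
    + replace (pdy (fun _ y => y)) with (fun _ _ : R => 1); [apply smooth2_const|].
      apply functional_extensionality. intros x. apply functional_extensionality. intros y.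
      symmetry. exact (Derive_id y).
Qed.

Lemma smooth2_opp (f : R -> R -> R) : smooth2 f -> smooth2 (fun x y => - f x y).
Proof.
  intros Hf m. specialize (Hf m). revert f Hf. induction m as [|m IH]; intros f Hf.
  - intros x y. apply (continuous_opp (fun p : R * R => f (fst p) (snd p))). apply Hf.
  - destruct Hf as (H1 & H2 & H3). split.
    + intros x y. destruct (H1 x y) as [Hx Hy]. split.
      * apply (ex_derive_opp (fun u => f u y)), Hx.
      * apply (ex_derive_opp (fun v => f x v)), Hy.
    + split.
      * replace (pdx (fun x y => - f x y)) with (fun x y => - pdx f x y); [apply IH, H2|].
        apply functional_extensionality. intros x. apply functional_extensionality. intros y.
        symmetry. exact (Derive_opp (fun u => f u y) x).
      * replace (pdy (fun x y => - f x y)) with (fun x y => - pdy f x y); [apply IH, H3|].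
        apply functional_extensionality. intros x. apply functional_extensionality. intros y.
        symmetry. exact (Derive_opp (fun v => f x v) y).
Qed.

Lemma smooth3_slice (f : R -> R -> R -> R) (s : R) :
  smooth3 (fun _ => True) f -> smooth2 (fun x y => f x y s).
Proof.
  intros Hf m. specialize (Hf m). revert f Hf. induction m as [|m IH]; intros f Hf.
  - intros x y.
    apply (continuous_comp_2 (fun p : R * R => p) (fun _ => s) (fun p s => f (fst p) (snd p) s)).
    + apply continuous_id.
    + apply continuous_const.
    + apply (Hf x y s I).
  - destruct Hf as (H1 & H2 & H3 & _). split.
    + intros x y. destruct (H1 x y s I) as (Hx & Hy & _). split; assumption.
    + split; [apply (IH _ H2)|apply (IH _ H3)].
Qed.

Lemma smooth3_Derive_x (I : R -> Prop) (f : R -> R -> R -> R) :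
  smooth3 I f -> smooth3 I (fun x y s => Derive (fun u => f u y s) x).
Proof. intros Hf m. apply (Hf (S m)). Qed.

Definition prepend (A0 : R -> R -> R) (A : nat -> R -> R -> R) (k : nat) : R -> R -> R :=
  match k with O => A0 | S _ => A k end.

Lemma prepend_pos (A0 : R -> R -> R) (A : nat -> R -> R -> R) (k : nat) :
  (1 <= k)%nat -> prepend A0 A k = A k.
Proof. intros H. destruct k as [|k]; [lia|reflexivity]. Qed.

Lemma trunc_prepend (A0 : R -> R -> R) (A : nat -> R -> R -> R) (q N : nat) (x y t : R) :
  trunc (prepend A0 A) N x y (tpow q 1 t) = A0 x y + sum_n_m (fun k => tpow q k t * A k x y) 1 N.
Proof.
  induction N as [|N IH].
  - cbn [trunc]. rewrite sum_n_m_zero by lia. change zero with 0. simpl. ring.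
  - cbn [trunc]. rewrite IH, sum_n_Sm by lia. change plus with Rplus.
    rewrite <- tpow_pow. simpl prepend. ring.
Qed.

Lemma asymptotic_field_of_perturbation (q : nat) (A0 : R -> R -> R) (F : R -> R -> R -> R) (Fk : nat -> R -> R -> R) :
  smooth2 A0 -> perturbation q F Fk ->
  asymptotic_field q (fun x y t => A0 x y + F x y t) (prepend A0 Fk).
Proof.
  intros HA (SF & SFk & _ & HE). split.
  - intros [|k]; [exact HA|]. apply SFk. lia.
  - intros x y t Ht. apply (continuous_plus (fun p : R * R * R => A0 (fst (fst p)) (snd (fst p)))).
    + apply (cont2_cont3 A0). apply (HA 0%nat).
    + apply (SF 0%nat). exact Ht.
  - intros r al be Hal.
    destruct (smooth2_lipschitz A0 r HA) as (L1 & HL1 & B1).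
    destruct (C1_lipschitz_on_box F r al be) as (L2 & HL2 & B2).
    + intros x y s Hs. destruct (SF 1%nat) as [H _]. destruct (H x y s ltac:(lra)) as (H1 & H2 & _).
      split; assumption.
    + intros x y s Hs. destruct (SF 1%nat) as (_ & H & _). apply H. lra.
    + intros x y s Hs. destruct (SF 1%nat) as (_ & _ & H & _). apply H. lra.
    + exists (L1 + L2). split; [lra|]. intros x y x' y' t Hx Hy Hx' Hy' Ht.
      specialize (B1 x y x' y' Hx Hy Hx' Hy'). specialize (B2 x y x' y' t Hx Hy Hx' Hy' Ht).
      replace (A0 x y + F x y t - (A0 x' y' + F x' y' t)) with ((A0 x y - A0 x' y') + (F x y t - F x' y' t)) by ring.
      eapply Rle_trans; [apply Rabs_triang|]. lra.
  - intros N r eps He. apply at_infinity_Rbar_locally.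
    apply (filter_imp _ _) with (2 := HE N r eps He). intros t Ht x y Hx Hy.
    rewrite trunc_prepend. specialize (Ht x y Hx Hy).
    match goal with |- Rabs ?e <= _ => replace e with (F x y t - sum_n_m (fun k => tpow q k t * Fk k x y) 1 N) by ring end.
    exact Ht.
Qed.

Lemma little_o_of_bound (q N : nat) (f : R -> R) (C : R) :
  (0 < q)%nat -> at_infinity (fun t => Rabs (f t) <= C * tpow q (S N) t) -> little_o q N f.
Proof.
  intros Hq H eps He. apply at_infinity_Rbar_locally.
  apply (at_infinity_imp (fun t => Rabs (f t) <= C * tpow q (S N) t /\ C * tpow q (S N) t <= eps * tpow q N t)).
  - intros t [H1 H2]. lra.
  - apply at_infinity_and; [exact H|apply tpow_absorb; lia || lra].
Qed.

Lemma psum_pol (q n : nat) (a : nat -> R) (N : nat) :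
  psum q n a N = fun t => pol n a N (tpow q 1 t).
Proof.
  apply functional_extensionality. intros t. unfold psum, pol. apply sum_n_m_ext.
  intros k. rewrite (tpow_pow q k). reflexivity.
Qed.

Lemma psum_empty (q n : nat) (a : nat -> R) (N : nat) : (N < n)%nat -> psum q n a N = fun _ => 0.
Proof.
  intros H. apply functional_extensionality. intros t. exact (sum_n_m_zero _ _ _ H).
Qed.

Lemma trunc_origin (A : nat -> R -> R -> R) (n N : nat) (e : R) :
  A O 0 0 = 0 -> (forall k, (1 <= k < n)%nat -> forall x y, A k x y = 0) -> (N < n)%nat -> trunc A N 0 0 e = 0.
Proof.
  intros H0 Hv HN. induction N as [|N IH]; cbn [trunc]; [exact H0|].
  rewrite IH, (Hv (S N)) by lia. ring.
Qed.

Lemma formal_residual (q n N : nat) (Z : R -> R -> R -> R) (A : nat -> R -> R -> R) (a b z : nat -> R) :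
  (1 <= n <= q)%nat -> asymptotic_field q Z A ->
  A O 0 0 = 0 -> (forall k, (1 <= k < n)%nat -> forall x y, A k x y = 0) ->
  ((n <= N)%nat -> smooth1 (pol n z N) /\ bO 1 (pol n a N) /\ bO 1 (pol n b N) /\
     bO (S N) (residual q A (N + n) (pol n a N) (pol n b N) (pol n z N))) ->
  little_o q N (fun t => Derive (psum q n z N) t - Z (psum q n a N t) (psum q n b N t) t).
Proof.
  intros Hn HZ H0 Hv Hg. assert (Hq : (0 < q)%nat) by lia.
  destruct (Nat.lt_ge_cases N n) as [Hlt|Hge].
  - rewrite !psum_empty by exact Hlt. intros eps He. apply at_infinity_Rbar_locally.
    apply (at_infinity_imp _ _) with (2 := af_exp _ _ _ HZ N 0 eps He).
    intros t Ht. assert (Hz : Rabs 0 <= 0) by (rewrite Rabs_R0; lra). specialize (Ht 0 0 Hz Hz).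
    rewrite (trunc_origin A n N) in Ht by assumption. rewrite Derive_const.
    rewrite Rminus_0_r in Ht. rewrite Rminus_0_l, Rabs_Ropp. exact Ht.
  - destruct (Hg Hge) as (Sz & Ba & Bb & BR).
    destruct (bO_at_infinity q (S N) _ Hq BR) as (C & HC & HI).
    destruct (bO_at_infinity q 1 _ Hq Ba) as (Ca & HCa & Ia). destruct (bO_at_infinity q 1 _ Hq Bb) as (Cb & HCb & Ib).
    apply (little_o_of_bound q N _ (C + 1) Hq).
    apply (at_infinity_imp _ _) with (2 := at_infinity_and _ _ (at_infinity_and _ _ HI (at_infinity_and _ _ Ia Ib))
      (at_infinity_and _ _ (af_exp _ _ _ HZ (N + n)%nat (Ca + Cb) 1 ltac:(lra)) (at_infinity_ge 1))).
    intros t ((HR & (Aa & Ab)) & (HX & Ht)).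
    rewrite !psum_pol.
    replace (Derive (fun t => pol n z N (tpow q 1 t)) t) with (- / INR q * tpow q 1 t ^ (q + 1) * Derive (pol n z N) (tpow q 1 t))
      by (symmetry; apply is_derive_unique, is_derive_eps_comp; lia || lra || assumption).
    pose proof (tpow_le_1 q 1 t Hq Ht). pose proof (tpow_pos q 1 t).
    specialize (HX (pol n a N (tpow q 1 t)) (pol n b N (tpow q 1 t)) ltac:(nra) ltac:(nra)).
    assert (E : tpow q (N + n) t <= tpow q (S N) t) by (apply tpow_le; lia || lra).
    unfold residual in HR.
    match type of HR with Rabs (?v - ?f) <= _ => match type of HX with Rabs (?z - _) <= _ =>
      replace (v - z) with ((v - f) - (z - f)) by ring end end.
    eapply Rle_trans; [apply Rabs_triang|]. rewrite Rabs_Ropp. lra.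
Qed.

Lemma expansion_of_approximations (q n : nat) (x : R -> R) (a : nat -> R) :
  (0 < q)%nat ->
  (forall N, (n <= N)%nat -> exists C, at_infinity (fun t => Rabs (x t - pol n a N (tpow q 1 t)) <= C * tpow q (S N) t)) ->
  expansion q n x a.
Proof.
  intros Hq HE N. destruct (Nat.lt_ge_cases N n) as [Hlt|Hge].
  - rewrite psum_empty by exact Hlt. destruct (HE n (Nat.le_refl n)) as [C HC].
    apply (little_o_of_bound q N _ (Rabs C + Rabs (a n)) Hq).
    apply (at_infinity_imp _ _) with (2 := at_infinity_and _ _ HC (at_infinity_ge 1)). intros t [E Ht].
    assert (P1 : tpow q (S n) t <= tpow q (S N) t) by (apply tpow_le; lia || lra).
    assert (P2 : tpow q n t <= tpow q (S N) t) by (apply tpow_le; lia || lra).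
    rewrite pol_n, <- tpow_pow in E. pose proof (tpow_pos q (S n) t). pose proof (tpow_pos q n t).
    replace (x t - 0) with ((x t - a n * tpow q n t) + a n * tpow q n t) by ring.
    eapply Rle_trans; [apply Rabs_triang|]. rewrite (Rabs_mult (a n)), (Rabs_pos_eq (tpow q n t)) by lra.
    assert (C * tpow q (S n) t <= Rabs C * tpow q (S n) t) by (apply Rmult_le_compat_r; [lra|apply Rle_abs]).
    assert (Rabs C * tpow q (S n) t <= Rabs C * tpow q (S N) t) by (apply Rmult_le_compat_l; [apply Rabs_pos|lra]).
    assert (Rabs (a n) * tpow q n t <= Rabs (a n) * tpow q (S N) t) by (apply Rmult_le_compat_l; [apply Rabs_pos|lra]).
    lra.
  - rewrite psum_pol. destruct (HE N Hge) as [C HC]. exact (little_o_of_bound q N _ C Hq HC).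
Qed.

(** The hypothesis on [restoring] says that nu is a simple root of the equation for
    the leading coefficient. *)
Lemma expansion_solution_exists (q n : nat) (w0 nu : R) (A B : nat -> R -> R -> R) (X Y : R -> R -> R -> R) :
  (1 <= n <= q)%nat -> degenerate_system n w0 A B -> asymptotic_field q X A -> asymptotic_field q Y B ->
  restoring n w0 nu B <> 0 ->
  w0 * nu ^ 2 - pdx (B n) 0 0 * nu - B (2 * n)%nat 0 0 + (pdy (B n) 0 0 + resonance q n) * A n 0 0 = 0 ->
  exists (T : R) (x y : R -> R), 1 <= T /\ has_expansion_solution q n X Y nu T x y.
Proof.
  intros Hn HD HX HY Hr Hnu. assert (Hq : (0 < q)%nat) by lia.
  destruct (formal_series q n w0 nu A B Hn HD Hr Hnu) as (a & b & Ha & Hgood).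
  destruct (tracking_all_orders q n w0 nu A B X Y a b Hn HD HX HY Hr Hgood) as (T & x & y & HT & HS & HE).
  exists T, x, y. split; [exact HT|]. split; [exact HS|].
  exists a, b. split; [exact Ha|].
  split; [|split].
  - apply (expansion_of_approximations q n x a Hq). intros N HN. destruct (HE N HN) as [C HC].
    exists C. apply (at_infinity_imp _ _) with (2 := HC). intros t [E _]. exact E.
  - apply (expansion_of_approximations q n y b Hq). intros N HN. destruct (HE N HN) as [C HC].
    exists C. apply (at_infinity_imp _ _) with (2 := HC). intros t [_ E]. exact E.
  - destruct HD as [_ _ A0 AV BV _ (C & _ & B0)].
    assert (HB00 : B O 0 0 = 0).
    { destruct (B0 0 0 ltac:(rewrite Rabs_R0; lra)) as [E _].
      replace (B O 0 0 + w0 * 0 ^ 2) with (B O 0 0) in E by ring. rewrite Rabs_R0 in E.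
      apply Rabs_le_between in E. simpl in E. lra. }
    intros N.
    pose proof (small_approximants q n nu A B a b Hn Hgood N) as Hsmall.
    split.
    + apply (formal_residual q n N X A a b a Hn HX (A0 0 0) AV). intros HN.
      destruct (Hgood N HN) as (S1 & _ & _ & _ & R1 & _). destruct (Hsmall HN). auto.
    + apply (formal_residual q n N Y B a b b Hn HY HB00 BV). intros HN.
      destruct (Hgood N HN) as (_ & S2 & _ & _ & _ & R2). destruct (Hsmall HN).
      repeat split; try assumption. apply (bO_weaken _ (S (N + n))); [lia|exact R2].
Qed.

Lemma leading_coefficient_unique (q n : nat) (x x' : R -> R) (a a' : nat -> R) (T : R) :
  expansion q n x a -> expansion q n x' a' -> a n <> a' n -> exists t, T < t /\ x t <> x' t.
Proof.
  intros E E' Hne.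
  set (eps := Rabs (a n - a' n) / 4).
  assert (Hp : 0 < Rabs (a n - a' n)) by (apply Rabs_pos_lt; lra).
  assert (He : 0 < eps) by (unfold eps; lra).
  destruct (filter_and _ _ (E n eps He) (E' n eps He)) as [M HM].
  set (t := Rmax M T + 1). pose proof (Rmax_l M T). pose proof (Rmax_r M T).
  exists t. split; [unfold t; lra|]. intros Heq.
  destruct (HM t ltac:(unfold t; lra)) as [H1 H2].
  rewrite Heq in H1. unfold psum in H1, H2. rewrite !sum_n_n in H1, H2.
  pose proof (tpow_pos q n t) as Pt.
  assert (Hd : Rabs (tpow q n t * (a n - a' n)) <= 2 * eps * tpow q n t).
  { replace (tpow q n t * (a n - a' n)) with ((x' t - tpow q n t * a' n) - (x' t - tpow q n t * a n)) by ring.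
    eapply Rle_trans; [apply Rabs_triang|]. rewrite Rabs_Ropp. lra. }
  rewrite Rabs_mult, Rabs_pos_eq in Hd by lra.
  assert (Hc : Rabs (a n - a' n) <= 2 * eps).
  { apply Rmult_le_reg_r with (tpow q n t); [exact Pt|]. lra. }
  unfold eps in Hc. lra.
Qed.

Lemma has_expansion_solution_mono (q n : nat) (f g : R -> R -> R -> R) (nu T T' : R) (x y : R -> R) :
  T <= T' -> has_expansion_solution q n f g nu T x y -> has_expansion_solution q n f g nu T' x y.
Proof.
  intros HT [HS HE]. split; [|exact HE]. intros t Ht. apply HS. lra.
Qed.

Section Hamiltonian.
Variables (H : R -> R -> R -> R) (V : R -> R -> R) (w : R -> R).
Hypotheses (Hsmooth : smooth3 (fun _ => True) H)
  (HH : forall x y lam : R, H x y lam = y ^ 2 / 2 + V x lam)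
  (HV : forall x lam : R, is_derive (fun u => V u lam) x ((x ^ 2 - lam) * w x)).

Lemma Derive_H_y (x y lam : R) : Derive (fun v => H x v lam) y = y.
Proof.
  rewrite (Derive_ext _ (fun v => v ^ 2 / 2 + V x lam)) by (intros v; apply HH).
  apply is_derive_unique. auto_derive; [exact I|]. field.
Qed.

Lemma Derive_H_x (x y lam : R) : Derive (fun u => H u y lam) x = (x ^ 2 - lam) * w x.
Proof.
  rewrite (Derive_ext _ (fun u => y ^ 2 / 2 + V u lam)) by (intros u; apply HH).
  apply is_derive_unique. rewrite <- (Rplus_0_l ((x ^ 2 - lam) * w x)).
  apply (is_derive_plus (fun _ => y ^ 2 / 2) (fun u => V u lam)); [apply (is_derive_const (y ^ 2 / 2))|apply HV].
Qed.

Definition force (x y : R) : R := - Derive (fun u => H u y 0) x.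

Lemma smooth2_force : smooth2 force.
Proof. apply smooth2_opp, (smooth3_slice (fun x y s => Derive (fun u => H u y s) x) 0), smooth3_Derive_x, Hsmooth. Qed.

Lemma force_eq (x y : R) : force x y = - (x ^ 2 * w x).
Proof. unfold force. rewrite Derive_H_x. ring. Qed.

(** w is the difference of dH/dx at two values of the parameter, hence smooth. *)
Lemma w_C1 : exists (w' : R -> R) (C : R), 0 <= C /\
  forall x, Rabs x <= 1 -> is_derive w x (w' x) /\ Rabs (w' x) <= C /\ Rabs (w x - w 0) <= C * Rabs x.
Proof.
  set (h := fun s x y => Derive (fun u => H u y s) x).
  assert (Sh : forall s, smooth2 (h s)).
  { intros s. apply (smooth3_slice (fun x y s => Derive (fun u => H u y s) x) s), smooth3_Derive_x, Hsmooth. }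
  assert (Ew : forall x, w x = h 0 x 0 - h 1 x 0) by (intros x; unfold h; rewrite !Derive_H_x; ring).
  destruct (smooth2_lipschitz (pdx (h 0)) 1 (smooth2_pdx _ (Sh 0))) as (L0 & HL0 & B0).
  destruct (smooth2_lipschitz (pdx (h 1)) 1 (smooth2_pdx _ (Sh 1))) as (L1 & HL1 & B1).
  set (C := Rabs (pdx (h 0) 0 0) + Rabs (pdx (h 1) 0 0) + L0 + L1).
  pose proof (Rabs_pos (pdx (h 0) 0 0)). pose proof (Rabs_pos (pdx (h 1) 0 0)).
  assert (HC : 0 <= C) by (unfold C; lra).
  assert (Hz : Rabs 0 <= 1) by (rewrite Rabs_R0; lra).
  assert (Hd : forall x, is_derive w x (pdx (h 0) x 0 - pdx (h 1) x 0)).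
  { intros x. apply (is_derive_ext (fun x => h 0 x 0 - h 1 x 0)); [intros u; symmetry; apply Ew|].
    apply (is_derive_minus (fun x => h 0 x 0) (fun x => h 1 x 0)).
    - exact (Derive_correct _ _ (proj1 (smooth2_ex_derive (h 0) x 0 (Sh 0)))).
    - exact (Derive_correct _ _ (proj1 (smooth2_ex_derive (h 1) x 0 (Sh 1)))). }
  assert (Hb : forall x, Rabs x <= 1 -> Rabs (pdx (h 0) x 0 - pdx (h 1) x 0) <= C).
  { intros x Hx. specialize (B0 x 0 0 0 Hx Hz Hz Hz). specialize (B1 x 0 0 0 Hx Hz Hz Hz).
    replace (0 - 0) with 0 in B0, B1 by ring. rewrite Rabs_R0, Rminus_0_r, Rplus_0_r in B0, B1.
    assert (L0 * Rabs x <= L0 * 1) by (apply Rmult_le_compat_l; lra).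
    assert (L1 * Rabs x <= L1 * 1) by (apply Rmult_le_compat_l; lra).
    replace (pdx (h 0) x 0 - pdx (h 1) x 0) with ((pdx (h 0) x 0 - pdx (h 0) 0 0) + - (pdx (h 1) x 0 - pdx (h 1) 0 0)
       + pdx (h 0) 0 0 + - pdx (h 1) 0 0) by ring.
    eapply Rle_trans; [apply Rabs_triang|]. rewrite Rabs_Ropp.
    eapply Rle_trans; [apply Rplus_le_compat_r, Rabs_triang|].
    eapply Rle_trans; [apply Rplus_le_compat_r, Rplus_le_compat_r, Rabs_triang|]. rewrite Rabs_Ropp. unfold C. lra. }
  exists (fun x => pdx (h 0) x 0 - pdx (h 1) x 0), C. split; [exact HC|].
  intros x Hx. split; [apply Hd|]. split; [apply Hb, Hx|].
  rewrite <- (Rminus_0_r x) at 2. apply (mvt_lipschitz w 0 x). intros z Hz'.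
  split; [eexists; apply Hd|].
  replace (Derive w z) with (pdx (h 0) z 0 - pdx (h 1) z 0) by (symmetry; apply is_derive_unique, Hd).
  apply Hb. apply (between_abs 0 x); assumption.
Qed.

Lemma force_degenerate : exists C, 0 <= C /\ forall x y, Rabs x <= 1 ->
  Rabs (force x y + w 0 * x ^ 2) <= C * Rabs x ^ 3 /\
  Rabs (pdx force x y + 2 * w 0 * x) <= C * Rabs x ^ 2 /\ pdy force x y = 0.
Proof.
  destruct w_C1 as (w' & C & HC & Hw).
  exists (3 * C). split; [lra|]. intros x y Hx. destruct (Hw x Hx) as (Dw & Bw' & Bw).
  assert (Hx2 : 0 <= Rabs x ^ 2) by (apply pow_le, Rabs_pos).
  assert (Hx3 : 0 <= Rabs x ^ 3) by (apply pow_le, Rabs_pos).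
  split; [|split].
  - rewrite force_eq. replace (- (x ^ 2 * w x) + w 0 * x ^ 2) with (- (x ^ 2 * (w x - w 0))) by ring.
    rewrite Rabs_Ropp, Rabs_mult, <- RPow_abs.
    assert (Rabs x ^ 2 * Rabs (w x - w 0) <= Rabs x ^ 2 * (C * Rabs x)) by (apply Rmult_le_compat_l; lra).
    replace (Rabs x ^ 2 * (C * Rabs x)) with (C * Rabs x ^ 3) in * by ring.
    assert (0 <= C * Rabs x ^ 3) by (apply Rmult_le_pos; lra). lra.
  - assert (E : pdx force x y = - (2 * x * w x + x ^ 2 * w' x)).
    { unfold pdx. rewrite (Derive_ext _ (fun u => - (u ^ 2 * w u))) by (intros u; apply force_eq).
      apply is_derive_unique. apply (is_derive_opp (fun u => u ^ 2 * w u)). evar_last.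
      - apply (is_derive_mult (fun u => u ^ 2) w); [|exact Dw|exact Rmult_comm].
        apply (is_derive_pow (fun u => u) 2). apply is_derive_id.
      - change one with 1. unfold plus, mult; simpl. ring. }
    rewrite E. replace (- (2 * x * w x + x ^ 2 * w' x) + 2 * w 0 * x) with (- (2 * x * (w x - w 0) + x ^ 2 * w' x)) by ring.
    rewrite Rabs_Ropp. eapply Rle_trans; [apply Rabs_triang|]. rewrite !Rabs_mult, <- RPow_abs, (Rabs_pos_eq 2) by lra.
    pose proof (Rabs_pos x).
    assert (Rabs x ^ 2 * Rabs (w' x) <= Rabs x ^ 2 * C) by (apply Rmult_le_compat_l; lra).
    assert (2 * Rabs x * Rabs (w x - w 0) <= 2 * Rabs x * (C * Rabs x)) by (apply Rmult_le_compat_l; lra). nra.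
  - unfold pdy. rewrite (Derive_ext _ (fun _ => - (x ^ 2 * w x))) by (intros v; apply force_eq). apply Derive_const.
Qed.
End Hamiltonian.

Theorem theorem3
  (H : R -> R -> R -> R) (V : R -> R -> R) (w : R -> R) (d0 : R)
  (F G : R -> R -> R -> R) (Fk Gk : nat -> R -> R -> R) (q n : nat)
  (Hsmooth : smooth3 (fun _ => True) H)
  (HH : forall x y lam : R, H x y lam = y ^ 2 / 2 + V x lam)
  (HV : forall x lam : R, is_derive (fun u => V u lam) x ((x ^ 2 - lam) * w x))
  (hd0 : 0 < d0)
  (hw : forall x lam : R,
     (0 <= lam /\ Rabs x < sqrt lam + d0) \/ (lam < 0 /\ Rabs x < d0) ->
     0 < w x)
  (hq : (0 < q)%nat)
  (HF : perturbation q F Fk)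
  (HG : perturbation q G Gk)
  (hn : (1 <= n <= q)%nat)
  (HF0 : forall i, (1 <= i < n)%nat -> forall x y, Fk i x y = 0)
  (HG0 : forall i, (1 <= i < n)%nat -> forall x y, Gk i x y = 0)
  (HGl : forall l, (l < n)%nat -> Gk (n + l)%nat 0 0 = 0)
  (Hnz : Gk (2 * n)%nat 0 0 - Fk n 0 0 * (pdy (Gk n) 0 0 + kron n q) <> 0)
  (HDelta : 0 < Delta_n q n (w 0) Fk Gk) :
  exists (T : R) (xp yp xm ym : R -> R),
    0 < T /\
    has_expansion_solution q n (xrhs H 0 F) (yrhs H 0 G)
      (1 / (2 * w 0) * (pdx (Gk n) 0 0 + sqrt (Delta_n q n (w 0) Fk Gk)))
      T xp yp /\
    has_expansion_solution q n (xrhs H 0 F) (yrhs H 0 G)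
      (1 / (2 * w 0) * (pdx (Gk n) 0 0 - sqrt (Delta_n q n (w 0) Fk Gk)))
      T xm ym /\
    (exists t, T < t /\ (xp t, yp t) <> (xm t, ym t)).
Proof.
  assert (Hw0 : 0 < w 0).
  { apply (hw 0 0). left. rewrite Rabs_R0, sqrt_0. lra. }
  set (A := prepend (fun _ y => y) Fk). set (B := prepend (force H) Gk).
  assert (EX : xrhs H 0 F = fun x y t => y + F x y t).
  { do 3 (apply functional_extensionality; intros ?). unfold xrhs. rewrite (Derive_H_y H V HH). reflexivity. }
  assert (HX : asymptotic_field q (xrhs H 0 F) A).
  { rewrite EX. apply (asymptotic_field_of_perturbation q (fun _ y => y)); [apply smooth2_snd|exact HF]. }
  assert (HY : asymptotic_field q (yrhs H 0 G) B).
  { apply (asymptotic_field_of_perturbation q (force H)); [apply smooth2_force, Hsmooth|exact HG]. }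
  assert (HD : degenerate_system n (w 0) A B).
  { split.
    - apply (af_smooth _ _ _ HX).
    - apply (af_smooth _ _ _ HY).
    - reflexivity.
    - intros k Hk. unfold A. rewrite prepend_pos by lia. apply HF0, Hk.
    - intros k Hk. unfold B. rewrite prepend_pos by lia. apply HG0, Hk.
    - intros k Hk. unfold B. rewrite prepend_pos by lia. replace k with (n + (k - n))%nat by lia. apply HGl. lia.
    - apply (force_degenerate H V w Hsmooth HH HV). }
  set (S := sqrt (Delta_n q n (w 0) Fk Gk)).
  assert (HS : 0 < S) by (apply sqrt_lt_R0, HDelta).
  assert (HS2 : S ^ 2 = Delta_n q n (w 0) Fk Gk) by (apply pow2_sqrt; lra).
  unfold Delta_n in HS2.
  assert (Hroot : forall s, s ^ 2 = S ^ 2 -> s <> 0 ->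
     exists (T : R) (x y : R -> R), 1 <= T /\ has_expansion_solution q n (xrhs H 0 F) (yrhs H 0 G)
        (1 / (2 * w 0) * (pdx (Gk n) 0 0 + s)) T x y).
  { intros s Hs Hs0.
    apply (expansion_solution_exists q n (w 0) _ A B); try assumption.
    - unfold restoring, B. rewrite prepend_pos by lia. intros E. apply Hs0. rewrite <- E. field. lra.
    - unfold A, B. rewrite !prepend_pos by lia. change (resonance q n) with (kron n q).
      replace (w 0 * (1 / (2 * w 0) * (pdx (Gk n) 0 0 + s)) ^ 2 - pdx (Gk n) 0 0 * (1 / (2 * w 0) * (pdx (Gk n) 0 0 + s)))
        with ((s ^ 2 - pdx (Gk n) 0 0 ^ 2) / (4 * w 0)) by (field; lra).
      rewrite Hs, HS2. field. lra. }
  destruct (Hroot S eq_refl ltac:(lra)) as (T1 & xp & yp & HT1 & HP).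
  destruct (Hroot (- S) ltac:(ring) ltac:(lra)) as (T2 & xm & ym & HT2 & HM).
  pose proof (Rmax_l T1 T2). pose proof (Rmax_r T1 T2).
  exists (Rmax T1 T2), xp, yp, xm, ym.
  split; [lra|].
  split; [apply (has_expansion_solution_mono _ _ _ _ _ T1); [lra|exact HP]|].
  split; [apply (has_expansion_solution_mono _ _ _ _ _ T2); [lra|exact HM]|].
  destruct HP as (_ & a & b & Ha & Ea & _). destruct HM as (_ & a' & b' & Ha' & Ea' & _).
  destruct (leading_coefficient_unique q n xp xm a a' (Rmax T1 T2) Ea Ea') as (t & Ht & Hne).
  - rewrite Ha, Ha'. intros E.
    assert (Hi : 0 < 1 / (2 * w 0)) by (apply Rdiv_lt_0_compat; lra).
    apply Rmult_eq_reg_l in E; lra.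
  - exists t. split; [exact Ht|]. intros E. apply Hne. congruence.
Qed.
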